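(* Let $G$ be a Łojasiewicz function, with associated distribution $\mathsf G$. Let $\mathsf g=\mathsf G'$, and suppose that the distributional point values $g(x)=\mathsf g(x)$ exist for all $x\in[a,b]\setminus E$, where $E$ is a set with $|E|\le\aleph_0$. Then $g$ is distributionally integrable over $[a,b]$ and $$(\mathfrak{dist})\int_c^dg(x)\,dx=G(d)-G(c)$$ for every $[c,d]\subset[a,b]$.
   Context: Distributions are real. Notation: $\overline{\mathbb R}=\mathbb R\cup\{-\infty,\infty\}$; $\mathcal E'[a,b]$ is the space of distributions on $\mathbb R$ with support contained in $[a,b]$; $\langle \mathsf h(x+ty),\phi(y)\rangle:=|t|^{-1}\langle \mathsf h(y),\phi((y-x)/t)\rangle$ for $t\ne0$. Point values. For $\mathsf h\in\mathcal D'(\mathbb R)$, the distributional (Łojasiewicz) point value $\mathsf h(x_0)$ exists and equals $\gamma\in\mathbb R$ if $\lim_{\varepsilon\to0}\langle \mathsf h(x_0+\varepsilon y),\phi(y)\rangle=\gamma\int_{-\infty}^\infty\phi(y)\,dy$ for every $\phi\in\mathcal D(\mathbb R)$. A Łojasiewicz distribution is one having a point value at every point of $\mathbb R$. A function $G:\mathbb R\to\mathbb R$ is a Łojasiewicz function if there is a (necessarily unique) Łojasiewicz distribution $\mathsf G$ with $\mathsf G(x)=G(x)$ for all $x\in\mathbb R$; $\mathsf G$ is the distribution associated to $G$. Test classes. $\mathcal T_0$: functions $\phi\in C^\infty(\mathbb R)$, $\phi\ge0$, $\int\phi=1$, such that for some $\alpha<-1$, $\phi^{(m)}(x)=O(|x|^{\alpha-m})$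 as $|x|\to\infty$ for all $m\ge0$. $\mathcal T_1$: those $\phi\in\mathcal T_0$ with $x\phi'(x)\le0$ for all $x$. For $\mathsf h\in\mathcal E'(\mathbb R)$, $\phi\in\mathcal T_0$: $\mathsf h^{+}_{\phi,0}(x)=\limsup_{t\to0^+}\langle \mathsf h(x+ty),\phi(y)\rangle$ and $\mathsf h^{-}_{\phi,0}(x)=\liminf_{t\to0^+}\langle \mathsf h(x+ty),\phi(y)\rangle$. Integral. Let $f:[a,b]\to\overline{\mathbb R}$. A major distributional pair $(\mathsf u,\mathsf U)$ for $f$ consists of $\mathsf u\in\mathcal E'[a,b]$ and a Łojasiewicz distribution $\mathsf U$ with $\mathsf U'=\mathsf u$, $\mathsf U(a)=0$, such that there exist a countable set $E$ and a Lebesgue null set $Z$ with $\mathsf u^-_{\phi,0}(x)\ge f(x)$ for all $x\in[a,b]\setminus Z$, $\phi\in\mathcal T_0$, and $\mathsf u^-_{\phi,0}(x)>-\infty$ for all $x\in[a,b]\setminus E$, $\phi\in\mathcal T_1$. A minor distributional pair $(\mathsf v,\mathsf V)$ for $f$ consists of $\mathsf v\in\mathcal E'[a,b]$ and a Łojasiewicz distribution $\mathsf V$ with $\mathsf V'=\mathsf v$, $\mathsf V(a)=0$, such that there exist a countable set $E$ and a null set $Z$ with $\mathsf v^+_{\phi,0}(x)\le f(x)$ for all $x\in[a,b]\setminus Z$, $\phi\in\mathcal T_0$, and $\mathsf v^+_{\phi,0}(x)<\infty$ for all $x\in[a,b]\setminus E$, $\phi\in\mathcal T_1$. The function $f$ is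 distributionally integrable over $[a,b]$ if it has both major and minor pairs and $\sup\mathsf V(b)=\inf\mathsf U(b)$ (sup over minor pairs, inf over major pairs); the common value is $(\mathfrak{dist})\int_a^bf(x)\,dx$. Integrability and the integral do not change if $f$ is modified on a null set, so a function defined almost everywhere is integrated by assigning it arbitrary values where it is not defined. *)

(* Defs.v *)
From HB Require Import structures.
From mathcomp Require Import all_boot all_order all_algebra.
From mathcomp Require Import all_classical all_reals all_analysis.

Set Implicit Arguments.
Unset Strict Implicit.
Unset Printing Implicit Defensive.

Import Order.TTheory GRing.Theory Num.Theory.
Import numFieldNormedType.Exports.

Local Open Scope ring_scope.
Local Open Scope classical_set_scope.

Section test_functions.
Context {R : realType}.
Implicit Types phi : R -> R.

Definition smooth phi : Prop :=
  forall (n : nat) (x : R), derivable (phi^`(n)) x 1.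

Definition tsupp phi : set R := closure [set x | phi x != 0].

Definition test_function phi : Prop := smooth phi /\ compact (tsupp phi).

Lemma derive1nSr phi n : (phi^`())^`(n) = phi^`(n.+1).
Proof. by rewrite /derive1n iterSr. Qed.

Lemma smooth_derive1 phi : smooth phi -> smooth phi^`().
Proof. by move=> sphi n x; rewrite derive1nSr; exact: sphi. Qed.

Lemma tsupp_derive1 phi : tsupp phi^`() `<=` tsupp phi.
Proof.
rewrite [X in _ `<=` X](closure_id _).1; last exact: closed_closure.
apply: closureS => y /= dy0; apply: contrapT => ny.
have : nbhs y (~` tsupp phi).
  by apply: open_nbhs_nbhs; split => //; exact/closed_openC/closed_closure.
move=> nby; move/eqP: dy0; apply.
rewrite derive1E -(derive_cst (0 : R) y 1); apply: near_eq_derive.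
apply: filterS nby => z nz; apply/eqP; apply: contrapT => /negP pz.
by apply: nz; exact: subset_closure.
Qed.

Lemma test_function_derive1 phi : test_function phi -> test_function phi^`().
Proof.
move=> [sphi cphi]; split; first exact: smooth_derive1.
apply: subclosed_compact cphi _; first exact: closed_closure.
exact: tsupp_derive1.
Qed.

End test_functions.

(* An element of D'(R) is represented by a functional on all of R -> R; only
   its values on test functions are meaningful, so that distributions are
   compared with [dist_eq] and not with Leibniz equality. Continuity is the
   usual seminorm criterion: for every compact K there are m and C such that
   `|h phi| <= C * sup_(k <= m) sup_x `|phi^`(k) x| when phi is supported in K. *)
Record schwartz_distribution (R : realType) := SchwartzDistribution {
  dist_fun :> (R -> R) -> R ;
  dist_linear : forall (c : R) (phi psi : R -> R),
    test_function phi -> test_function psi ->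
    dist_fun (fun x => c * phi x + psi x) = c * dist_fun phi + dist_fun psi ;
  dist_continuous : forall K : set R, compact K ->
    exists (m : nat) (C : R), forall (phi : R -> R) (B : R),
      test_function phi -> tsupp phi `<=` K ->
      (forall (k : nat) (x : R), (k <= m)%N -> `|(phi^`(k)) x| <= B) ->
      `|dist_fun phi| <= C * B }.

Definition dist_eq (R : realType) (h1 h2 : schwartz_distribution R) : Prop :=
  forall phi : R -> R, test_function phi -> h1 phi = h2 phi.

Section distributional_derivative.
Context {R : realType} (h : schwartz_distribution R).

Let dh (phi : R -> R) : R := - h (phi^`()).

Let dh_linear (c : R) (phi psi : R -> R) :
  test_function phi -> test_function psi ->
  dh (fun x => c * phi x + psi x) = c * dh phi + dh psi.
Proof.
move=> tphi tpsi; rewrite /dh.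
have -> : (fun x => c * phi x + psi x)^`() =
          (fun x => c * derive1 phi x + derive1 psi x).
  apply/funext => x; rewrite !derive1E.
  have dphi : derivable phi x 1 by exact: (tphi.1 0%N x).
  have dpsi : derivable psi x 1 by exact: (tpsi.1 0%N x).
  rewrite (_ : (fun x => _) = (c \*: phi) + psi)//.
  rewrite deriveD ?deriveZ//.
  exact: derivableZ.
by rewrite dist_linear ?opprD ?mulrN//; exact: test_function_derive1.
Qed.

Let dh_continuous (K : set R) : compact K ->
  exists (m : nat) (C : R), forall (phi : R -> R) (B : R),
    test_function phi -> tsupp phi `<=` K ->
    (forall (k : nat) (x : R), (k <= m)%N -> `|(phi^`(k)) x| <= B) ->
    `|dh phi| <= C * B.
Proof.
move=> /(dist_continuous h)[m [C hC]]; exists m.+1, C => phi B tphi sK hB.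
rewrite /dh normrN; apply: hC.
- exact: test_function_derive1.
- by apply: subset_trans sK; exact: tsupp_derive1.
- by move=> k x km; rewrite derive1nSr; exact: hB.
Qed.

Definition dist_derive : schwartz_distribution R :=
  SchwartzDistribution dh_linear dh_continuous.

End distributional_derivative.

Section supports.
Context {R : realType}.
Implicit Types (h : schwartz_distribution R) (a b x : R) (phi : R -> R).

Definition dist_vanishes_on h (V : set R) : Prop :=
  forall phi, test_function phi -> tsupp phi `<=` V -> h phi = 0.

Definition dist_supp h : set R :=
  ~` [set x | exists2 V, open_nbhs x V & dist_vanishes_on h V].

Definition supported_in h a b : Prop := dist_supp h `<=` `[a, b].

(* The pairing of a compactly supported distribution with a smooth function
   phi: the value of h at chi * phi, where chi is any test function equal to 1
   on a neighborhood of the support of h. *)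
Definition compact_pairing h phi : R :=
  xget 0 [set c | exists chi : R -> R,
    [/\ test_function chi,
        exists V : set R, [/\ open V, dist_supp h `<=` V &
                              forall x, V x -> chi x = 1]
      & c = h (fun x => chi x * phi x)]].

(* <h(x + t y), phi(y)> = |t|^-1 <h(y), phi((y - x) / t)>, for the pairing
   <h, _> of h with either test functions or smooth functions. *)
Definition affine_pairing (pairing : (R -> R) -> R) x (t : R) phi : R :=
  `|t|^-1 * pairing (fun y => phi ((y - x) / t)).

End supports.

Section point_values.
Context {R : realType}.
Implicit Types (h : schwartz_distribution R) (x gamma : R) (G : R -> R).

Definition point_value h x gamma : Prop :=
  forall phi : R -> R, test_function phi ->
    affine_pairing h x e phi @[e --> 0^'] -->
      gamma * (\int[lebesgue_measure]_y phi y).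

Definition lojasiewicz_distribution h : Prop :=
  forall x, exists gamma, point_value h x gamma.

Definition associated_distribution G h : Prop :=
  lojasiewicz_distribution h /\ forall x, point_value h x (G x).

Definition lojasiewicz_function G : Prop :=
  exists h, associated_distribution G h.

End point_values.

Section test_classes.
Context {R : realType}.
Implicit Types (phi : R -> R).

Definition T0 phi : Prop :=
  [/\ smooth phi,
      forall x, 0 <= phi x,
      (\int[lebesgue_measure]_x (phi x)%:E = 1)%E
    & exists2 alpha : R, alpha < -1 & forall m : nat,
        exists C M : R, forall x : R, M <= `|x| ->
          `|(phi^`(m)) x| <= C * `|x| `^ (alpha - m%:R)].

Definition T1 phi : Prop := T0 phi /\ forall x, x * derive1 phi x <= 0.

End test_classes.

Section integral.
Context {R : realType}.
Implicit Types (h u v U V : schwartz_distribution R) (a b x : R) (f : R -> \bar R).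

Definition upper_value h (phi : R -> R) x : \bar R :=
  limf_esup (fun t : R => (affine_pairing (compact_pairing h) x t phi)%:E) 0^'+.

Definition lower_value h (phi : R -> R) x : \bar R :=
  limf_einf (fun t : R => (affine_pairing (compact_pairing h) x t phi)%:E) 0^'+.

(* In what follows a function f : [a, b] -> \bar R is represented by a total
   function, of which only the values on [a, b] are used. *)

Definition major_pair a b f u U : Prop :=
  [/\ supported_in u a b,
      lojasiewicz_distribution U,
      dist_eq (dist_derive U) u,
      point_value U a 0
    & exists E Z : set R,
      [/\ countable E,
          lebesgue_measure.-negligible Z,
          forall x phi, (`[a, b] `\` Z) x -> T0 phi ->
            (f x <= lower_value u phi x)%E
        & forall x phi, (`[a, b] `\` E) x -> T1 phi ->
            (-oo < lower_value u phi x)%E]].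

Definition minor_pair a b f v V : Prop :=
  [/\ supported_in v a b,
      lojasiewicz_distribution V,
      dist_eq (dist_derive V) v,
      point_value V a 0
    & exists E Z : set R,
      [/\ countable E,
          lebesgue_measure.-negligible Z,
          forall x phi, (`[a, b] `\` Z) x -> T0 phi ->
            (upper_value v phi x <= f x)%E
        & forall x phi, (`[a, b] `\` E) x -> T1 phi ->
            (upper_value v phi x < +oo)%E]].

Definition major_values a b f : set \bar R :=
  [set r%:E | r in [set r | exists u U, major_pair a b f u U /\
                                        point_value U b r]].

Definition minor_values a b f : set \bar R :=
  [set r%:E | r in [set r | exists v V, minor_pair a b f v V /\
                                        point_value V b r]].

Definition dist_integrable a b f : Prop :=
  [/\ exists u U, major_pair a b f u U,
      exists v V, minor_pair a b f v V
    & ereal_sup (minor_values a b f) = ereal_inf (major_values a b f)].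

(* Meaningful when f is integrable over [a, b]; it is then also the infimum of
   the major values, and a finite number. *)
Definition dist_integral a b f : \bar R := ereal_sup (minor_values a b f).

End integral.

(* Main.v *)
Require Import Defs.
From mathcomp Require Import all_boot all_order all_algebra.
From mathcomp Require Import all_classical all_reals all_analysis.
From mathcomp Require Import measurable_realfun.
From mathcomp Require Import ring lra.
Set Implicit Arguments.
Unset Strict Implicit.
Unset Printing Implicit Defensive.
Import Order.TTheory GRing.Theory Num.Theory.
Import numFieldNormedType.Exports.
Local Open Scope ring_scope.
Local Open Scope classical_set_scope.

(* Write U for the distribution that is 0 to the left of c, G - G(c) on [c, d] and G(d) - G(c) to
   the right of d. It is a Lojasiewicz distribution, and at every x in ]c, d[ outside E the
   transforms of u = U' by T_0 kernels tend to g(x), so (u, U) is both a major and a minor pair for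
   g. The integral is then determined once we know that U1(d) >= U2(d) for a major pair (u1, U1)
   and a minor pair (u2, U2), i.e. that w = W' is positive when W = U1 - U2.

   Let v(x, t) be the transform of w by a Gaussian; it solves the heat equation in (x, t^2), its
   lower limit as t -> 0 is nonnegative almost everywhere and is > -oo off a countable set. Let P be
   the complement of the largest open set on which w is positive. As W has point values,
   t <w(x + t y), psi(y)> tends to 0 for every test function psi, which excludes isolated points of
   P. By Baire's theorem v is bounded below on a portion of P, uniformly in t, and by the minimum
   principle it is also bounded below on the gaps of that portion: the corners of the heat problem
   at the end points of a gap are controlled by the same smallness of t <w(x + t y), psi(y)>. Fatou's
   lemma then shows that w is positive near a point of P, so P is empty. *)

(** * Smooth functions *)

(** Two obstacles shape the proof. A point value is a limit for each single test function, without
    uniformity, and Gaussians are not compactly supported. Uniformity comes from a Banach-Steinhaus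
    argument and the compactness of translates; kernels without compact support are then reached by
    a dyadic decomposition. The same quantitative form of the point value makes it possible to cut G
    at c and d. Moreover the bounds on lower limits hold pointwise, with no common range of t, so no
    minimum principle applies on a whole strip. Baire's theorem gives a common range on P only,
    which is why the gaps are treated apart. The Gaussian is suitable because it lies in T_1, so
    that both conditions on a pair apply to it, and because its scalings solve a heat equation. At a
    corner the transform may go down to -eps / t times a Gaussian of width of order t, which is
    unbounded as t -> 0; but this is dominated by a heat kernel with a coefficient of order eps,
    whose value at any fixed later time is O(eps). *)

Section smooth_calculus_base.
Context {R : realType}.
Implicit Types (f g : R -> R) (x y : R).

Lemma is_derive_derive1 f x : derivable f x 1 -> is_derive x 1 f (f^`() x).
Proof. by move=> df; rewrite derive1E; exact: derivableP. Qed.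

Lemma is_derive1E f x (d : R) : is_derive x 1 f d -> f^`() x = d.
Proof. by move=> h; rewrite derive1E; exact: derive_val. Qed.

Lemma derive1_fun f f' : (forall x, is_derive x 1 f (f' x)) -> f^`() = f'.
Proof. by move=> h; apply/funext => x; exact: is_derive1E. Qed.

Lemma is_derive_derivable f x (d : R) : is_derive x 1 f d -> derivable f x 1.
Proof. by case. Qed.

Lemma is_deriveDf f g x (df dg : R) : is_derive x 1 f df -> is_derive x 1 g dg ->
  is_derive x 1 (fun y => f y + g y) (df + dg).
Proof. by move=> hf hg; exact: is_deriveD. Qed.

Lemma is_deriveMf f g x (df dg : R) : is_derive x 1 f df -> is_derive x 1 g dg ->
  is_derive x 1 (fun y => f y * g y) (df * g x + f x * dg).
Proof.
move=> hf hg.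
have := is_deriveM hf hg.
rewrite (_ : f * g = fun y => f y * g y)//.
by move/is_derive_eq; apply; rewrite /GRing.scale/= addrC mulrC [X in _ + X]mulrC mulrC [X in _ + X]mulrC.
Qed.

Lemma is_derive_compf f g x (df dg : R) : is_derive (g x) 1 f df -> is_derive x 1 g dg ->
  is_derive x 1 (fun y => f (g y)) (df * dg).
Proof. by move=> hf hg; have := @is_derive1_comp _ f g x _ _ hf hg. Qed.

Lemma is_deriveZf (c : R) f x (df : R) : is_derive x 1 f df ->
  is_derive x 1 (fun y => c * f y) (c * df).
Proof.
move=> hf; have := @is_deriveMf (fun=> c) f x 0 df (is_derive_cst _ _ _) hf.
by rewrite mul0r add0r.
Qed.

Lemma is_derive_aff (s c : R) x : is_derive x 1 (fun y => s * y + c) s.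
Proof.
have h := @is_deriveDf (fun y => s * y) (fun=> c) x s 0.
rewrite addr0 in h; apply: h.
by have := @is_deriveZf s id x 1 (is_derive_id _ _); rewrite mulr1.
Qed.

Lemma smoothS f : smooth f <-> (forall x, derivable f x 1) /\ smooth f^`().
Proof.
split=> [sf|[d0 sf] [|n] x]; last by rewrite -derive1nSr; exact: sf.
  by split; [exact: (sf 0%N) | exact: smooth_derive1].
exact: d0.
Qed.

(** Smooth functions form the largest class of derivable functions stable under derivation.
    Exhibiting a stable class replaces Leibniz and chain formulas of higher order. *)
Lemma smooth_coind (P : (R -> R) -> Prop) :
  (forall f, P f -> (forall x, derivable f x 1) /\ P f^`()) ->
  forall f, P f -> smooth f.
Proof.
move=> hP f Pf n; elim: n f Pf => [|n IHn] f /hP[df Pf'] x; first exact: df.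
by rewrite -derive1nSr; exact: IHn.
Qed.

Lemma smooth_derivable f x : smooth f -> derivable f x 1.
Proof. by move=> sf; exact: (sf 0%N). Qed.

Lemma smooth_is_derive f x : smooth f -> is_derive x 1 f (f^`() x).
Proof. by move=> sf; apply: is_derive_derive1; exact: (sf 0%N). Qed.

End smooth_calculus_base.

Opaque smooth.

Section smooth_calculus.
Context {R : realType}.
Implicit Types (f g : R -> R) (x y : R).

Lemma smooth_cst (c : R) : smooth (fun _ : R => c).
Proof.
apply: (@smooth_coind R (fun f => exists c : R, f = fun=> c)); last by exists c.
move=> _ [d ->]; split => [x|]; first exact: derivable_cst.
by exists 0; apply: derive1_fun => x; exact: is_derive_cst.
Qed.

(** By the product rule, sums of products of smooth functions are stable under derivation. *)
Inductive smooth_span : (R -> R) -> Prop :=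
| span_mul f g : smooth f -> smooth g -> smooth_span (fun y => f y * g y)
| span_add f g : smooth_span f -> smooth_span g -> smooth_span (fun y => f y + g y).

Lemma smooth_span_smooth f : smooth_span f -> smooth f.
Proof.
apply: smooth_coind => {}f; elim => {f}[f g sf sg|f g _ [df Pf] _ [dg Pg]].
- have h x := @is_deriveMf R f g x _ _ (smooth_is_derive _ sf) (smooth_is_derive _ sg).
  split => [x|]; first exact: is_derive_derivable (h x).
  rewrite (derive1_fun h).
  exact: (span_add (span_mul (smooth_derive1 sf) sg) (span_mul sf (smooth_derive1 sg))).
- have h x := @is_deriveDf R f g x _ _ (is_derive_derive1 (df x)) (is_derive_derive1 (dg x)).
  split => [x|]; first exact: is_derive_derivable (h x).
  by rewrite (derive1_fun h); exact: span_add.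
Qed.

Lemma smoothM f g : smooth f -> smooth g -> smooth (fun y => f y * g y).
Proof. move=> sf sg; have h := span_mul sf sg; have h2 := smooth_span_smooth h; exact: h2. Qed.

Lemma smoothZ (c : R) f : smooth f -> smooth (fun y => c * f y).
Proof. by apply: smoothM; exact: smooth_cst. Qed.

Lemma smoothD f g : smooth f -> smooth g -> smooth (fun y => f y + g y).
Proof.
have span1 h : smooth h -> smooth_span h.
  move=> sh; have := span_mul (@smooth_cst 1) sh; congr smooth_span.
  by apply/funext => y; rewrite mul1r.
by move=> sf sg; exact: smooth_span_smooth (span_add (span1 _ sf) (span1 _ sg)).
Qed.

Lemma smoothN f : smooth f -> smooth (fun y => - f y).
Proof.
by move=> /(@smoothZ (-1)); congr smooth; apply/funext => y; rewrite mulN1r.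
Qed.

Lemma smoothB f g : smooth f -> smooth g -> smooth (fun y => f y - g y).
Proof. by move=> sf sg; apply: smoothD; [exact: sf|apply: smoothN; exact: sg]. Qed.

Lemma smooth_id : smooth (fun y : R => y).
Proof.
apply/smoothS; split => [x|]; first exact: derivable_id.
rewrite (@derive1_fun R _ (fun=> 1)); first exact: smooth_cst.
Qed.

(** Sums of terms (f o g) h are stable under derivation: the chain rule only puts a factor g' into
    h. *)
Inductive comp_span (g : R -> R) : (R -> R) -> Prop :=
| cspan_mul f h : smooth f -> smooth h -> comp_span g (fun y => f (g y) * h y)
| cspan_add f h : comp_span g f -> comp_span g h -> comp_span g (fun y => f y + h y).

Lemma smooth_comp f g : smooth f -> smooth g -> smooth (fun y => f (g y)).
Proof.
move=> sf sg; apply: (@smooth_coind R (comp_span g)); last first.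
  rewrite (_ : (fun _ => _) = fun y => f (g y) * 1); last by apply/funext => y; rewrite mulr1.
  exact: (cspan_mul g sf (@smooth_cst 1)).
move=> k; elim => {k}[k h sk sh|k h _ [dk Pk] _ [dh Ph]].
- have d x := @is_deriveMf R (fun y => k (g y)) h x _ _
    (is_derive_compf (smooth_is_derive _ sk) (smooth_is_derive _ sg))
    (smooth_is_derive _ sh).
  split => [x|]; first exact: is_derive_derivable (d x).
  rewrite (derive1_fun d); apply: cspan_add.
    rewrite (_ : (fun _ => _) = fun y => derive1 k (g y) * (derive1 g y * h y)); last first.
      by apply/funext => y; rewrite mulrA.
    exact: (cspan_mul g (smooth_derive1 sk) (smoothM (smooth_derive1 sg) sh)).
  exact: (cspan_mul g sk (smooth_derive1 sh)).
- have d x := @is_deriveDf R k h x _ _ (is_derive_derive1 (dk x)) (is_derive_derive1 (dh x)).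
  split => [x|]; first exact: is_derive_derivable (d x).
  by rewrite (derive1_fun d); exact: cspan_add.
Qed.

Lemma smooth_aff (s c : R) f : smooth f -> smooth (fun y => f (s * y + c)).
Proof.
move=> sf; apply: (@smooth_comp f (fun y => s * y + c)); first exact: sf.
by apply: smoothD; [apply: smoothZ; exact: smooth_id | exact: smooth_cst].
Qed.

Lemma smooth_expR : smooth (@expR R).
Proof.
apply: (@smooth_coind R (fun f => f = expR)) => // _ ->; split => [x|].
  exact: derivable_expR.
by apply: derive1_fun => x; exact: is_derive_expR.
Qed.

Lemma smooth_continuous f : smooth f -> continuous f.
Proof.
by move=> sf x; apply/differentiable_continuous/derivable1_diffP; exact: smooth_derivable.
Qed.

Lemma smooth_derive1n f n : smooth f -> smooth f^`(n).
Proof. move=> sf; elim: n => [|n IHn]; first exact: sf.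
by rewrite derive1nS; apply: smooth_derive1; exact: IHn. Qed.

Lemma derive1nD f g n : smooth f -> smooth g ->
  (fun y => f y + g y)^`(n) = fun y => derive1n n f y + derive1n n g y.
Proof.
move=> sf sg; elim: n => // n IHn; rewrite !derive1nS IHn.
by apply: derive1_fun => x; apply: is_deriveDf; apply: smooth_is_derive;
  exact: smooth_derive1n.
Qed.

Lemma derive1M f g : smooth f -> smooth g ->
  (fun y => f y * g y)^`() = fun y => derive1 f y * g y + f y * derive1 g y.
Proof.
move=> sf sg; apply: derive1_fun => x.
exact: is_deriveMf (smooth_is_derive _ sf) (smooth_is_derive _ sg).
Qed.

Lemma derive1nZ (c : R) f n : smooth f ->
  (fun y => c * f y)^`(n) = fun y => c * derive1n n f y.
Proof.
move=> sf; elim: n => // n IHn; rewrite !derive1nS IHn.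
by apply: derive1_fun => x; apply: is_deriveZf; apply: smooth_is_derive;
  exact: smooth_derive1n.
Qed.

Lemma derive1n_cst (c : R) n : (fun _ : R => c)^`(n.+1) = fun=> 0.
Proof.
elim: n => [|n IHn].
  by rewrite derive1n1; apply: derive1_fun => x; exact: is_derive_cst.
by rewrite derive1nS IHn; apply: derive1_fun => x; exact: is_derive_cst.
Qed.

Lemma derive1n_aff (s c : R) f n : smooth f ->
  (fun y => f (s * y + c))^`(n) = fun y => s ^+ n * derive1n n f (s * y + c).
Proof.
move=> sf; elim: n => [|n IHn]; first by apply/funext => y /=; rewrite mul1r.
rewrite !derive1nS IHn; apply: derive1_fun => x.
have := @is_deriveZf R (s ^+ n) _ x _ (@is_derive_compf R f^`(n) (fun y => s * y + c) x _ _
   (smooth_is_derive _ (smooth_derive1n sf)) (is_derive_aff s c x)).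
by move/is_derive_eq; apply; rewrite exprSr mulrAC -mulrA mulrA.
Qed.

(** A C^k bound at a single point, so that bounds may carry weights depending on the point and no
    supremum has to be formed. *)
Definition bndAt (k : nat) (A : R) f x := forall j, (j <= k)%N -> `|derive1n j f x| <= A.

Lemma bndAtS k A f x : bndAt k.+1 A f x <-> `|f x| <= A /\ bndAt k A f^`() x.
Proof.
split=> [h|[h0 h] [|j] jk]; last by rewrite -derive1nSr; exact: h.
  by split => [|j jk]; [exact: (h 0%N) | rewrite derive1nSr; exact: h].
exact: h0.
Qed.

Lemma bndAt_ge0 k A f x : bndAt k A f x -> 0 <= A.
Proof. by move=> /(_ 0%N isT); exact: le_trans. Qed.

Lemma bndAt_le k k' A A' f x : (k' <= k)%N -> A <= A' -> bndAt k A f x -> bndAt k' A' f x.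
Proof. by move=> kk AA h j jk; apply: le_trans AA; apply: h; exact: leq_trans kk. Qed.

Lemma bndAtD k A B f g x : smooth f -> smooth g ->
  bndAt k A f x -> bndAt k B g x -> bndAt k (A + B) (fun y => f y + g y) x.
Proof.
move=> sf sg hf hg j jk; rewrite derive1nD//; apply: le_trans (ler_normD _ _) _.
by apply: lerD; [exact: hf|exact: hg].
Qed.

Lemma bndAtZ k A (c : R) f x : smooth f -> bndAt k A f x -> bndAt k (`|c| * A) (fun y => c * f y) x.
Proof.
by move=> sf hf j jk; rewrite derive1nZ// normrM ler_wpM2l//; exact: hf.
Qed.

(** Each derivation doubles the number of terms, whence the factor 2^k. *)
Lemma bndAtM k A B f g x : smooth f -> smooth g ->
  bndAt k A f x -> bndAt k B g x -> bndAt k (2 ^+ k * A * B) (fun y => f y * g y) x.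
Proof.
elim: k f g => [|k IHk] f g sf sg hf hg.
  move=> [|//] _ /=; rewrite normrM mul1r ler_pM//; [exact: (hf 0%N)|exact: (hg 0%N)].
have A0 := bndAt_ge0 hf; have B0 := bndAt_ge0 hg.
have [hf0 hf1] := (bndAtS _ _ _ _).1 hf.
have [hg0 hg1] := (bndAtS _ _ _ _).1 hg.
apply/bndAtS; split.
  rewrite normrM -mulrA -[leLHS]mul1r; apply: ler_pM; rewrite ?mulr_ge0//.
    by rewrite exprn_ege1// ler1n.
  exact: ler_pM.
rewrite derive1M//.
have -> : 2 ^+ k.+1 * A * B = 2 ^+ k * A * B + 2 ^+ k * A * B by rewrite exprS; ring.
have hf' : bndAt k A f x by exact: bndAt_le hf.
have hg' : bndAt k B g x by exact: bndAt_le hg.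
have := smooth_derive1 sf; have := smooth_derive1 sg => sg' sf'.
by apply: bndAtD; [exact: smoothM|exact: smoothM|exact: IHk|exact: IHk].
Qed.

Lemma bndAt_aff k A (s c : R) f x : smooth f -> bndAt k A f (s * x + c) ->
  bndAt k ((1 + `|s|) ^+ k * A) (fun y => f (s * y + c)) x.
Proof.
move=> sf hf j jk; rewrite derive1n_aff// normrM ler_pM//; last exact: hf.
rewrite normrX; apply: (@le_trans _ _ ((1 + `|s|) ^+ j)).
  by rewrite lerXn2r ?nnegrE ?addr_ge0// lerDr.
by rewrite ler_weXn2l// lerDl.
Qed.

Lemma near_derive1n f g x n : (\forall y \near x, f y = g y) ->
  \forall y \near x, f^`(n) y = g^`(n) y.
Proof.
elim: n => // n IHn /IHn {}IHn.
near=> y; rewrite !derive1nS !derive1E; apply: near_eq_derive.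
near: y; exact: (near_join IHn).
Unshelve. all: by end_near. Qed.

Lemma bndAt_near k A f g x : (\forall y \near x, f y = g y) ->
  bndAt k A f x -> bndAt k A g x.
Proof.
move=> fg hf j jk.
by rewrite -(nbhs_singleton (near_derive1n j fg)); exact: hf.
Qed.

Lemma bndAt0 k x : bndAt k 0 (fun=> 0) x.
Proof. by move=> [|j] _; rewrite ?derive1n_cst ?normr0// /= normr0. Qed.

Lemma bndAt_out k A f x : ~ tsupp f x -> 0 <= A -> bndAt k A f x.
Proof.
move=> nfx A0; apply: bndAt_le (leqnn k) A0 _.
apply: (bndAt_near _ (@bndAt0 k x)).
have : nbhs x (~` tsupp f).
  by apply: open_nbhs_nbhs; split => //; exact/closed_openC/closed_closure.
apply: filterS => y ny; apply/eqP; rewrite eq_sym; apply: contrapT => /negP h.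
by apply: ny; exact: subset_closure.
Qed.

Lemma tsupp_sub f (K : set R) : closed K -> (forall x, ~ K x -> f x = 0) -> tsupp f `<=` K.
Proof.
move=> cK h; rewrite [X in _ `<=` X](closure_id _).1//; apply: closureS => x /= fx0.
by apply: contrapT => /h fx; move: fx0; rewrite fx eqxx.
Qed.

Lemma tsupp0 f x : ~ tsupp f x -> f x = 0.
Proof.
move=> h; apply/eqP; apply: contrapT => /negP fx; apply: h; exact: subset_closure.
Qed.

End smooth_calculus.

Arguments smooth_derivable {R f} x _.
Arguments smooth_is_derive {R f} x _.
Arguments smooth_cst {R} c.
Arguments smoothM {R f g} _ _.
Arguments smoothZ {R} c {f} _.
Arguments smoothD {R f g} _ _.
Arguments smoothN {R f} _.
Arguments smoothB {R f g} _ _.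
Arguments smooth_id {R}.
Arguments smooth_comp {R f g} _ _.
Arguments smooth_aff {R} s c {f} _.
Arguments smooth_expR {R}.
Arguments smooth_continuous {R f} _ _.
Arguments smooth_derive1 {R phi} _.
Arguments smooth_derive1n {R f} n _.
Arguments derive1nD {R f g} n _ _.
Arguments derive1M {R f g} _ _.
Arguments derive1nZ {R} c {f} n _.
Arguments derive1n_aff {R} s c {f} n _.
Arguments bndAtD {R k A B f g x} _ _ _ _.
Arguments bndAtZ {R k A} c {f x} _ _.
Arguments bndAtM {R k A B f g x} _ _ _ _.
Arguments bndAt_aff {R k A} s c {f x} _ _.
Arguments bndAt0 {R} k x.

(** * Second-order estimates and derivatives obtained from them *)

Section taylor.
Context {R : realType}.
Implicit Types (f g : R -> R) (x y : R).

Lemma derivable_lipschitz f x y (M : R) :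
  (forall z, derivable f z 1) ->
  (forall z, `|z - x| <= `|y - x| -> `|derive1 f z| <= M) ->
  `|f y - f x| <= M * `|y - x|.
Proof.
move=> df hM.
have key u v : u <= v -> (forall z, u <= z <= v -> `|derive1 f z| <= M) ->
    `|f v - f u| <= M * `|v - u|.
  move=> uv hz.
  have [||c /itvP cuv ->] := @MVT_segment R f f^`() u v uv.
  - by move=> z _; exact: is_derive_derive1.
  - apply: continuous_subspaceT => z.
    exact/differentiable_continuous/derivable1_diffP.
  - by rewrite normrM ler_wpM2r// hz// !cuv.
case: (leP x y) => xy.
  apply: key => // z /andP[xz zy]; apply: hM; rewrite !ger0_norm ?subr_ge0// lerB//.
rewrite distrC [X in M * X]distrC; apply: key; first exact: ltW.
move=> z /andP[yz zx]; apply: hM; rewrite distrC [leRHS]distrC !ger0_norm ?subr_ge0//; lra.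
Qed.

(** Two applications of the mean value bound, which give M in place of the sharp M / 2. *)
Lemma smooth_taylor2 f x y (M : R) : smooth f ->
  (forall z, `|z - x| <= `|y - x| -> `|derive1n 2 f z| <= M) ->
  `|f y - f x - (y - x) * derive1 f x| <= M * `|y - x| ^+ 2.
Proof.
move=> sf hM; pose g z := f z - z * derive1 f x.
have sg : smooth g.
  apply: smoothB; first exact: sf.
  by apply: smoothM; [exact: smooth_id|exact: smooth_cst].
have dg z : derive1 g z = derive1 f z - derive1 f x.
  apply: is_derive1E; rewrite /g.
  have h1 := smooth_is_derive z sf.
  have h2 := @is_deriveZf R (- derive1 f x) id z 1 (is_derive_id _ _).
  have h3 := is_deriveDf h1 h2; rewrite mulr1 in h3.
  move: h3; congr is_derive; apply/funext => u; rewrite mulNr; congr (_ - _); exact: mulrC.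
have -> : f y - f x - (y - x) * derive1 f x = g y - g x by rewrite /g; ring.
rewrite expr2 mulrA; apply: derivable_lipschitz => z; first exact: smooth_derivable.
move=> zx; rewrite dg; apply: (@le_trans _ _ (M * `|z - x|)).
  apply: derivable_lipschitz => w; first exact: smooth_derivable (smooth_derive1 sf).
  by move=> wz; apply: hM; exact: le_trans zx.
rewrite ler_wpM2l//; apply: le_trans (hM x _); rewrite ?normr_ge0// subrr normr0//.
Qed.

(** The way in which pairings and integrals depending on a parameter are differentiated below:
    Taylor's estimate is proved inside the pairing, and continuity of the pairing gives the
    quadratic remainder. *)
Lemma is_derive_of_quadratic f x (d M r : R) : 0 <= M -> 0 < r ->
  (forall e, `|e| <= r -> `|f (e + x) - f x - e * d| <= M * `|e| ^+ 2) ->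
  is_derive x 1 f d.
Proof.
move=> M0 r0 key.
have cv : h^-1 *: ((f \o shift x) (h *: 1) - f x) @[h --> 0^'] --> d.
  apply/cvgrPdist_le => e e0; near=> h.
  have h0 : h != 0 by near: h; exact: nbhs_dnbhs_neq.
  have hr : `|h| <= r by near: h; exact: dnbhs0_le.
  rewrite /GRing.scale/= mulr1.
  have -> : d - h^-1 * (f (h + x) - f x) = - (h^-1 * (f (h + x) - f x - h * d)) by field.
  rewrite normrN normrM normfV ler_pdivrMl ?normr_gt0//; apply: le_trans (key h hr) _.
  rewrite expr2 mulrA mulrC ler_wpM2l//.
  have : `|h| <= e / (M + 1).
    by near: h; apply: dnbhs0_le; rewrite divr_gt0// ltr_wpDl.
  rewrite ler_pdivlMr ?ltr_wpDl// => he; apply: le_trans he.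
  by rewrite mulrC ler_wpM2l// lerDl.
apply: DeriveDef; first by apply/cvg_ex; exists d; exact: cv.
by apply: cvg_lim => //; exact: cv.
Unshelve. all: by end_near. Qed.

End taylor.

(** * Test functions and pairings *)

Section test_basics.
Context {R : realType}.
Implicit Types (f g : R -> R) (x y : R) (h : schwartz_distribution R).

Lemma test_of_support f (L : R) : smooth f -> (forall x, L < `|x| -> f x = 0) -> test_function f.
Proof.
move=> sf h; split; first exact: sf.
have sub : tsupp f `<=` `[- L, L].
  apply: tsupp_sub; first exact: itv_closed.
  move=> x xL; apply: h; rewrite ltNge; apply/negP => xL'; apply: xL.
  by rewrite /= in_itv/= -ler_norml.
apply: subclosed_compact sub; first exact: closed_closure.
exact: segment_compact.
Qed.

Lemma test_support f : test_function f -> exists2 L : R, 0 < L & forall x, L < `|x| -> f x = 0.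
Proof.
move=> [_ /compact_bounded[M [_ hM]]]; exists (`|M| + 1); first by rewrite ltr_wpDl.
move=> x xM; apply: tsupp0 => /(hM (`|M| + 1)).
rewrite ltNge in xM; move=> h; move: xM; rewrite h//.
by rewrite ltr_pwDr// ler_norm.
Qed.

Lemma testM f g : test_function f -> smooth g -> test_function (fun y => f y * g y).
Proof.
move=> tf sg; have [L _ hL] := test_support tf.
apply: (@test_of_support _ L); first exact: smoothM tf.1 sg.
by move=> x /hL ->; rewrite mul0r.
Qed.

Lemma testMr f g : smooth f -> test_function g -> test_function (fun y => f y * g y).
Proof.
move=> sf tg; have := testM tg sf; congr test_function; apply/funext => y; exact: mulrC.
Qed.

Lemma testD f g : test_function f -> test_function g -> test_function (fun y => f y + g y).
Proof.
move=> tf tg; have [L _ hL] := test_support tf; have [K _ hK] := test_support tg.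
apply: (@test_of_support _ (Num.max L K)); first exact: smoothD tf.1 tg.1.
by move=> x; rewrite gt_max => /andP[/hL -> /hK ->]; rewrite addr0.
Qed.

Lemma testZ (c : R) f : test_function f -> test_function (fun y => c * f y).
Proof. by move=> tf; apply: testMr; [exact: smooth_cst | exact: tf]. Qed.

Lemma testN f : test_function f -> test_function (fun y => - f y).
Proof.
move=> tf; have := testZ (-1) tf; congr test_function; apply/funext => y; exact: mulN1r.
Qed.

Lemma testB f g : test_function f -> test_function g -> test_function (fun y => f y - g y).
Proof. by move=> tf tg; apply: testD; [exact: tf|apply: testN; exact: tg]. Qed.

Lemma test0 : test_function (fun _ : R => 0 : R).
Proof. by apply: (@test_of_support _ 0) => //; exact: smooth_cst. Qed.

Lemma test_aff (s c : R) f : s != 0 -> test_function f -> test_function (fun y => f (s * y + c)).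
Proof.
move=> s0 tf; have [L L0 hL] := test_support tf.
apply: (@test_of_support _ ((L + `|c|) / `|s|)); first exact: smooth_aff tf.1.
move=> x; rewrite ltr_pdivrMr ?normr_gt0// mulrC -normrM => xL; apply: hL.
have := lerB_normD (s * x) c; lra.
Qed.

Lemma distD h f g : test_function f -> test_function g -> h (fun y => f y + g y) = h f + h g.
Proof.
move=> tf tg; have := dist_linear h 1 tf tg; rewrite mul1r => <-.
by congr (dist_fun h _); apply/funext => y; rewrite mul1r.
Qed.

Lemma dist0 h : h (fun=> 0) = 0.
Proof.
have := distD h test0 test0; rewrite (_ : (fun y => 0 + 0) = fun=> 0); last first.
  by apply/funext => y; rewrite addr0.
move=> e; apply: (@addrI _ (h (fun=> 0))); by rewrite addr0 -e.
Qed.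

Lemma distZ h (c : R) f : test_function f -> h (fun y => c * f y) = c * h f.
Proof.
move=> tf; have := dist_linear h c tf test0; rewrite dist0 addr0 => <-.
by congr (dist_fun h _); apply/funext => y; rewrite addr0.
Qed.

Lemma distN h f : test_function f -> h (fun y => - f y) = - h f.
Proof.
move=> tf; rewrite -mulN1r -distZ//; congr (dist_fun h _); apply/funext => y.
by rewrite mulN1r.
Qed.

Lemma distB h f g : test_function f -> test_function g -> h (fun y => f y - g y) = h f - h g.
Proof. by move=> tf tg; rewrite distD ?distN//; exact: testN. Qed.

(** The continuity criterion for K = [-L, L]; bounds on the derivatives are asked only there, since
    they vanish outside. *)
Lemma dist_bound h (L : R) : 0 <= L -> exists (m : nat) (C : R), 0 <= C /\
  forall f (B : R), smooth f -> (forall x, L < `|x| -> f x = 0) ->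
    (forall x, `|x| <= L -> bndAt m B f x) -> `|h f| <= C * B.
Proof.
move=> L0; have [m [C hC]] := dist_continuous h (@segment_compact R (- L) L).
exists m, `|C|; split => // f B sf fL fB.
have B0 : 0 <= B by apply: bndAt_ge0 (fB 0 _); rewrite normr0.
apply: (@le_trans _ _ (C * B)); last by rewrite ler_wpM2r// ler_norm.
have sub : tsupp f `<=` `[- L, L].
  apply: tsupp_sub; first exact: itv_closed.
  move=> x xL; apply: fL; rewrite ltNge; apply/negP => xL'; apply: xL.
  by rewrite /= in_itv/= -ler_norml.
apply: hC => //; first exact: (@test_of_support _ L).
move=> k x km; case: (lerP `|x| L) => xL; first exact: fB.
suff : bndAt m B f x by apply.
apply: bndAt_out => // /sub /=; rewrite in_itv/= -ler_norml.
by move=> xL'; move: xL; rewrite ltNge xL'.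
Qed.

End test_basics.

(** * Smooth steps and plateaus *)

Section bumps.
Context {R : realType}.
Implicit Types (f g : R -> R) (x y : R) (p : {poly R}).

(** Induction on the polynomial: each factor |u| is absorbed by half of the exponent, as a |u| / 2
    <= e^(a |u| / 2). *)
Lemma poly_le_expR p (a : R) : 0 < a ->
  exists2 C : R, 0 <= C & forall u, `|p.[u]| <= C * expR (a * `|u|).
Proof.
elim/poly_ind: p a => [|p c IHp] a a0.
  by exists 0 => // u; rewrite horner0 normr0 mul0r.
have a2 : 0 < a / 2 by rewrite divr_gt0.
have [C C0 hC] := IHp _ a2.
exists (C * (2 / a) + `|c|) => [|u].
  by rewrite addr_ge0// mulr_ge0// divr_ge0// ltW.
rewrite hornerMXaddC mulrDl; apply: le_trans (ler_normD _ _) _; apply: lerD.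
  have -> : a * `|u| = a / 2 * `|u| + a / 2 * `|u| by field.
  rewrite expRD normrM mulrACA; apply: ler_pM; rewrite ?normr_ge0//.
  rewrite -ler_pdivrMl ?divr_gt0// invf_div.
  by apply: le_trans (expR_ge1Dx _); rewrite lerDr.
rewrite ler_peMr//; apply: le_trans (expR_ge1Dx _); rewrite lerDl mulr_ge0//; exact: ltW.
Qed.

(** Sums of terms h / g^n are stable under derivation, which only raises n. *)
Inductive inv_span g : (R -> R) -> Prop :=
| ispan_mul h (n : nat) : smooth h -> inv_span g (fun y => h y * (g y)^-1 ^+ n)
| ispan_add h k : inv_span g h -> inv_span g k -> inv_span g (fun y => h y + k y).

Lemma smoothV g : smooth g -> (forall x, g x != 0) -> smooth (fun y => (g y)^-1).
Proof.
move=> sg g0; apply: (@smooth_coind R (inv_span g)); last first.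
  have := ispan_mul g 1 (smooth_cst 1); congr inv_span.
  by apply/funext => y; rewrite mul1r expr1.
move=> f; elim => {f} [h n sh|h k _ [dh Ph] _ [dk Pk]].
- have dV x : is_derive x 1 (fun y => (g y)^-1) (- (derive1 g x) * (g x)^-1 ^+ 2).
    have := is_deriveV (g0 x) (smooth_is_derive x sg).
    by move/is_derive_eq; apply; rewrite /GRing.scale/= exprVn mulrC mulrN mulNr.
  have dX x : is_derive x 1 (fun y => (g y)^-1 ^+ n)
      (n%:R * (g x)^-1 ^+ n.-1 * (- (derive1 g x) * (g x)^-1 ^+ 2)).
    have h1 : is_derive ((g x)^-1) 1 (fun u : R => u ^+ n) (n%:R * (g x)^-1 ^+ n.-1).
      apply: DeriveDef; first exact: exprn_derivable.
      by rewrite exp_derive /GRing.scale/= mulr1.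
    exact: (@is_derive_compf R (fun u => u ^+ n) (fun y => (g y)^-1) x _ _ h1 (dV x)).
  have d x := is_deriveMf (smooth_is_derive x sh) (dX x).
  split => [x|]; first exact: is_derive_derivable (d x).
  rewrite (derive1_fun d); apply: ispan_add.
    exact: (ispan_mul g n (smooth_derive1 sh)).
  have s2 : smooth (fun y => - n%:R * (h y * derive1 g y)).
    by apply: smoothZ; apply: smoothM; [exact: sh|exact: smooth_derive1].
  have := ispan_mul g n.+1 s2; congr inv_span.
  apply/funext => y; case: n {d dX s2} => [|n]; first by rewrite !mul0r oppr0 !mul0r mulr0.
  by rewrite -[n.+2]addn2 exprD exprS/=; field; exact: g0.
- have d x := is_deriveDf (is_derive_derive1 (dh x)) (is_derive_derive1 (dk x)).
  split => [x|]; first exact: is_derive_derivable (d x).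
  by rewrite (derive1_fun d); exact: ispan_add.
Qed.

(* The functions [0, +oo[ -> R of the form p(1/x) e^(-1/x), extended by 0; they are
   stable under derivation, which gives the smoothness of e^(-1/x). *)
Definition flat p x : R := if 0 < x then p.[x^-1] * expR (- x^-1) else 0.

(** The exponential beats the polynomial p(u) u^2 at u = 1 / x. A quadratic bound is what makes the
    derivative at 0 exist and vanish. *)
Lemma flat_sqr p : exists2 C : R, 0 <= C & forall x, `|flat p x| <= C * x ^+ 2.
Proof.
have [C C0 hC] := poly_le_expR (p * 'X^2) (@ltr01 R); exists C => // x.
rewrite /flat; case: ifPn => [x0|_]; last by rewrite normr0 mulr_ge0// sqr_ge0.
have := hC x^-1; rewrite hornerM hornerXn mul1r normrM normrX (@ger0_norm _ x^-1) ?invr_ge0 ?(ltW x0)//.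
rewrite exprVn ler_pdivrMr ?exprn_gt0// => h.
rewrite normrM [X in _ * X]ger0_norm ?expR_ge0// expRN ler_pdivrMr ?expR_gt0//.
by rewrite mulrAC.
Qed.

Lemma is_derive_flat p x : is_derive x 1 (flat p) (flat ((p - p^`()%R) * 'X^2) x).
Proof.
case: (ltgtP x 0) => x0.
- have e : {near x, flat p =1 fun=> 0}.
    have : \forall y \near x, y < 0 by exact: lt_nbhsl.
    by apply: filterS => y y0; rewrite /flat ltNge (ltW y0).
  apply: (near_eq_is_derive (f := fun=> 0)).
    by apply: filterS e => y ->.
  by rewrite /flat ltNge (ltW x0)/=; exact: is_derive_cst.
- have e : {near x, flat p =1 fun y => p.[y^-1] * expR (- y^-1)}.
    have : \forall y \near x, 0 < y by exact: lt_nbhsr.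
    by apply: filterS => y y0; rewrite /flat y0.
  apply: (near_eq_is_derive (f := fun y => p.[y^-1] * expR (- y^-1))).
    by apply: filterS e => y ->.
  have dV : is_derive x 1 (fun y : R => y^-1) (- x^-1 ^+ 2).
    have := @is_deriveV R id x 1 1 (lt0r_neq0 x0) (is_derive_id _ _).
    by move/is_derive_eq; apply; rewrite /GRing.scale/= mulr1 exprVn.
  have dp : is_derive x^-1 1 (horner p) ((p^`()%R).[x^-1]).
    exact: is_derive_poly.
  have dN : is_derive x 1 (fun y : R => - y^-1) (x^-1 ^+ 2).
    by have := is_deriveN dV; rewrite opprK.
  have := is_deriveMf (@is_derive_compf R (horner p) (fun y => y^-1) x _ _ dp dV) (@is_derive_compf R expR (fun y => - y^-1) x _ _ (is_derive_expR _) dN).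
  by move/is_derive_eq; apply; rewrite /flat x0 hornerM hornerXn hornerD hornerN /=; ring.
- have [C C0 hC] := flat_sqr p.
  have f0 q : flat q 0 = 0 by rewrite /flat ltxx.
  rewrite x0 f0.
  have key : h^-1 *: ((flat p \o shift 0) (h *: 1) - flat p 0) @[h --> 0^'] --> (0 : R).
    apply/cvgr0Pnorm_le => e e0; near=> h.
    have h0 : h != 0 by near: h; exact: nbhs_dnbhs_neq.
    rewrite f0 subr0 /GRing.scale/= mulr1 addr0 normrM normfV ler_pdivrMl ?normr_gt0//.
    apply: le_trans (hC _) _; rewrite -real_normK ?num_real// expr2 mulrA mulrC ler_wpM2l//.
    have : `|h| <= e / (C + 1).
      near: h; apply: dnbhs0_le; rewrite divr_gt0// ltr_wpDl//.
    rewrite ler_pdivlMr ?ltr_wpDl// => he; apply: le_trans he.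
    by rewrite mulrC ler_wpM2l// lerDl.
  apply: DeriveDef; first by apply/cvg_ex; exists 0; exact: key.
  by apply: cvg_lim => //; exact: key.
Unshelve. all: by end_near. Qed.

Lemma smooth_flat p : smooth (flat p).
Proof.
apply: (@smooth_coind R (fun f => exists p, f = flat p)); last by exists p.
move=> _ [q ->]; split => [x|]; first exact: is_derive_derivable (is_derive_flat q x).
by exists ((q - q^`()%R) * 'X^2); apply: derive1_fun => x; exact: is_derive_flat.
Qed.

(** The usual quotient with a positive denominator: it is 0 for x <= 0 and 1 for x >= 1. *)
Definition smooth_step x : R := flat 1 x * (flat 1 x + flat 1 (1 - x))^-1.
Local Notation S := smooth_step.

Lemma flat1_ge0 x : 0 <= flat 1 x.
Proof. by rewrite /flat; case: ifP => // _; rewrite hornerE mul1r expR_ge0. Qed.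

Lemma flat1_gt0 x : 0 < x -> 0 < flat 1 x.
Proof. by move=> x0; rewrite /flat x0 hornerE mul1r expR_gt0. Qed.

Lemma flat1_le0 x : x <= 0 -> flat 1 x = 0.
Proof. by move=> x0; rewrite /flat ltNge x0. Qed.

Lemma flat1_sum_gt0 x : 0 < flat 1 x + flat 1 (1 - x).
Proof.
have [x0|x0] := ltP 0 x.
  by apply: ltr_pwDl; [exact: flat1_gt0|exact: flat1_ge0].
by apply: ltr_wpDl; [exact: flat1_ge0|apply: flat1_gt0; lra].
Qed.

Lemma smooth_smooth_step : smooth S.
Proof.
apply: smoothM; first exact: smooth_flat.
apply: smoothV; last by move=> x; rewrite gt_eqF// flat1_sum_gt0.
apply: smoothD; first exact: smooth_flat.
have := smooth_aff (-1) 1 (@smooth_flat 1); congr smooth; apply/funext => y.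
by rewrite mulN1r addrC.
Qed.

Lemma step_ge0 x : 0 <= S x.
Proof. by rewrite mulr_ge0 ?flat1_ge0// invr_ge0 ltW// flat1_sum_gt0. Qed.

Lemma step_le1 x : S x <= 1.
Proof. by rewrite ler_pdivrMr ?flat1_sum_gt0// mul1r lerDl flat1_ge0. Qed.

Lemma step_eq0 x : x <= 0 -> S x = 0.
Proof. by move=> x0; rewrite /smooth_step flat1_le0// mul0r. Qed.

Lemma step_eq1 x : 1 <= x -> S x = 1.
Proof.
move=> x1; rewrite /smooth_step (@flat1_le0 (1 - x)) ?subr_le0// addr0 divff//.
by rewrite gt_eqF// flat1_gt0//; lra.
Qed.

Definition plateau (L : R) x : R := S (2 - L^-1 * x) * S (2 + L^-1 * x).

Lemma smooth_plateau L : smooth (plateau L).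
Proof.
apply: smoothM.
  have := smooth_aff (- L^-1) 2 smooth_smooth_step; congr smooth; apply/funext => y.
  by rewrite mulNr addrC.
have := smooth_aff (L^-1) 2 smooth_smooth_step; congr smooth; apply/funext => y.
by rewrite addrC.
Qed.

Lemma plateau_ge0 L x : 0 <= plateau L x.
Proof. by rewrite mulr_ge0 ?step_ge0. Qed.

Lemma plateau_le1 L x : plateau L x <= 1.
Proof. by rewrite -[leRHS]mulr1 ler_pM ?step_ge0 ?step_le1. Qed.

Lemma plateau_eq1 L x : 0 < L -> `|x| <= L -> plateau L x = 1.
Proof.
move=> L0; rewrite ler_norml => /andP[h1 h2].
rewrite /plateau !step_eq1 ?mulr1//.
- have : L^-1 * (- L) <= L^-1 * x by rewrite ler_wpM2l// invr_ge0 ltW.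
  by rewrite mulrN mulVf ?gt_eqF//; lra.
- have : L^-1 * x <= L^-1 * L by rewrite ler_wpM2l// invr_ge0 ltW.
  by rewrite mulVf ?gt_eqF//; lra.
Qed.

Lemma plateau_eq0 L x : 0 < L -> 2 * L <= `|x| -> plateau L x = 0.
Proof.
move=> L0; rewrite ler_normr => /orP[] h; rewrite /plateau.
- have : L^-1 * (2 * L) <= L^-1 * x by rewrite ler_wpM2l// invr_ge0 ltW.
  rewrite mulrCA mulVf ?gt_eqF// mulr1 => h'.
  by rewrite (@step_eq0 (2 - L^-1 * x)) ?mul0r//; lra.
- have : L^-1 * (2 * L) <= L^-1 * (- x) by rewrite ler_wpM2l// invr_ge0 ltW.
  rewrite mulrCA mulVf ?gt_eqF// mulr1 mulrN => h'.
  by rewrite (@step_eq0 (2 + L^-1 * x)) ?mulr0//; lra.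
Qed.

Lemma test_plateau L : 0 < L -> test_function (plateau L).
Proof.
move=> L0; apply: (@test_of_support _ _ (2 * L)); first exact: smooth_plateau.
by move=> x /ltW xL; exact: plateau_eq0.
Qed.

Lemma test_bnd f (k : nat) : test_function f -> exists2 B : R, 0 <= B & forall x, bndAt k B f x.
Proof.
move=> tf; elim: k f tf => [|k IHk] f tf.
  have [L L0 hL] := test_support tf.
  have cf : continuous (fun x => `|f x|).
    move=> x; apply: continuous_comp; last exact: norm_continuous.
    exact: (smooth_continuous tf.1 x).
  have LL : - L <= L by lra.
  have [c _ hc] := @EVT_max R (fun x => `|f x|) (- L) L LL (continuous_subspaceT cf).
  exists `|f c| => // x [|//] _ /=; case: (lerP `|x| L) => xL; last by rewrite hL ?normr0.
  by apply: hc; rewrite in_itv/= -ler_norml.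
have [B B0 hB] := IHk _ tf; have [B' B'0 hB'] := IHk _ (test_function_derive1 tf).
exists (B + B'); first exact: addr_ge0.
move=> x; apply/bndAtS; split.
  by have := hB x 0%N isT => /= h; apply: le_trans h _; rewrite lerDl.
by apply: bndAt_le (hB' x) => //; rewrite lerDr.
Qed.

End bumps.

(** * Uniform boundedness *)

Section uniform_boundedness.
Context {R : realType}.
Implicit Types (f g psi : R -> R) (x y : R) (u d : nat -> R).

Lemma halving_le d n : (forall n, d n.+1 <= d n / 2) -> d n <= d 0%N * 2^-1 ^+ n.
Proof.
move=> hd; elim: n => [|n IHn]; first by rewrite expr0 mulr1.
rewrite exprSr mulrA; apply: le_trans (hd n) _; rewrite ler_wpM2r// invr_ge0; lra.
Qed.

Lemma le_halving (a b C : R) d N : (forall n, d n.+1 <= d n / 2) -> 0 <= C ->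
  (forall n, (N <= n)%N -> a <= b + C * d n) -> a <= b.
Proof.
move=> hd C0 h; apply/ler_addgt0Pr => e e0.
have c : (fun n => C * (`|d 0%N| * 2^-1 ^+ n)) @ \oo --> (0 : R).
  rewrite -[X in _ --> X](mulr0 C); apply: cvgMr.
  rewrite -[X in _ --> X](mulr0 `|d 0%N|); apply: cvgMr.
  by apply: cvg_expr; rewrite ger0_norm ?invr_ge0// invf_lt1//; lra.
move/cvgr0Pnorm_le : c => /(_ _ e0)[M _ hM].
apply: le_trans (h (maxn N M) (leq_maxl _ _)) _; rewrite lerD2l.
have := hM (maxn N M) (leq_maxr _ _) => /= h'; apply: le_trans h'.
apply: le_trans (ler_norm _); rewrite ler_wpM2l//.
apply: le_trans (halving_le _ hd) _; rewrite ler_wpM2r ?ler_norm// exprn_ge0// invr_ge0; lra.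
Qed.

(** Completeness with an explicit rate: from rank N on, u n - 2 d n increases and u n + 2 d n
    decreases, so the supremum of the former is the limit. *)
Lemma halving_limit u d N : (forall n, d n.+1 <= d n / 2) ->
  (forall n, (N <= n)%N -> `|u n.+1 - u n| <= d n) ->
  exists l : R, forall n, (N <= n)%N -> `|l - u n| <= 2 * d n.
Proof.
move=> hd hu.
pose a n := u (N + n)%N - 2 * d (N + n)%N; pose b n := u (N + n)%N + 2 * d (N + n)%N.
have d0 n : (N <= n)%N -> 0 <= d n by move=> /hu; exact: le_trans.
have ua n : `|u (N + n).+1 - u (N + n)%N| <= d (N + n)%N by apply: hu; exact: leq_addr.
have ia : {homo a : m n / (m <= n)%N >-> m <= n}.
  apply: homo_leq => //; first exact: le_trans.
  move=> n; have := ua n; have := hd (N + n)%N; rewrite /a addnS ler_norml => h1 /andP[h2 h3].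
  lra.
have ib : {homo b : m n / (m <= n)%N >-> n <= m}.
  apply: homo_leq => //; first by move=> ? ? ? h1 h2; exact: le_trans h2 h1.
  move=> n; have := ua n; have := hd (N + n)%N; rewrite /b addnS ler_norml => h1 /andP[h2 h3].
  lra.
have ab m n : a m <= b n.
  apply: (@le_trans _ _ (a (maxn m n))); first by apply: ia; exact: leq_maxl.
  apply: (@le_trans _ _ (b (maxn m n))); last by apply: ib; exact: leq_maxr.
  have := d0 (N + maxn m n)%N (leq_addr _ _); rewrite /a /b; lra.
exists (sup (range a)) => n Nn.
have -> : n = (N + (n - N))%N by rewrite subnKC.
have h1 : a (n - N)%N <= sup (range a).
  apply: ub_le_sup; last by exists (n - N)%N.
  by exists (b 0%N) => _ [m _ <-].
have h2 : sup (range a) <= b (n - N)%N.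
  apply: ge_sup; first by exists (a 0%N), 0%N.
  by move=> _ [m _ <-].
by rewrite ler_norml; move: h1 h2; rewrite /a /b; lra.
Qed.

Lemma dist_tri3 (a b c B e e' : R) : `|c - a| <= e -> `|c - b| <= e' -> `|b| <= B ->
  `|a| <= B + e' + e.
Proof. by rewrite !ler_norml; lra. Qed.

Lemma dist_tri (a b c e e' : R) : `|a - c| <= e -> `|b - c| <= e' -> `|a - b| <= e + e'.
Proof. by rewrite !ler_norml; lra. Qed.

Lemma taylor_perturb (a b c a' b' c' t e Q : R) : `|a' - a| <= e -> `|b' - b| <= e ->
  `|c' - c| <= e -> `|a - b - t * c| <= Q -> `|a' - b' - t * c'| <= Q + (2 + `|t|) * e.
Proof.
move=> h1 h2 h3 h4.
have h5 : `|t * (c' - c)| <= `|t| * e by rewrite normrM ler_wpM2l.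
have -> : a' - b' - t * c' = (a - b - t * c) + (a' - a) - (b' - b) - t * (c' - c) by ring.
move: h1 h2 h4 h5; move: (a - _ - _) (a' - a) (b' - b) (t * (_ - _)) => u v w z.
by rewrite !ler_norml; lra.
Qed.

Lemma normD_ge (u v M n : R) : `|v| <= M -> M + n <= `|u| -> n <= `|v + u|.
Proof.
move=> h1 h2; have : `|u| <= `|v + u| + `|v|.
  by rewrite -[X in `|X| <= _](addKr v) addrC; exact: ler_normB.
lra.
Qed.

(** Completeness of the test functions supported in [-L, L]. As k n >= n, every derivative is
    eventually controlled; the limits [F j] of the derivatives are taken separately, and Taylor's
    estimate, stable under limits, shows that [F j.+1] is the derivative of [F j]. *)
Lemma test_limit (f : nat -> R -> R) (k : nat -> nat) d (L : R) :
  (forall n, smooth (f n)) -> (forall n x, L < `|x| -> f n x = 0) ->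
  (forall n, (n <= k n)%N) -> (forall n, (k n <= k n.+1)%N) ->
  (forall n, d n.+1 <= d n / 2) ->
  (forall n x, bndAt (k n) (d n) (fun y => f n.+1 y - f n y) x) ->
  exists F : R -> R, [/\ smooth F, forall x, L < `|x| -> F x = 0 &
    forall n x, bndAt (k n) (2 * d n) (fun y => F y - f n y) x].
Proof.
move=> sf fL nk kS hd hf.
have dB g h j : smooth g -> smooth h ->
    derive1n j (fun y => g y - h y) = fun y => derive1n j g y - derive1n j h y.
  move=> sg sh; have -> : (fun y => g y - h y) = fun y => g y + (-1) * h y.
    by apply/funext => y; rewrite mulN1r.
  rewrite (derive1nD j sg (smoothZ (-1) sh)) (derive1nZ (-1) j sh).
  by apply/funext => y; rewrite mulN1r.
have d0 n : 0 <= d n by apply: bndAt_ge0 (hf n 0).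
have kmono : {homo k : m n / (m <= n)%N >-> (m <= n)%N}.
  by apply: homo_leq => //; exact: leq_trans.
have hu j n x : (j <= k n)%N -> `|derive1n j (f n.+1) x - derive1n j (f n) x| <= d n.
  by move=> jk; have := hf n x j jk; rewrite (dB _ _ _ (sf n.+1) (sf n)).
have ex j : exists Fj : R -> R, forall x n, (j <= n)%N -> `|Fj x - derive1n j (f n) x| <= 2 * d n.
  have [|Fj hFj] := @choice R R (fun x l => forall n, (j <= n)%N -> `|l - derive1n j (f n) x| <= 2 * d n).
    move=> x; apply: (@halving_limit (fun n => derive1n j (f n) x)) => // n jn.
    by apply: hu; exact: leq_trans (nk n).
  by exists Fj.
have [F hF] := choice ex.
(* The choice of [F j] controls it from rank j on only. The bound is wanted as soon as j <= k n, so
   [F j] is identified with the limit along the ranks from n on. *)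
have hF' j n x : (j <= k n)%N -> `|F j x - derive1n j (f n) x| <= 2 * d n.
  move=> jn; have [l hl] : exists l : R, forall m, (n <= m)%N -> `|l - derive1n j (f m) x| <= 2 * d m.
    apply: (@halving_limit (fun m => derive1n j (f m) x)) => // m nm; apply: hu; apply: leq_trans jn _; exact: kmono.
  suff -> : F j x = l by exact: hl.
  apply/eqP; rewrite -subr_eq0 -normr_le0.
  apply: (@le_halving _ _ 4 d (maxn j n)) => // m; rewrite geq_max => /andP[jm nm].
  have h1 := hF j x m jm; have h2 := hl m nm.
  rewrite add0r; have -> : 4 * d m = 2 * d m + 2 * d m by ring.
  exact: dist_tri h1 h2.
have dF j x : is_derive x 1 (F j) (F j.+1 x).
  have [B B0 hB] : exists2 B : R, 0 <= B & forall z, `|derive1n j.+2 (f j.+2) z| <= B.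
    have [B B0 hB] := test_bnd j.+2 (test_of_support (sf j.+2) (fL j.+2)).
    by exists B => // z; exact: hB.
  have bd n z : (j.+2 <= n)%N -> `|derive1n j.+2 (f n) z| <= B + 4 * d j.+2.
    move=> jn; have h1 := hF' j.+2 n z (leq_trans jn (nk n)).
    have h2 := hF' j.+2 j.+2 z (nk _).
    have h3 : d n <= d j.+2.
      elim: n jn {h1} => // n IHn; rewrite leq_eqVlt => /orP[/eqP <-//|/IHn h].
      have := hd n; have := d0 n; lra.
    have h4 : `|F j.+2 z - derive1n j.+2 (f n) z| <= 2 * d j.+2.
      by apply: le_trans h1 _; rewrite ler_wpM2l.
    have -> : B + 4 * d j.+2 = B + 2 * d j.+2 + 2 * d j.+2 by ring.
    exact: dist_tri3 h4 h2 (hB z).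
  set M := B + 4 * d j.+2.
  have M0 : 0 <= M by have := d0 j.+2; rewrite /M; lra.
  have key y : `|F j y - F j x - (y - x) * F j.+1 x| <= M * `|y - x| ^+ 2.
    apply: (@le_halving _ _ (4 + 2 * `|y - x|) d j.+2) => //.
    move=> n jn.
    have := @smooth_taylor2 R (derive1n j (f n)) x y M (smooth_derive1n _ (sf n)).
    have -> : derive1n 2 (derive1n j (f n)) = derive1n j.+2 (f n) by rewrite -[RHS]/(derive1n 2 _).
    move=> /(_ (fun z _ => bd n z jn)).
    rewrite -derive1nS => h.
    have jn1 : (j.+1 <= n)%N by exact: ltnW.
    have h1 := hF j y n (ltnW jn1); have h2 := hF j x n (ltnW jn1); have h3 := hF j.+1 x n jn1.
    have -> : (4 + 2 * `|y - x|) * d n = (2 + `|y - x|) * (2 * d n) by ring.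
    exact: taylor_perturb h1 h2 h3 h.
  apply: (is_derive_of_quadratic M0 (@ltr01 R)) => e _.
  by have := key (e + x); rewrite addrK.
have sF : smooth (F 0%N).
  apply: (@smooth_coind R (fun g => exists j, g = F j)); last by exists 0%N.
  move=> _ [j ->]; split => [x|]; first exact: is_derive_derivable (dF j x).
  by exists j.+1; exact: derive1_fun.
have FE j : derive1n j (F 0%N) = F j.
  by elim: j => // j IHj; rewrite derive1nS IHj; exact: derive1_fun.
exists (F 0%N); split => [|x xL|n x j jn]; first exact: sF; last first.
  by rewrite (dB _ _ _ sF (sf n)) FE; exact: hF'.
apply/eqP; rewrite -normr_le0; apply: (@le_halving _ _ 2 d 0%N) => // n _.
have := hF 0%N x n (leq0n _); rewrite /= fL// subr0; lra.
Qed.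

(* Gliding hump, since the test functions supported in [-L, L] are not set up as a Frechet space. *)
Lemma banach_steinhaus (T : R -> schwartz_distribution R) (L : R) : 0 <= L ->
  (forall psi, smooth psi -> (forall x, L < `|x| -> psi x = 0) ->
     exists M r0 : R, 0 < r0 /\ forall r, 0 < r < r0 -> `|T r psi| <= M) ->
  exists (k : nat) (C r0 : R), [/\ 0 <= C, 0 < r0 &
    forall r psi (B : R), 0 < r < r0 -> smooth psi -> (forall x, L < `|x| -> psi x = 0) ->
      (forall x, bndAt k B psi x) -> `|T r psi| <= C * B].
Proof.
move=> L0 hT; apply: contrapT => H.
pose good psi := smooth psi /\ forall x, L < `|x| -> psi x = 0.
have tgood psi : good psi -> test_function psi by move=> [s1 s2]; exact: test_of_support s1 s2.
have {}H (k : nat) (C r0 : R) : 0 <= C -> 0 < r0 -> exists r psi (B : R),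
    [/\ 0 < r < r0, good psi, forall x, bndAt k B psi x & C * B < `|T r psi|].
  move=> C0 r00; apply: contrapT => H'; apply: H; exists k, C, r0; split => // r psi B hr sp lp hb.
  rewrite leNgt; apply/negP => h; apply: H'; exists r, psi, B; split => //.
(* A state consists of the partial sum f, the order k of the seminorm in which the next correction
   is measured, and the size d allowed for that correction. *)
pose state := ((R -> R) * nat * R)%type.
pose valid (s : state) := good s.1.1 /\ 0 < s.2.
pose next (s : state * nat) (s' : state) (r : R) := valid s.1 -> valid s' /\
  [/\ (forall x, bndAt s.1.1.2 s.1.2 (fun y => s'.1.1 y - s.1.1.1 y) x),
      (s.1.1.2 < s'.1.2)%N, s'.2 <= s.1.2 / 2, 0 < r < s.2.+1%:R^-1 &
      s.2.+1%:R <= `|T r s'.1.1| /\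
      forall psi, good psi -> (forall x, bndAt s'.1.2 (2 * s'.2) psi x) -> `|T r psi| <= 1].
have step (s : state * nat) : exists sr : state * R, next s sr.1 sr.2.
  case: s => [[[f k] d] n] /=.
  case: (pselect (valid (f, k, d))) => [[/= gf d0]|nv]; last first.
    by exists ((f, k, d), 0) => /nv.
  have [M [r0 [r00 hM]]] := hT f gf.1 gf.2.
  have M0 : 0 <= `|M| by [].
  (* The failure of the bound at order k with the constant (|M| + n + 1) / d yields psi such that (d
     / B) psi has C^k size at most d, while [T r] exceeds |M| + n + 1 on it. *)
  have [r [psi [B [/andP[rp hr] gpsi hB hTr]]]] := H k ((`|M| + n.+1%:R) / d) (Num.min r0 n.+1%:R^-1)
     (ltac:(rewrite divr_ge0// ?addr_ge0// ltW//)) (ltac:(by rewrite lt_min r00 invr_gt0 ltr0n)).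
  move: hr; rewrite lt_min => /andP[rr0 rn].
  have B0 : 0 < B.
    rewrite lt_neqAle (bndAt_ge0 (hB 0)) andbT; apply/eqP => B0.
    have : psi = fun=> 0.
      apply/funext => x; apply/eqP; rewrite -normr_le0 B0; exact: (hB x 0%N).
    by move=> e; move: hTr; rewrite e dist0 normr0 -B0 mulr0 ltxx.
  have [m [C' [C'0 hC']]] := dist_bound (T r) L0.
  pose g := fun y => f y + (d / B) * psi y.
  have sg : smooth g by apply: smoothD; [exact: gf.1|apply: smoothZ; exact: gpsi.1].
  have gg : good g.
    by split => // x xL; rewrite /g gf.2// gpsi.2// mulr0 addr0.
  (* The second bound on the new size uses the continuity of this single [T r]: all later
     corrections together, of size at most twice the new one, change [T r] by at most 1. *)
  exists ((g, maxn k.+1 m, Num.min (d / 2) (2 * (C' + 1))^-1), r) => _ /=.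
  have p0 : 0 < (2 * (C' + 1))^-1 by rewrite invr_gt0 mulr_gt0// ltr_wpDl.
  split; first by split => //=; rewrite lt_min divr_gt0.
  split.
  - move=> x; have -> : (fun y => g y - f y) = fun y => d / B * psi y.
      by apply/funext => y; rewrite /g addrC addKr.
    have := bndAtZ (d / B) gpsi.1 (hB x).
    by rewrite ger0_norm ?divfK ?gt_eqF// divr_ge0// ltW.
  - exact: leq_maxl.
  - by rewrite ge_min lexx.
  - by rewrite rp rn.
  split.
    rewrite /g distD ?distZ; last 3 first.
    - exact: tgood.
    - exact: tgood.
    - by apply: testZ; exact: tgood.
    have h1 : `|T r f| <= `|M|.
      by apply: le_trans (ler_norm _); apply: hM; rewrite rp rr0.
    have h2 : `|M| + n.+1%:R <= `|d / B * T r psi|.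
      rewrite normrM (ger0_norm (ltW (divr_gt0 d0 B0))).
      move: (ltW hTr); rewrite mulrAC ler_pdivrMr// => h.
      by rewrite mulrAC ler_pdivlMr// [d * _]mulrC.
    exact: normD_ge h1 h2.
  move=> phi gphi hphi; apply: le_trans (hC' phi (2 * (2 * (C' + 1))^-1) gphi.1 gphi.2 _) _.
    move=> x _; apply: bndAt_le (hphi x); first exact: leq_maxr.
    by rewrite ler_wpM2l// ge_min lexx orbT.
  have C1 : 0 < C' + 1 by rewrite ltr_wpDl.
  have -> : 2 * (2 * (C' + 1))^-1 = (C' + 1)^-1 by field; rewrite gt_eqF.
  by rewrite ler_pdivrMr// mul1r lerDl.
have [F hF] := choice step.
pose fix seq_ n : state := if n is m.+1 then (F (seq_ m, m)).1 else ((fun=> 0), 0%N, 1).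
pose rr n := (F (seq_ n, n)).2.
have V n : valid (seq_ n).
  elim: n => [|n IHn]; last exact: (hF (seq_ n, n) IHn).1.
  by split => //; split => //; exact: smooth_cst.
have N n := (hF (seq_ n, n) (V n)).2.
have [X [sX XL hX]] := @test_limit (fun n => (seq_ n).1.1) (fun n => (seq_ n).1.2)
   (fun n => (seq_ n).2) L (fun n => (V n).1.1) (fun n => (V n).1.2)
   (ltac:(by elim => // n IHn; apply: leq_ltn_trans IHn _; case: (N n)))
   (ltac:(by move=> n; apply: ltnW; case: (N n)))
   (ltac:(by move=> n; case: (N n))) (ltac:(by move=> n; case: (N n))).
have [M [r0 [r00 hM]]] := hT X sX XL.
have [n nM] : exists n : nat, M + 1 < n.+1%:R /\ n.+1%:R^-1 < r0.
  exists (maxn (Num.truncn (M + 1)) (Num.truncn r0^-1)).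
  have h a : a < (Num.truncn a).+1%:R :> R.
    exact: real_truncnS_gt (num_real a).
  split.
    by apply: lt_le_trans (h _) _; rewrite ler_nat ltnS leq_maxl.
  rewrite invf_plt ?posrE//; apply: lt_le_trans (h _) _; rewrite ler_nat ltnS leq_maxr//.
have [_ _ _ /= /andP[rp rn] [h1 h2]] := N n.
have h3 : `|T (rr n) X| <= M by apply: hM; rewrite rp/=; apply: lt_trans rn nM.2.
have gd : good (fun y => X y - (seq_ n.+1).1.1 y).
  split; first by apply: smoothB; [exact: sX|exact: (V n.+1).1.1].
  by move=> x xL; rewrite XL// (V n.+1).1.2// subr0.
have h4 : `|T (rr n) (fun y => X y - (seq_ n.+1).1.1 y)| <= 1.
  by apply: h2; [exact: gd|move=> x; exact: (hX n.+1 x)].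
rewrite distB in h4; last 2 first.
- exact: test_of_support sX XL.
- by apply: tgood; exact: (V n.+1).1.
have := lerB_dist (T (rr n) (seq_ n.+1).1.1) (T (rr n) X); rewrite distrC => h5.
have := nM.1; move: h1 h3 h4 h5; rewrite -/(rr n) -/(seq_ n.+1); lra.
Qed.

End uniform_boundedness.

(** * Convolutions and mollification *)

Section segment_integral.
Context {R : realType}.
Implicit Types (f g : R -> R) (p q x y z : R).
Local Notation mu := (@lebesgue_measure R).

Definition itg p q f : R := \int[mu]_(x in `[p, q]) f x.

Lemma continuous_itg p q f : continuous f -> mu.-integrable `[p, q] (EFin \o f).
Proof.
move=> cf; apply: (@continuous_compact_integrable R f `[p, q]).
  exact: segment_compact.
exact: continuous_subspaceT.
Qed.

Lemma itgD p q f g : continuous f -> continuous g ->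
  itg p q (fun x => f x + g x) = itg p q f + itg p q g.
Proof. by move=> cf cg; apply: RintegralD => //; exact: continuous_itg. Qed.

Lemma itgB p q f g : continuous f -> continuous g ->
  itg p q (fun x => f x - g x) = itg p q f - itg p q g.
Proof. by move=> cf cg; apply: RintegralB => //; exact: continuous_itg. Qed.

Lemma itgZ p q (c : R) f : continuous f -> itg p q (fun x => c * f x) = c * itg p q f.
Proof. by move=> cf; apply: RintegralZl => //; exact: continuous_itg. Qed.

Lemma itg_cst p q (c : R) : p <= q -> itg p q (fun=> c) = c * (q - p).
Proof.
move=> pq; rewrite /itg Rintegral_cst//; congr (_ * _).
have := @lebesgue_measure_itv R `[p, q]%R; rewrite /= lte_fin => ->.
case: ltP => [|qp]; first by move=> _; rewrite -EFinB.
have /eqP -> : p == q by rewrite eq_le pq qp.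
by rewrite subrr.
Qed.

Lemma itg_ext p q f g : (forall x, p <= x <= q -> f x = g x) -> itg p q f = itg p q g.
Proof. by move=> fg; apply: eq_Rintegral => x; rewrite inE/= in_itv/=; exact: fg. Qed.

Lemma itg_le p q f g : continuous f -> continuous g ->
  (forall x, p <= x <= q -> f x <= g x) -> itg p q f <= itg p q g.
Proof.
move=> cf cg fg; apply: le_Rintegral => //; try exact: continuous_itg.
Qed.

Lemma continuous_norm f : continuous f -> continuous (fun x => `|f x|).
Proof. by move=> cf x; apply: continuous_comp; [exact: cf|exact: norm_continuous]. Qed.

Lemma itg_norm p q f : continuous f -> `|itg p q f| <= itg p q (fun x => `|f x|).
Proof. by move=> cf; apply: le_normr_Rintegral => //; exact: continuous_itg. Qed.

Lemma itg_bound p q f (M : R) : continuous f -> p <= q ->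
  (forall x, p <= x <= q -> `|f x| <= M) -> `|itg p q f| <= M * (q - p).
Proof.
move=> cf pq fM; apply: le_trans (itg_norm _ _ cf) _; rewrite -(itg_cst M pq).
apply: itg_le => //; first exact: continuous_norm.
by move=> x; exact: cst_continuous.
Qed.

Lemma itg_split p q z f : continuous f -> p <= z <= q -> itg p q f = itg p z f + itg z q f.
Proof.
move=> cf /andP[pz zq].
have h := @Rintegral_itvB R f (BLeft p) (BRight q) z (@continuous_itg p q f cf).
have {}h := h (ltac:(by rewrite bnd_simp)) (ltac:(by rewrite bnd_simp)).
rewrite /itg; apply/eqP; rewrite addrC -subr_eq; apply/eqP.
rewrite h Rintegral_itv_obnd_cbnd//.
apply: (integrableS _ _ _ (@continuous_itg z q f cf)) => //.
by apply: subset_itvr; rewrite bnd_simp.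
Qed.

Lemma itg_point p f : itg p p f = 0.
Proof. by rewrite /itg set_itv1 Rintegral_set1. Qed.

Lemma itg_FTC2 p q f : smooth f -> p <= q -> itg p q (derive1 f) = f q - f p.
Proof.
move=> sf; rewrite le_eqVlt => /orP[/eqP <-|pq]; first by rewrite itg_point subrr.
have cf' : continuous (derive1 f) by exact: smooth_continuous (smooth_derive1 sf).
rewrite /itg /Rintegral (@continuous_FTC2 R (derive1 f) f p q pq)//.
- exact: continuous_subspaceT.
- split.
  + by move=> x _; exact: smooth_derivable.
  + by apply: cvg_at_right_filter; exact: smooth_continuous.
  + by apply: cvg_at_left_filter; exact: smooth_continuous.
Qed.

(** Cutting [p, q] into N + 1 equal steps bounds the total increment by C (q - p)^2 / (N + 1). *)
Lemma const_of_quadratic (D : R -> R) p q (C : R) : p <= q -> 0 <= C ->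
  (forall z z', p <= z -> z <= z' -> z' <= q -> `|D z' - D z| <= C * (z' - z) ^+ 2) ->
  D p = D q.
Proof.
move=> pq C0 hD; apply/eqP; rewrite eq_sym -subr_eq0 -normr_le0.
apply/ler_addgt0Pr => e e0; rewrite add0r.
have [N hN] : exists N : nat, C * (q - p) ^+ 2 / e < N.+1%:R.
  by exists (Num.truncn (C * (q - p) ^+ 2 / e)); exact: real_truncnS_gt (num_real _).
have N0 : 0 < N.+1%:R :> R by rewrite ltr0n.
pose s := (q - p) / N.+1%:R.
have s0 : 0 <= s by rewrite divr_ge0// subr_ge0.
have key n : (n <= N.+1)%N -> `|D (p + n%:R * s) - D p| <= n%:R * (C * s ^+ 2).
  elim: n => [|n IHn] nN; first by rewrite !mul0r addr0 subrr normr0.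
  have h1 := IHn (ltnW nN).
  have h2 : `|D (p + n.+1%:R * s) - D (p + n%:R * s)| <= C * s ^+ 2.
    have -> : s ^+ 2 = ((p + n.+1%:R * s) - (p + n%:R * s)) ^+ 2 by rewrite -natr1; ring.
    apply: hD.
    - by rewrite lerDl mulr_ge0.
    - by rewrite lerD2l ler_wpM2r// ler_nat.
    - rewrite -lerBrDl; apply: (@le_trans _ _ (N.+1%:R * s)).
        by rewrite ler_wpM2r// ler_nat.
      by rewrite /s mulrC divfK ?gt_eqF.
  have -> : n.+1%:R * (C * s ^+ 2) = C * s ^+ 2 + n%:R * (C * s ^+ 2) by rewrite -natr1; ring.
  have := ler_distD (D (p + n%:R * s)) (D (p + n.+1%:R * s)) (D p); lra.
have := key N.+1 (leqnn _).
have -> : p + N.+1%:R * s = q by rewrite /s mulrC divfK ?gt_eqF// addrC subrK.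
move=> h; apply: le_trans h _.
have -> : N.+1%:R * (C * s ^+ 2) = C * (q - p) ^+ 2 / N.+1%:R.
  by rewrite /s; field; rewrite nat1r; exact: lt0r_neq0.
by rewrite ler_pdivrMr//; move: (ltW hN); rewrite ler_pdivrMr// [e * _]mulrC.
Qed.

(** All derivatives are bounded but the support is arbitrary, so that Gaussians are included. *)
Definition smooth_bounded f := smooth f /\
  forall k, exists2 B : R, 0 <= B & forall x, bndAt k B f x.

Lemma smooth_bounded_derive1 f : smooth_bounded f -> smooth_bounded (derive1 f).
Proof.
move=> [sf hf]; split; first exact: smooth_derive1.
move=> k; have [B B0 hB] := hf k.+1; exists B => // x.
by have [_] := (bndAtS _ _ _ _).1 (hB x).
Qed.

Definition conv_itg p q f psi y : R := itg p q (fun x => f (y - x) * psi x).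

Lemma continuous_convM f psi y : continuous f -> continuous psi ->
  continuous (fun x => f (y - x) * psi x).
Proof.
move=> cf cpsi x; apply: continuousM; last exact: cpsi.
apply: continuous_comp; last exact: cf.
by apply: continuousB; [exact: cst_continuous | exact: cvg_id].
Qed.

Lemma is_derive_conv p q f psi y : p <= q -> smooth_bounded f -> continuous psi ->
  is_derive y 1 (conv_itg p q f psi) (conv_itg p q (derive1 f) psi y).
Proof.
move=> pq bf cpsi.
have [sf /(_ 2%N)[B B0 hB]] := bf.
have cf := smooth_continuous sf; have cf' := smooth_continuous (smooth_derive1 sf).
have [c _ hc] := @EVT_max R (fun x => `|psi x|) p q pq (continuous_subspaceT (continuous_norm cpsi)).
set P := `|psi c| in hc.
have hP x : p <= x <= q -> `|psi x| <= P by move=> xpq; apply: hc; rewrite in_itv.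
pose M := B * P * (q - p).
have M0 : 0 <= M by rewrite !mulr_ge0 ?normr_ge0// subr_ge0.
have key e : `|conv_itg p q f psi (e + y) - conv_itg p q f psi y -
    e * conv_itg p q (derive1 f) psi y| <= M * `|e| ^+ 2.
  have c1 z := @continuous_convM f psi z cf cpsi.
  have c2 := @continuous_convM _ psi y cf' cpsi.
  have c3 : continuous (fun x => e * (derive1 f (y - x) * psi x)).
    by move=> x; apply: cvgMr; exact: c2.
  have c4 : continuous (fun x => f (e + y - x) * psi x - f (y - x) * psi x).
    by move=> x; apply: cvgB; exact: c1.
  rewrite /conv_itg -(@itgZ p q e _ c2) -(@itgB p q _ _ (c1 (e + y)) (c1 y)) -(@itgB p q _ _ c4 c3).
  have -> : M * `|e| ^+ 2 = (B * `|e| ^+ 2 * P) * (q - p) by rewrite /M; ring.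
  apply: itg_bound => //.
    by move=> x; apply: cvgB; [exact: c4|exact: c3].
  move=> x xpq; have -> : f (e + y - x) * psi x - f (y - x) * psi x -
    e * (derive1 f (y - x) * psi x) = (f (e + y - x) - f (y - x) - e * derive1 f (y - x)) * psi x by ring.
  rewrite normrM ler_pM//; last exact: hP.
  have := @smooth_taylor2 R f (y - x) (e + y - x) B sf (fun z _ => hB z 2%N isT).
  by have -> : e + y - x - (y - x) = e by ring.
by apply: (is_derive_of_quadratic M0 (@ltr01 R)) => e _; exact: key.
Qed.

Lemma smooth_conv p q f psi : p <= q -> smooth_bounded f -> continuous psi ->
  smooth (conv_itg p q f psi).
Proof.
move=> pq bf cpsi.
apply: (@smooth_coind R (fun g => exists2 f, smooth_bounded f & g = conv_itg p q f psi)); last by exists f.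
move=> _ [g bg ->]; split => [y|].
  exact: is_derive_derivable (is_derive_conv y pq bg cpsi).
exists (derive1 g); first exact: smooth_bounded_derive1.
by apply: derive1_fun => y; exact: is_derive_conv.
Qed.

Lemma derive1n_conv p q f psi n : p <= q -> smooth_bounded f -> continuous psi ->
  derive1n n (conv_itg p q f psi) = conv_itg p q (derive1n n f) psi.
Proof.
move=> pq + cpsi; elim: n f => // n IHn f bf.
rewrite -!derive1nSr -IHn; last exact: smooth_bounded_derive1.
congr (derive1n n _); apply: derive1_fun => y; exact: is_derive_conv.
Qed.

End segment_integral.

(** * Pairings with the translates of a fixed function *)

Section translations.
Context {R : realType}.
Implicit Types (f g psi chi : R -> R) (x y : R) (h : schwartz_distribution R).

Lemma smooth_shift x f : smooth f -> smooth (fun y => f (y - x)).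
Proof.
by move=> /(smooth_aff 1 (- x)); congr smooth; apply/funext => y; rewrite mul1r.
Qed.

Arguments smooth_shift x {f} _.

Lemma derive1n_shift x f n : smooth f ->
  derive1n n (fun y => f (y - x)) = fun y => derive1n n f (y - x).
Proof.
move=> sf; have := derive1n_aff 1 (- x) n sf.
have -> : (fun y => f (1 * y + - x)) = fun y => f (y - x).
  by apply/funext => y; rewrite mul1r.
by move=> ->; apply/funext => y; rewrite expr1n !mul1r.
Qed.

Lemma derive1nB f g n : smooth f -> smooth g ->
  derive1n n (fun y => f y - g y) = fun y => derive1n n f y - derive1n n g y.
Proof.
move=> sf sg; have -> : (fun y => f y - g y) = fun y => f y + (-1) * g y.
  by apply/funext => y; rewrite mulN1r.
rewrite (derive1nD n sf (smoothZ (-1) sg)) (derive1nZ (-1) n sg).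
by apply/funext => y; rewrite mulN1r.
Qed.

Lemma bndAt_lipschitz k f (B : R) x y : smooth f -> (forall z, bndAt k.+1 B f z) ->
  forall j, (j <= k)%N -> `|derive1n j f x - derive1n j f y| <= B * `|x - y|.
Proof.
move=> sf hB j jk; apply: derivable_lipschitz.
  by move=> z; exact: smooth_derivable (smooth_derive1n j sf).
by move=> z _; rewrite -derive1nS; apply: hB.
Qed.

(** The order and the constant are made explicit so that one estimate serves a whole bounded family
    of distributions. *)
Definition dist_bounded h (K : R) (m : nat) (C0 : R) := forall psi (B : R),
  smooth psi -> (forall x, K < `|x| -> psi x = 0) -> (forall x, bndAt m B psi x) ->
  `|h psi| <= C0 * B.

Lemma dist_boundedP h (K : R) : 0 <= K -> exists (m : nat) (C0 : R), 0 <= C0 /\ dist_bounded h K m C0.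
Proof.
move=> K0; have [m [C [C0 hC]]] := dist_bound h K0.
by exists m, C; split => // psi B sp pK hB; apply: hC => // x _; exact: hB.
Qed.

Variables (chi f : R -> R) (K : R).
Hypotheses (sc : smooth chi) (cK : forall x, K < `|x| -> chi x = 0).
Hypothesis bf : smooth_bounded f.

Let tc : test_function chi := test_of_support sc cK.

Lemma test_chi_shift x : test_function (fun y => chi y * f (y - x)).
Proof. by apply: testM; [exact: tc|apply: smooth_shift; exact: bf.1]. Qed.

Lemma transl_bound (m : nat) : exists2 c : R, 0 <= c & forall h C0, dist_bounded h K m C0 ->
  forall x, `|h (fun y => chi y * f (y - x))| <= C0 * c.
Proof.
have [A A0 hA] := test_bnd m tc; have [B B0 hB] := bf.2 m.
exists (2 ^+ m * A * B); first by rewrite !mulr_ge0.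
move=> h C0 hh x; apply: hh.
- by apply: smoothM; [exact: sc|apply: smooth_shift; exact: bf.1].
- by move=> y yK; rewrite cK// mul0r.
- move=> y; apply: bndAtM; [exact: sc|apply: smooth_shift; exact: bf.1|exact: hA|].
  by move=> j jm; rewrite (derive1n_shift _ _ bf.1); exact: hB.
Qed.

(** Translation is Lipschitz in C^m at the cost of one derivative. The constant [c] is chosen before
    [h], so that equicontinuity holds for a bounded family. *)
Lemma transl_lipschitz (m : nat) : exists2 c : R, 0 <= c & forall h C0, dist_bounded h K m C0 ->
  forall x x', `|h (fun y => chi y * f (y - x)) - h (fun y => chi y * f (y - x'))| <= C0 * c * `|x - x'|.
Proof.
have [A A0 hA] := test_bnd m tc; have [B B0 hB] := bf.2 m.+1.
exists (2 ^+ m * A * B); first by rewrite !mulr_ge0.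
move=> h C0 hh x x'; rewrite -distB; [|exact: test_chi_shift|exact: test_chi_shift].
have -> : (fun y => chi y * f (y - x) - chi y * f (y - x')) =
          (fun y => chi y * (f (y - x) - f (y - x'))) by apply/funext => y; ring.
have s1 z : smooth (fun y => f (y - z)) by apply: smooth_shift; exact: bf.1.
rewrite -mulrA -(mulrA _ B); apply: hh.
- by apply: smoothM; [exact: sc|apply: smoothB; exact: s1].
- by move=> y yK; rewrite cK// mul0r.
- move=> y; apply: bndAtM; [exact: sc|apply: smoothB; exact: s1|exact: hA|].
  move=> j jm; rewrite (derive1nB _ (s1 x) (s1 x')) !(derive1n_shift _ _ bf.1).
  apply: le_trans (bndAt_lipschitz _ _ bf.1 hB jm) _.
  by rewrite (_ : y - x - (y - x') = x' - x) 1?distrC//; ring.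
Qed.

Lemma continuous_transl h : continuous (fun x => h (fun y => chi y * f (y - x))).
Proof.
have [m [C0 [C00 hC0]]] := dist_boundedP h (normr_ge0 K).
have {}hC0 : dist_bounded h K m C0.
  move=> psi B sp pK hB; apply: hC0; [exact: sp| |exact: hB].
  by move=> x xK; apply: pK; apply: le_lt_trans xK; exact: ler_norm.
have [c c0 hc] := transl_lipschitz m.
move=> x; apply/cvgrPdist_le => e e0; near=> z.
apply: le_trans (hc _ _ hC0 x z) _.
have : `|x - z| <= e / (C0 * c + 1).
  near: z; apply: cvgr_dist_le; first exact: cvg_id.
  by rewrite divr_gt0// ltr_wpDl// mulr_ge0.
rewrite ler_pdivlMr ?ltr_wpDl ?mulr_ge0// => h1; apply: le_trans h1.
by rewrite mulrC ler_wpM2l// lerDl.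
Unshelve. all: by end_near. Qed.

(** Regard the difference of the two sides as a function of the upper end point. Over a short
    segment both sides agree with the length times the value at the left end, up to the square of
    the length; hence the difference is constant, and it is 0 at p. *)
Lemma dist_fubini h psi (p q : R) : p <= q -> test_function psi ->
  h (fun y => chi y * conv_itg p q f psi y) =
  itg p q (fun x => h (fun y => chi y * f (y - x)) * psi x).
Proof.
move=> pq tp.
have [m [C0 [C00 hC0]]] := dist_boundedP h (normr_ge0 K).
have {}hC0 : dist_bounded h K m C0.
  move=> phi B sp pK hB; apply: hC0; [exact: sp| |exact: hB].
  by move=> x xK; apply: pK; apply: le_lt_trans xK; exact: ler_norm.
have [c c0 hc] := transl_lipschitz m; have [c' c'0 hc'] := transl_bound m.
have [A A0 hA] := test_bnd m tc; have [B B0 hB] := bf.2 m.+1.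
have [P P0 hP] := test_bnd 1 tp.
have sf := bf.1; have cf := smooth_continuous sf; have cp := smooth_continuous tp.1.
pose b x := h (fun y => chi y * f (y - x)).
have cb : continuous b by exact: continuous_transl.
have cbp : continuous (fun x => b x * psi x) by move=> x; apply: cvgM; [exact: cb|exact: cp].
have lp x x' : `|psi x - psi x'| <= P * `|x - x'|.
  exact: (bndAt_lipschitz x x' tp.1 hP (leqnn 0)).
have np x : `|psi x| <= P by exact: (hP x 0%N).
have tI z z' : z <= z' -> test_function (fun y => chi y * conv_itg z z' f psi y).
  by move=> zz; apply: testM; [exact: tc|exact: smooth_conv].
pose D z := h (fun y => chi y * conv_itg p z f psi y) - itg p z (fun x => b x * psi x).
have Dp : D p = 0.
  rewrite /D itg_point subr0 -[RHS](dist0 h); congr (dist_fun h _).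
  by apply/funext => y; rewrite /conv_itg itg_point mulr0.
suff : D p = D q by rewrite Dp => /esym/eqP; rewrite subr_eq0 => /eqP.
pose C := C0 * (2 ^+ m * A * (2 * B * P)) + (C0 * c * P + C0 * c' * P).
have CC : 0 <= C by rewrite /C !(addr_ge0, mulr_ge0).
apply: (@const_of_quadratic R D p q C pq CC) => z z' pz zz' z'q.
have pz' : p <= z' by exact: le_trans zz'.
have pzz' : p <= z <= z' by rewrite pz zz'.
have s0 : 0 <= z' - z by rewrite subr_ge0.
have e1 : D z' - D z = h (fun y => chi y * conv_itg z z' f psi y) - itg z z' (fun x => b x * psi x).
  rewrite /D (itg_split cbp pzz').
  have -> : (fun y => chi y * conv_itg p z' f psi y) =
     fun y => chi y * conv_itg p z f psi y + chi y * conv_itg z z' f psi y.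
    apply/funext => y; rewrite -mulrDr; congr (_ * _).
    have cy : continuous (fun x => f (y - x) * psi x) by exact: continuous_convM.
    exact: (itg_split cy pzz').
  rewrite distD; [|exact: tI|exact: tI].
  by ring.
have tz : test_function (fun y => (z' - z) * psi z * (chi y * f (y - z))).
  by apply: testZ; exact: test_chi_shift.
have e2 : h (fun y => (z' - z) * psi z * (chi y * f (y - z))) = (z' - z) * (b z * psi z).
  by rewrite distZ; [rewrite -/(b z); ring|exact: test_chi_shift].
have -> : D z' - D z =
  h (fun y => chi y * conv_itg z z' f psi y - (z' - z) * psi z * (chi y * f (y - z))) -
  (itg z z' (fun x => b x * psi x) - (z' - z) * (b z * psi z)).
  by rewrite e1 distB; [rewrite e2; ring|exact: tI|exact: tz].
apply: le_trans (ler_normB _ _) _; rewrite /C [leRHS]mulrDl; apply: lerD; last first.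
  have -> : (z' - z) * (b z * psi z) = itg z z' (fun=> b z * psi z) by rewrite itg_cst// mulrC.
  rewrite -itgB; [|exact: cbp|exact: cst_continuous].
  rewrite expr2 mulrA; apply: itg_bound => //.
    by move=> x; apply: cvgB; [exact: cbp|exact: cst_continuous].
  move=> x /andP[zx xz'].
  have -> : b x * psi x - b z * psi z = (b x - b z) * psi x + b z * (psi x - psi z) by ring.
  have xz : `|x - z| <= z' - z by rewrite ger0_norm ?subr_ge0// lerB.
  apply: le_trans (ler_normD _ _) _; rewrite [leRHS]mulrDl !normrM; apply: lerD.
    rewrite mulrAC; apply: ler_pM => //; apply: le_trans (hc _ _ hC0 x z) _.
    by rewrite ler_wpM2l// mulr_ge0.
  rewrite -mulrA; apply: ler_pM => //; first exact: hc'.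
  by apply: le_trans (lp x z) _; rewrite ler_wpM2l.
have sI : smooth (fun y => conv_itg z z' f psi y - (z' - z) * psi z * f (y - z)).
  apply: smoothB; first exact: smooth_conv.
  by apply: smoothZ; apply: smooth_shift; exact: sf.
have -> : (fun y => chi y * conv_itg z z' f psi y - (z' - z) * psi z * (chi y * f (y - z))) =
   fun y => chi y * (conv_itg z z' f psi y - (z' - z) * psi z * f (y - z)).
  by apply/funext => y; ring.
have -> : C0 * (2 ^+ m * A * (2 * B * P)) * (z' - z) ^+ 2 =
   C0 * (2 ^+ m * A * (2 * B * P * (z' - z) ^+ 2)) by ring.
apply: hC0.
- by apply: smoothM; [exact: sc|exact: sI].
- by move=> y yK; rewrite cK// mul0r.
- move=> y; apply: bndAtM; [exact: sc|exact: sI|exact: hA|].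
  move=> j jm; rewrite (derive1nB _ (smooth_conv zz' bf cp) (smoothZ _ (smooth_shift z sf))).
  rewrite derive1n_conv// (derive1nZ _ _ (smooth_shift z sf)) (derive1n_shift _ _ sf).
  have cfj := smooth_continuous (smooth_derive1n j sf).
  have ci : continuous (fun x => derive1n j f (y - x) * psi x) by exact: continuous_convM.
  have -> : (z' - z) * psi z * derive1n j f (y - z) =
     itg z z' (fun=> psi z * derive1n j f (y - z)) by rewrite itg_cst//; ring.
  rewrite /conv_itg -itgB; [|exact: ci|exact: cst_continuous].
  rewrite expr2 mulrA; apply: itg_bound => //.
    by move=> x; apply: cvgB; [exact: ci|exact: cst_continuous].
  move=> x /andP[zx xz'].
  have xz : `|x - z| <= z' - z by rewrite ger0_norm ?subr_ge0// lerB.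
  have -> : derive1n j f (y - x) * psi x - psi z * derive1n j f (y - z) =
     (derive1n j f (y - x) - derive1n j f (y - z)) * psi x + derive1n j f (y - z) * (psi x - psi z) by ring.
  have -> : 2 * B * P * (z' - z) = B * (z' - z) * P + B * (P * (z' - z)) by ring.
  apply: le_trans (ler_normD _ _) _; rewrite !normrM; apply: lerD.
    apply: ler_pM => //; apply: le_trans (bndAt_lipschitz _ _ sf hB jm) _.
    rewrite ler_wpM2l// (_ : y - x - (y - z) = z - x) 1?distrC//; ring.
  apply: ler_pM => //; first by apply: hB; exact: leqW.
  by apply: le_trans (lp x z) _; rewrite ler_wpM2l.
Qed.

End translations.

(** * The Gaussian kernel and mollification by it *)

Section gauss_kernel.
Context {R : realType}.
Implicit Types (f g psi chi : R -> R) (x y t : R).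
Local Notation mu := (@lebesgue_measure R).
Local Notation gauss_fun := (@gauss_fun R).

Lemma smooth_sqr : smooth (fun z : R => z ^+ 2).
Proof. by have := smoothM (@smooth_id R) smooth_id; congr smooth; apply/funext => y; rewrite expr2. Qed.

Lemma smooth_gauss_fun : smooth gauss_fun.
Proof. by apply: (smooth_comp smooth_expR); apply: smoothN; exact: smooth_sqr. Qed.

Lemma derive1n_gauss_fun j : exists p : {poly R}, forall z, derive1n j gauss_fun z = p.[z] * gauss_fun z.
Proof.
elim: j => [|j [p hp]]; first by exists 1 => z; rewrite hornerE mul1r.
exists (p^`()%R - p * ('X *+ 2)) => z; rewrite derive1nS (_ : derive1n j gauss_fun = fun z => p.[z] * gauss_fun z); last exact/funext.
apply: is_derive1E.
have h1 : is_derive z 1 (horner p) p^`()%R.[z] by exact: is_derive_poly.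
have h2 : is_derive z 1 (fun z : R => - z ^+ 2) (- (z *+ 2)).
  have h3 := @is_deriveMf R id id z 1 1 (is_derive_id _ _) (is_derive_id _ _).
  have h4 := @is_deriveZf R (-1) _ z _ h3.
  move: h4; rewrite !mulr1 mul1r -mulr2n mulN1r; congr is_derive.
  by apply/funext => u; rewrite mulN1r expr2.
have h3 := @is_derive_compf R expR (fun z => - z ^+ 2) z _ _ (is_derive_expR _) h2.
have := @is_deriveMf R (horner p) gauss_fun z _ _ h1 h3.
move/is_derive_eq; apply.
rewrite hornerD hornerN hornerM hornerMn hornerX /gauss_fun; ring.
Qed.

(** A quarter of the exponent pays for the polynomial factor of the derivatives. The remaining rate
    3/4 exceeds 1/2, which leaves the room used by [corner_exponent]. *)
Lemma gauss_fun_bound k : exists2 C : R, 0 <= C &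
  forall x, bndAt k (C * expR (- (3 / 4 * x ^+ 2))) gauss_fun x.
Proof.
have key j : exists2 C : R, 0 <= C & forall x,
    `|derive1n j gauss_fun x| <= C * expR (- (3 / 4 * x ^+ 2)).
  have [p hp] := derive1n_gauss_fun j.
  have [C C0 hC] := poly_le_expR p (@ltr01 R).
  exists (C * expR 1); first by rewrite mulr_ge0// expR_ge0.
  move=> x; rewrite hp normrM [X in _ * X]ger0_norm ?expR_ge0//.
  apply: (@le_trans _ _ (C * expR (1 * `|x|) * gauss_fun x)).
    by rewrite ler_wpM2r// expR_ge0.
  rewrite -!mulrA ler_wpM2l// /gauss_fun -!expRD ler_expR mul1r -(real_normK (num_real x)).
  have : 0 <= (`|x| / 2 - 1) ^+ 2 by exact: sqr_ge0.
  have -> : (`|x| / 2 - 1) ^+ 2 = `|x| ^+ 2 / 4 - `|x| + 1 by field.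
  lra.
elim: k => [|k [C C0 hC]].
  have [C C0 hC] := key 0%N; exists C => // x [|//] _; exact: hC.
have [D D0 hD] := key k.+1; exists (C + D); first exact: addr_ge0.
move=> x j; rewrite leq_eqVlt => /orP[/eqP ->|].
  by apply: le_trans (hD x) _; rewrite ler_wpM2r ?expR_ge0// lerDr.
by rewrite ltnS => /(hC x) h; apply: le_trans h _; rewrite ler_wpM2r ?expR_ge0// lerDl.
Qed.

Lemma smooth_bounded_gauss_fun : smooth_bounded gauss_fun.
Proof.
split; first exact: smooth_gauss_fun.
move=> k; have [C C0 hC] := gauss_fun_bound k; exists C => // x.
apply: bndAt_le (hC x) => //; rewrite ler_piMr// -expR0 ler_expR oppr_le0.
by rewrite mulr_ge0// sqr_ge0.
Qed.

Lemma smooth_bounded_aff (s c : R) f : smooth_bounded f -> smooth_bounded (fun y => s * f (c * y)).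
Proof.
move=> [sf hf].
have s1 : smooth (fun y => f (c * y)).
  by have := smooth_aff c 0 sf; congr smooth; apply/funext => y; rewrite addr0.
split; first by apply: smoothZ; exact: s1.
move=> k; have [B B0 hB] := hf k; exists (`|s| * ((1 + `|c|) ^+ k * B)).
  by rewrite !mulr_ge0// exprn_ge0// addr_ge0.
move=> x; apply: bndAtZ; first exact: s1.
have -> : (fun y => f (c * y)) = fun y => f (c * y + 0) by apply/funext => y; rewrite addr0.
by apply: bndAt_aff; [exact: sf|exact: hB].
Qed.

Definition gauss_kernel (u : R) : R := (Num.sqrt pi)^-1 * gauss_fun u.

(** The normal density of variance t^2 / 2; as a function of x and T = t^2 it solves f_T = f_xx /
    4. *)
Definition gauss_scaled t u : R := t^-1 * gauss_kernel (t^-1 * u).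

Lemma sqrt_pi_gt0 : 0 < Num.sqrt (@pi R).
Proof. by rewrite sqrtr_gt0 pi_gt0. Qed.

Lemma smooth_bounded_gauss_kernel : smooth_bounded gauss_kernel.
Proof.
have := smooth_bounded_aff (Num.sqrt pi)^-1 1 smooth_bounded_gauss_fun.
by congr smooth_bounded; apply/funext => y; rewrite mul1r.
Qed.

Lemma smooth_bounded_gauss_scaled t : smooth_bounded (gauss_scaled t).
Proof. exact: smooth_bounded_aff smooth_bounded_gauss_kernel. Qed.

Lemma gauss_kernel_ge0 u : 0 <= gauss_kernel u.
Proof. by rewrite mulr_ge0 ?invr_ge0 ?sqrtr_ge0// expR_ge0. Qed.

Lemma gauss_scaledE t y x : 0 < t -> gauss_scaled t (y - x) = normal_pdf y (t / Num.sqrt 2) x.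
Proof.
move=> t0; have s20 : 0 < Num.sqrt (2 : R) by rewrite sqrtr_gt0.
rewrite normal_pdfE; last by rewrite gt_eqF// divr_gt0.
rewrite /gauss_scaled /gauss_kernel /normal_peak /normal_fun mulrA; congr (_ * _).
  have -> : (t / Num.sqrt 2) ^+ 2 * pi *+ 2 = t ^+ 2 * pi.
    by rewrite expr_div_n sqr_sqrtr// -mulr_natr; field.
  by rewrite sqrtrM ?sqr_ge0// sqrtr_sqr gtr0_norm// invfM.
rewrite /gauss_fun; congr (expR _).
have -> : (t / Num.sqrt 2) ^+ 2 *+ 2 = t ^+ 2.
  by rewrite expr_div_n sqr_sqrtr// -mulr_natr; field.
by field; rewrite gt_eqF.
Qed.

(** With v = |x - y| / t one has v e^(-v^2 / 2) <= 1: the factor |x - y| is absorbed by doubling the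
    variance. *)
Lemma gauss_moment t y x : 0 < t ->
  gauss_scaled t (y - x) * `|x - y| <= t * Num.sqrt 2 * normal_pdf y t x.
Proof.
move=> t0; have s20 : 0 < Num.sqrt (2 : R) by rewrite sqrtr_gt0.
have -> : normal_pdf y t x =
    (t * Num.sqrt pi * Num.sqrt 2)^-1 * expR (- (x - y) ^+ 2 / (t ^+ 2 *+ 2)).
  rewrite normal_pdfE ?gt_eqF// /normal_peak /normal_fun; congr (_^-1 * _).
  have tp : 0 <= t ^+ 2 * pi by apply: mulr_ge0; [exact: sqr_ge0|exact: pi_ge0].
  by rewrite -mulr_natr (sqrtrM _ tp) (sqrtrM _ (sqr_ge0 t)) sqrtr_sqr gtr0_norm.
rewrite /gauss_scaled /gauss_kernel.
suff h : t^-1 * ((Num.sqrt pi)^-1 * gauss_fun (t^-1 * (y - x))) * `|x - y| <=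
    t^-1 * (Num.sqrt pi)^-1 * (t * expR (- (x - y) ^+ 2 / (t ^+ 2 *+ 2))).
  apply: le_trans h _; rewrite le_eqVlt; apply/orP; left; apply/eqP.
  have h1 := sqrt_pi_gt0; move: h1 s20.
  move: (Num.sqrt 2) (Num.sqrt pi) (expR _) => a b c b0 a0.
  by field; rewrite !gt_eqF.
rewrite mulrA -[leLHS]mulrA ler_wpM2l ?mulr_ge0 ?invr_ge0 ?sqrtr_ge0 ?(ltW t0)//.
set v := `|x - y| / t.
have -> : `|x - y| = v * t by rewrite /v divfK ?gt_eqF.
have -> : gauss_fun (t^-1 * (y - x)) = expR (- (v ^+ 2 / 2)) * expR (- (v ^+ 2 / 2)).
  rewrite /gauss_fun -expRD; congr (expR _); rewrite /v expr_div_n real_normK ?num_real//.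
  by field; rewrite gt_eqF.
have -> : - (x - y) ^+ 2 / (t ^+ 2 *+ 2) = - (v ^+ 2 / 2).
  rewrite /v expr_div_n real_normK ?num_real//.
  by rewrite -mulr_natr; field; rewrite gt_eqF.
rewrite -mulrA mulrCA [leRHS]mulrC ler_wpM2l ?expR_ge0//.
rewrite mulrA ler_piMl// ?(ltW t0)// expRN mulrC ler_pdivrMr ?expR_gt0// mul1r.
apply: le_trans (expR_ge1Dx _).
have : 0 <= (v - 1) ^+ 2 by exact: sqr_ge0.
have -> : (v - 1) ^+ 2 = v ^+ 2 - 2 * v + 1 by ring.
lra.
Qed.

(** The error is at most B times the first moment of the kernel, which is O(t); the constant sqrt 2
    is rounded up to 2. *)
Lemma gauss_mollify t g (L B y : R) : 0 < t -> 0 <= L -> continuous g ->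
  (forall x, L < `|x| -> g x = 0) -> (forall x x', `|g x - g x'| <= B * `|x - x'|) -> 0 <= B ->
  `|g y - conv_itg (- L) L (gauss_scaled t) g y| <= 2 * B * t.
Proof.
move=> t0 L0 cg gL lg B0.
have s20 : 0 < Num.sqrt (2 : R) by rewrite sqrtr_gt0.
pose k x := normal_pdf y (t / Num.sqrt 2) x.
have ik : mu.-integrable setT (EFin \o k) by exact: integrable_normal_pdf.
pose d x := k x * (g y - g x).
have mg : measurable_fun setT g by exact: continuous_measurable_fun.
have mk : measurable_fun setT k by exact: measurable_normal_pdf.
have k0 x : 0 <= k x by exact: normal_pdf_ge0.
have dle x : `|d x| <= B * (t * Num.sqrt 2) * normal_pdf y t x.
  rewrite normrM (ger0_norm (k0 x)) -mulrA; apply: (@le_trans _ _ (B * (k x * `|x - y|))).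
    by rewrite mulrCA ler_wpM2l// distrC.
  by rewrite ler_wpM2l// /k -gauss_scaledE//; exact: gauss_moment.
have ib : mu.-integrable setT (EFin \o (fun x => B * (t * Num.sqrt 2) * normal_pdf y t x)).
  have := @integrableZl _ _ R mu setT measurableT (B * (t * Num.sqrt 2)) _ (integrable_normal_pdf y t).
  by apply: eq_integrable => // x _; rewrite /= EFinM.
have id' : mu.-integrable setT (EFin \o d).
  apply: le_integrable ib => //.
    apply/measurable_EFinP; apply: measurable_funM => //; apply: measurable_funB => //.
  move=> x _; rewrite /= lee_fin [leRHS]ger0_norm ?dle//.
  by rewrite !mulr_ge0 ?normal_pdf_ge0 ?sqrtr_ge0// ltW.
have igy : mu.-integrable setT (EFin \o (fun x => k x * g y)).
  have := @integrableZr _ _ R mu setT measurableT (g y) _ ik.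
  by apply: eq_integrable => // x _; rewrite /= EFinM.
have e1 : conv_itg (- L) L (gauss_scaled t) g y = \int[mu]_x (k x * g y - d x).
  rewrite /conv_itg /itg Rintegral_mkcond; apply: eq_Rintegral => x _.
  rewrite patchE; case: ifPn => xL.
    by rewrite gauss_scaledE// -/(k x) /d; ring.
  have gx : g x = 0.
    apply: gL; rewrite ltNge; apply/negP => h; move/negP: xL; apply.
    by rewrite inE/= in_itv/= -ler_norml.
  by rewrite /d gx subr0 subrr.
rewrite e1 RintegralB// (_ : \int[mu]_x (k x * g y) = g y); last first.
  rewrite RintegralZr//; rewrite /Rintegral.
  have -> : (\int[mu]_x (k x)%:E = 1)%E by exact: integral_normal_pdf.
  by rewrite mul1r.
rewrite opprB addrC subrK.
apply: le_trans (le_normr_Rintegral _ _) _ => //.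
apply: (@le_trans _ _ (\int[mu]_x (B * (t * Num.sqrt 2) * normal_pdf y t x))).
  apply: le_Rintegral => //.
  by have := integrable_norm id'; apply: eq_integrable.
rewrite RintegralZl//; last exact: integrable_normal_pdf.
have -> : \int[mu]_x normal_pdf y t x = 1 by rewrite /Rintegral integral_normal_pdf.
rewrite mulr1 mulrA [_ * t]mulrC -!mulrA; rewrite [leRHS](_ : _ = t * (B * 2)); last by ring.
rewrite ler_wpM2l ?(ltW t0)// ler_wpM2l//.
rewrite -[leRHS]ger0_norm// -sqrtr_sqr ler_wsqrtr//; lra.
Qed.

End gauss_kernel.

(** * Weak convergence to zero *)

Section uniform_smallness.
Context {R : realType}.
Implicit Types (f g psi chi : R -> R) (x y t r : R) (h : schwartz_distribution R).

Lemma continuous_supp_closed f (L : R) : continuous f -> (forall x, L < `|x| -> f x = 0) ->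
  forall x, L <= `|x| -> f x = 0.
Proof.
move=> cf fL x xL; apply/eqP; rewrite -normr_le0; apply/ler_addgt0Pr => e e0; rewrite add0r.
have [d /= d0 hd] := (cvgrPdist_le _ _).1 (cf x) e e0.
pose s : R := if 0 <= x then 1 else -1.
have y1 : `|x - (x + s * (d / 2))| < d.
  rewrite opprD addrA subrr add0r normrN normrM (_ : `|s| = 1) ?mul1r.
    by rewrite gtr0_norm ?divr_gt0//; lra.
  by rewrite /s; case: ifP; rewrite ?normrN normr1.
have y2 : L < `|x + s * (d / 2)|.
  apply: le_lt_trans xL _; rewrite /s; case: (lerP 0 x) => x0.
    by rewrite mul1r [ltRHS]ger0_norm ?(ger0_norm x0); lra.
  by rewrite mulN1r [ltRHS]ltr0_norm ?(ltr0_norm x0); lra.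
have := hd (x + s * (d / 2)) y1.
by rewrite (fL _ y2) subr0.
Qed.

Lemma derive1_supp f (L : R) : (forall x, L < `|x| -> f x = 0) ->
  forall x, L < `|x| -> derive1 f x = 0.
Proof.
move=> fL x xL; rewrite derive1E -(derive_cst (0 : R) x 1); apply: near_eq_derive.
have : \forall y \near x, L < `|y|.
  have h : (fun y : R => `|y|) z @[z --> x] --> `|x| by exact: norm_continuous.
  by move/cvgr_gt : h; apply.
by apply: filterS => y /fL ->.
Qed.

Lemma derive1n_supp f (L : R) n : (forall x, L < `|x| -> f x = 0) ->
  forall x, L < `|x| -> derive1n n f x = 0.
Proof.
by move=> fL; elim: n => [|n IHn]; [exact: fL|rewrite derive1nS; exact: derive1_supp].
Qed.

(** Moving derivatives from the kernel to [psi] keeps the mollification error free of the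
    derivatives of the kernel, which blow up as its width tends to 0. *)
Lemma conv_by_parts f psi (L : R) y : 0 <= L -> smooth f -> smooth psi ->
  (forall x, L < `|x| -> psi x = 0) ->
  conv_itg (- L) L (derive1 f) psi y = conv_itg (- L) L f (derive1 psi) y.
Proof.
move=> L0 sf sp pL; apply/eqP; rewrite -subr_eq0; apply/eqP.
have s1 : smooth (fun x => f (y - x)).
  have := smooth_aff (-1) y sf; congr smooth; apply/funext => x.
  by rewrite mulN1r addrC.
have s2 : smooth (fun x => f (y - x) * psi x) by exact: smoothM.
have c1 : continuous (fun x => derive1 f (y - x) * psi x).
  by apply: continuous_convM; apply: smooth_continuous; [exact: smooth_derive1|].
have c2 : continuous (fun x => f (y - x) * derive1 psi x).
  by apply: continuous_convM; apply: smooth_continuous; [|exact: smooth_derive1].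
rewrite /conv_itg -itgB//.
have LL : - L <= L by lra.
have d1 x : is_derive x 1 (fun x => f (y - x)) (- derive1 f (y - x)).
  have e := @is_derive_aff R (-1) y x.
  have := @is_derive_compf R f (fun x => -1 * x + y) x _ _ (smooth_is_derive _ sf) e.
  rewrite mulrN1; have -> : -1 * x + y = y - x by rewrite mulN1r addrC.
  congr is_derive; apply/funext => u; by rewrite mulN1r addrC.
rewrite (@itg_ext R (- L) L _ (fun x => - derive1 (fun x => f (y - x) * psi x) x)); last first.
  move=> x _; have -> : derive1 (fun x => f (y - x) * psi x) x =
     - derive1 f (y - x) * psi x + f (y - x) * derive1 psi x.
    by apply: is_derive1E; exact: is_deriveMf (d1 x) (smooth_is_derive _ sp).
  by ring.
have -> : (fun x => - derive1 (fun x => f (y - x) * psi x) x) =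
   fun x => -1 * derive1 (fun x => f (y - x) * psi x) x.
  by apply/funext => x; rewrite mulN1r.
rewrite itgZ; last by apply: smooth_continuous; exact: smooth_derive1.
rewrite itg_FTC2// !(continuous_supp_closed (smooth_continuous sp) pL) ?normrN ?ler_norm//.
by rewrite !mulr0 subrr mulr0.
Qed.

Lemma derive1n_conv_by_parts f psi (L : R) y n : 0 <= L -> smooth f -> smooth psi ->
  (forall x, L < `|x| -> psi x = 0) ->
  conv_itg (- L) L (derive1n n f) psi y = conv_itg (- L) L f (derive1n n psi) y.
Proof.
move=> L0 + + +; elim: n f psi => [//|n IHn] f psi sf sp pL.
rewrite derive1nS (@conv_by_parts _ _ L y L0 (smooth_derive1n n sf) sp pL).
by rewrite IHn; [rewrite derive1nSr|exact: sf|exact: smooth_derive1|exact: derive1_supp].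
Qed.

(** As [chi] is 1 on [-L, L], the function minus [chi] times its mollification is [chi] times the
    mollification error, which is O(t) in C^m at the cost of one derivative; [dist_fubini] turns the
    mollified pairing into the integral. The constant [c] depends neither on [h] nor on t. *)
Lemma mollified_pairing chi (L K : R) (m : nat) : 0 <= L -> smooth chi ->
  (forall x, K < `|x| -> chi x = 0) -> (forall x, `|x| <= L -> chi x = 1) ->
  exists2 c : R, 0 <= c & forall h C0, dist_bounded h K m C0 -> forall t psi (B : R), 0 < t ->
    smooth psi -> (forall x, L < `|x| -> psi x = 0) -> (forall x, bndAt m.+1 B psi x) ->
    `|h psi - itg (- L) L (fun x => h (fun y => chi y * gauss_scaled t (y - x)) * psi x)| <=
       C0 * (c * t * B).
Proof.
move=> L0 sc cK c1; have tc := test_of_support sc cK.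
have [A A0 hA] := test_bnd m tc.
exists (2 ^+ m * A * 2); first by rewrite !mulr_ge0.
move=> h C0 hh t psi B t0 sp pL hB.
have B0 : 0 <= B by exact: bndAt_ge0 (hB 0).
have tp := test_of_support sp pL.
have LL : - L <= L by lra.
have bg := smooth_bounded_gauss_scaled t.
have cp := smooth_continuous sp.
rewrite -(dist_fubini sc cK bg h LL tp).
have sI := smooth_conv LL bg cp.
rewrite -distB; [|exact: tp|by apply: testM; [exact: tc|exact: sI]].
have -> : (fun y => psi y - chi y * conv_itg (- L) L (gauss_scaled t) psi y) =
    (fun y => chi y * (psi y - conv_itg (- L) L (gauss_scaled t) psi y)).
  apply/funext => y; rewrite mulrBr; congr (_ - _); case: (lerP `|y| L) => yL.
    by rewrite c1// mul1r.
  by rewrite pL// mulr0.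
have -> : 2 ^+ m * A * 2 * t * B = 2 ^+ m * A * (2 * B * t) by ring.
apply: hh.
- by apply: smoothM; [exact: sc|apply: smoothB; [exact: sp|exact: sI]].
- by move=> x /cK ->; rewrite mul0r.
move=> y; apply: bndAtM; [exact: sc|apply: smoothB; [exact: sp|exact: sI]|exact: hA|].
move=> j jm; rewrite (derive1nB _ sp sI) (derive1n_conv j LL bg cp).
rewrite (@derive1n_conv_by_parts _ _ L y j L0 bg.1 sp pL).
apply: gauss_mollify; [exact: t0|exact: L0| | | |exact: B0].
- by apply: smooth_continuous; exact: smooth_derive1n.
- exact: derive1n_supp.
- move=> x x'; exact: bndAt_lipschitz hB _ jm.
Qed.

Lemma eventually_all (P : nat -> R -> Prop) :
  (forall i, exists2 r0 : R, 0 < r0 & forall r, 0 < r < r0 -> P i r) ->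
  forall N, exists2 r0 : R, 0 < r0 & forall r, 0 < r < r0 -> forall i, (i <= N)%N -> P i r.
Proof.
move=> H; elim => [|N [r0 r00 IH]].
  by have [r0 r00 h] := H 0%N; exists r0 => // r hr [|//] _; exact: h.
have [r1 r10 h] := H N.+1; exists (Num.min r0 r1); first by rewrite lt_min r00.
move=> r /andP[rp]; rewrite lt_min => /andP[h0 h1] i.
rewrite leq_eqVlt => /orP[/eqP ->|]; first by apply: h; rewrite rp.
by rewrite ltnS; apply: IH; rewrite rp.
Qed.

(* A family of distributions that tends to 0 weakly tends to 0 in some C^k-dual norm: mollify
   the test function, and use that translates of a fixed function form a compact family. *)
Lemma uniform_small (T : R -> schwartz_distribution R) (L : R) : 0 <= L ->
  (forall psi, test_function psi -> forall e : R, 0 < e ->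
     exists2 r0 : R, 0 < r0 & forall r, 0 < r < r0 -> `|T r psi| <= e) ->
  exists k : nat, forall e : R, 0 < e -> exists2 r0 : R, 0 < r0 &
    forall r psi (B : R), 0 < r < r0 -> smooth psi -> (forall x, L < `|x| -> psi x = 0) ->
      (forall x, bndAt k B psi x) -> `|T r psi| <= e * B.
Proof.
(* [L] may be 0, and a plateau needs a positive radius. *)
move=> L0 hT; pose L1 := L + 1; have L10 : 0 < L1 by rewrite /L1; lra.
have K0 : 0 <= 2 * L1 by lra.
have [|m [C [r1 [C0 r10 hC]]]] := @banach_steinhaus R T (2 * L1) K0.
  move=> psi sp pK; exists 1.
  have [r0 r00 h] := hT psi (test_of_support sp pK) 1 ltr01.
  by exists r0; split.
have sc : smooth (plateau L1) by exact: smooth_plateau.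
have cK x : 2 * L1 < `|x| -> plateau L1 x = 0 by move=> /ltW; exact: plateau_eq0.
have [c c0 hc] := mollified_pairing m (ltW L10) sc cK (fun x => plateau_eq1 L10).
exists m.+1 => e e0.
have D0 : 0 < C * c + 1 by rewrite ltr_wpDl// mulr_ge0.
(* The width of the mollifier is fixed once and for all, with an error of at most e / 2 per unit of
   B; what remains involves the translates of a single function. *)
pose d := e / 2 / (C * c + 1).
have d0 : 0 < d by rewrite !divr_gt0.
have Ccd : C * c * d <= e / 2.
  rewrite /d mulrA ler_pdivrMr// mulrC ler_wpM2l ?lerDl//; lra.
have [c' c'0 hc'] := transl_lipschitz sc cK (smooth_bounded_gauss_scaled d) m.
pose e1 := e / 2 / (2 * L1).
have e10 : 0 < e1 by rewrite !divr_gt0//; lra.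
have [N hN] : exists N : nat, C * c' * (2 * L1) * 2 / e1 < N.+1%:R.
  by eexists; exact: real_truncnS_gt (num_real _).
(* A net of [-L1, L1] of mesh 2 L1 / (N + 1): weak convergence settles the finitely many translates
   at its points, and the Lipschitz bound all the others. *)
pose xi (i : nat) : R := - L1 + i%:R * (2 * L1 / N.+1%:R).
have [|r2 r20 hr2] := @eventually_all (fun i r =>
    `|T r (fun y => plateau L1 y * gauss_scaled d (y - xi i))| <= e1 / 2) _ N.+1.
  move=> i; apply: hT; last by rewrite divr_gt0.
  by apply: (test_chi_shift sc cK); exact: smooth_bounded_gauss_scaled.
exists (Num.min r1 r2); first by rewrite lt_min r10.
move=> r psi B /andP[rp]; rewrite lt_min => /andP[rr1 rr2] sp pL hB.
have B0 : 0 <= B by exact: bndAt_ge0 (hB 0).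
have hr : dist_bounded (T r) (2 * L1) m C.
  by move=> f B' sf fK hf; apply: hC => //; rewrite rp.
have small x : - L1 <= x <= L1 ->
    `|T r (fun y => plateau L1 y * gauss_scaled d (y - x))| <= e1.
  move=> /andP[x1 x2].
  pose s := 2 * L1 / N.+1%:R.
  have N0 : 0 < N.+1%:R :> R by rewrite ltr0n.
  have s0 : 0 < s by rewrite divr_gt0//; lra.
  pose i := Num.truncn ((x + L1) / s).
  have q0 : 0 <= (x + L1) / s by rewrite divr_ge0 ?(ltW s0)//; lra.
  have /andP[i1 i2] := truncn_itv q0.
  have iN : (i <= N.+1)%N.
    rewrite -(ler_nat R); apply: le_trans i1 _; rewrite ler_pdivrMr// /s.
    by rewrite mulrC divfK ?gt_eqF//; lra.
  have h1 : `|x - xi i| <= s.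
    move: i1 i2; rewrite -/i ler_pdivlMr// ltr_pdivrMr// -natr1 mulrDl mul1r /xi -/s => i1 i2.
    by rewrite ler_norml; lra.
  have h2 := hr2 r (ltac:(by rewrite rp)) i iN.
  have h3 := hc' (T r) C hr x (xi i).
  have h4 : C * c' * `|x - xi i| <= e1 / 2.
    apply: (@le_trans _ _ (C * c' * s)); first by rewrite ler_wpM2l// mulr_ge0.
    rewrite /s mulrA ler_pdivrMr//.
    move: (ltW hN); rewrite ler_pdivrMr// => h5.
    by rewrite [leRHS](_ : _ = N.+1%:R * e1 / 2); [lra|ring].
  have := le_trans h3 h4; move: h2.
  move: (T r _) (T r _) => a b; rewrite !ler_norml; lra.
have c1 : continuous (fun x => T r (fun y => plateau L1 y * gauss_scaled d (y - x)) * psi x).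
  move=> x; apply: cvgM; last exact: smooth_continuous sp x.
  exact: (continuous_transl sc cK (smooth_bounded_gauss_scaled d)).
have pL1 x : L1 < `|x| -> psi x = 0 by move=> h; apply: pL; apply: lt_trans h; rewrite /L1; lra.
have h1 := hc (T r) C hr d psi B d0 sp pL1 hB.
have LL : - L1 <= L1 by lra.
have h2 : `|itg (- L1) L1 (fun x => T r (fun y => plateau L1 y * gauss_scaled d (y - x)) * psi x)|
    <= e1 * B * (L1 - - L1).
  apply: itg_bound => // x xL; rewrite normrM ler_pM//; first exact: small.
  exact: (hB x 0%N).
have h3 : e1 * B * (L1 - - L1) = e / 2 * B.
  by rewrite /e1; field; rewrite gt_eqF.
have h4 : C * (c * d * B) <= e / 2 * B.
  by rewrite -[c * d * B]mulrA mulrA mulrA ler_wpM2r.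
rewrite h3 in h2; move: (le_trans h1 h4) h2.
move: (T r psi) (itg _ _ _) => a b; rewrite !ler_norml.
have -> : e * B = e / 2 * B + e / 2 * B by field.
lra.
Qed.

End uniform_smallness.

(** * Rescaling a distribution around a point *)

Section scaling.
Context {R : realType}.
Implicit Types (f g psi phi chi : R -> R) (x y t r : R) (h : schwartz_distribution R).

Lemma dist_of_bounded (F : (R -> R) -> R) :
  (forall c phi psi, test_function phi -> test_function psi ->
     F (fun x => c * phi x + psi x) = c * F phi + F psi) ->
  (forall L : R, 0 <= L -> exists (m : nat) (C : R), forall phi (B : R), smooth phi ->
     (forall x, L < `|x| -> phi x = 0) -> (forall x, bndAt m B phi x) -> `|F phi| <= C * B) ->
  exists h, forall phi, h phi = F phi.
Proof.
move=> lin bnd.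
have cont (K : set R) : compact K -> exists (m : nat) (C : R), forall phi (B : R),
    test_function phi -> tsupp phi `<=` K ->
    (forall (k : nat) (x : R), (k <= m)%N -> `|derive1n k phi x| <= B) -> `|F phi| <= C * B.
  move=> /compact_bounded[M [_ hM]].
  have [|m [C hC]] := bnd (`|M| + 1); first by rewrite addr_ge0.
  exists m, C => phi B tp sK hB; apply: hC; first exact: tp.1.
    move=> x xM; apply: tsupp0 => /sK/(hM (`|M| + 1)).
    rewrite ltNge in xM; move=> h; move: xM; rewrite h//.
    by rewrite ltr_pwDr// ler_norm.
  by move=> x j jm; exact: hB.
by exists (SchwartzDistribution lin cont).
Qed.

Definition rescale x0 r phi y : R := phi ((y - x0) / r).

Lemma rescaleE x0 r phi : rescale x0 r phi = fun y => phi (r^-1 * y + - (x0 * r^-1)).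
Proof. by apply/funext => y; rewrite /rescale; congr phi; ring. Qed.

Lemma smooth_rescale x0 r phi : smooth phi -> smooth (rescale x0 r phi).
Proof. by move=> sp; rewrite rescaleE; exact: smooth_aff. Qed.

Lemma test_rescale x0 r phi : r != 0 -> test_function phi -> test_function (rescale x0 r phi).
Proof. by move=> r0 tp; rewrite rescaleE; apply: test_aff => //; rewrite invr_eq0. Qed.

Lemma bndAt_rescale x0 r phi k (A : R) y : smooth phi -> bndAt k A phi ((y - x0) / r) ->
  bndAt k ((1 + `|r^-1|) ^+ k * A) (rescale x0 r phi) y.
Proof.
move=> sp hA; rewrite rescaleE; apply: bndAt_aff; first exact: sp.
by have -> : r^-1 * y + - (x0 * r^-1) = (y - x0) / r by ring.
Qed.

Lemma derive1n_rescale x0 r phi j y : smooth phi ->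
  derive1n j (rescale x0 r phi) y = r^-1 ^+ j * derive1n j phi ((y - x0) / r).
Proof.
move=> sp; rewrite rescaleE derive1n_aff//.
by have -> : r^-1 * y + - (x0 * r^-1) = (y - x0) / r by ring.
Qed.

(** Packages the rescaled pairings as a family of distributions, to which [uniform_small] applies;
    the members with r <= 0 are arbitrary. *)
Lemma dist_scaleP h x0 (a : nat) : exists T : R -> schwartz_distribution R,
  forall r phi, 0 < r -> T r phi = r ^+ a * (r^-1 * h (rescale x0 r phi)).
Proof.
suff H r : exists T : schwartz_distribution R,
    0 < r -> forall phi, T phi = r ^+ a * (r^-1 * h (rescale x0 r phi)).
  by have [T hT] := choice H; exists T => r phi r0; exact: hT.
case: (ltP 0 r) => [r0|rn]; last by exists h.
have rn0 : r != 0 by rewrite gt_eqF.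
have [||T hT] := @dist_of_bounded (fun phi => r ^+ a * (r^-1 * h (rescale x0 r phi))).
- move=> c phi psi tp tq.
  have -> : rescale x0 r (fun x => c * phi x + psi x) =
     fun y => c * rescale x0 r phi y + rescale x0 r psi y by [].
  by rewrite dist_linear; [ring|exact: test_rescale|exact: test_rescale].
- move=> L L0.
  have M0 : 0 <= `|x0| + r * L by rewrite addr_ge0// mulr_ge0// ltW.
  have [m [C [C0 hC]]] := dist_bound h M0.
  exists m, (r ^+ a * (r^-1 * (C * (1 + `|r^-1|) ^+ m))) => phi B sp pL hB.
  have hB' x := @bndAt_rescale x0 r phi m B x sp (hB _).
  move: hB'; set c := 1 + _ => hB'.
  rewrite !normrM normfV -!mulrA (ger0_norm (exprn_ge0 a (ltW r0))) (ger0_norm (ltW r0)).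
  rewrite ler_wpM2l ?exprn_ge0 ?(ltW r0)// ler_wpM2l ?invr_ge0 ?(ltW r0)//.
  apply: hC; first exact: smooth_rescale.
    move=> x xL; apply: pL; rewrite normrM normfV (ger0_norm (ltW r0)) ltr_pdivlMr//.
    by have := lerB_dist x x0; lra.
  by move=> x _; exact: hB'.
by exists T.
Qed.

(** The factor N^j produced by a dilation by N is absorbed by the faster decay of the j-th
    derivative, so that every order gains the same N^beta. *)
Lemma powR_piece (N u beta : R) (j : nat) : 1 <= N -> 1 <= u -> beta < 0 ->
  N ^+ j * (N * u) `^ (beta - j%:R) <= N `^ beta.
Proof.
move=> N1 u1 b0; have N0 : 0 < N by lra.
have u0 : 0 < u by lra.
rewrite (powRM _ (ltW N0) (ltW u0)).
have -> : N `^ (beta - j%:R) = N `^ beta / N ^+ j.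
  by rewrite powRB ?(gt_eqF N0) ?implybT// (powR_mulrn _ (ltW N0)).
rewrite (_ : N ^+ j * _ = N `^ beta * u `^ (beta - j%:R)); last first.
  by field; rewrite expf_neq0// gt_eqF.
rewrite ler_piMr ?powR_ge0//.
apply: (@le_trans _ _ (u `^ 0)); last by rewrite powRr0.
have jj : 0 <= j%:R :> R by [].
by rewrite ler_powR//; lra.
Qed.

(** At distance s >= d from the centre, all derivatives of a function of decay beta dilated to scale
    r are of the same order r^(-beta). *)
Lemma powR_tail (r s d beta : R) (j m : nat) : 0 < r -> 0 < d -> d <= 1 -> d <= s ->
  (j <= m)%N -> beta < 0 ->
  r^-1 ^+ j * (s / r) `^ (beta - j%:R) <= r `^ (- beta) * d `^ (beta - m%:R).
Proof.
move=> r0 d0 d1 ds jm b0.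
have s0 : 0 < s by lra.
have jm' : j%:R <= m%:R :> R by rewrite ler_nat.
have jj : 0 <= j%:R :> R by [].
rewrite powRM ?invr_ge0 ?(ltW r0) ?(ltW s0)//.
have -> : r^-1 `^ (beta - j%:R) = r `^ (- beta) * r ^+ j.
  rewrite -(powR_inv1 (ltW r0)) -powRrM -powR_mulrn ?(ltW r0)// -powRD; last by rewrite (gt_eqF r0) implybT.
  by congr (_ `^ _); ring.
rewrite (_ : r^-1 ^+ j * _ = r `^ (- beta) * s `^ (beta - j%:R)); last first.
  by rewrite exprVn; field; rewrite expf_neq0// gt_eqF.
rewrite ler_wpM2l ?powR_ge0//; apply: (@le_trans _ _ (d `^ (beta - j%:R))); last first.
  by apply: ger_powR; [rewrite d0|lra].
have e0 : beta - j%:R = - (j%:R - beta) by ring.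
rewrite e0 !powRN lef_pV2 ?posrE ?powR_gt0//.
by apply: ge0_ler_powR; rewrite ?nnegrE ?(ltW d0) ?(ltW s0)//; lra.
Qed.

End scaling.

Local Ltac nneg := repeat first [assumption | apply: mulr_ge0 | apply: addr_ge0 | apply: exprn_ge0
  | exact: powR_ge0 | exact: ler01 | exact: ler0n | apply: ltW; assumption | rewrite invr_ge0].

(** * From test functions to kernels with power decay *)

Section weighted.
Context {R : realType}.
Implicit Types (f g psi phi chi Psi : R -> R) (x y t r : R) (h : schwartz_distribution R).

(** The case a = 0 is what a point value 0 provides, the case a = 1 what the derivative of a
    distribution with a point value satisfies. *)
Definition weakly_small h x0 (a : nat) := forall psi, test_function psi -> forall e : R, 0 < e ->
  exists2 r0 : R, 0 < r0 & forall r, 0 < r < r0 -> `|r ^+ a * (r^-1 * h (rescale x0 r psi))| <= e.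

Lemma powR_small (c e : R) : 0 < c -> 0 < e ->
  exists2 r0 : R, 0 < r0 & forall r, 0 < r < r0 -> r `^ c <= e.
Proof.
move=> c0 e0; exists (e `^ c^-1); first exact: powR_gt0.
move=> r /andP[r0 rr]; apply: (@le_trans _ _ ((e `^ c^-1) `^ c)).
  by apply: ge0_ler_powR; rewrite ?nnegrE ?(ltW c0) ?(ltW r0) ?(ltW rr)// powR_ge0.
by rewrite -powRrM mulVf ?gt_eqF// powRr1// ltW.
Qed.

Lemma plateau_scale (N c : R) u : plateau (N * c) u = plateau c (u / N).
Proof.
have e : (N * c)^-1 * u = c^-1 * (u / N) by rewrite invfM; ring.
by rewrite /plateau e.
Qed.

Lemma dyadic_scale (d r : R) : 0 < r -> r <= d -> exists N : nat, 2 ^+ N * r <= d /\ d < 2 ^+ N.+1 * r.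
Proof.
move=> r0 rd.
have ex : exists n : nat, d < 2 ^+ n.+1 * r.
  exists (Num.truncn (d / r)); rewrite -ltr_pdivrMr//.
  apply: lt_le_trans (real_truncnS_gt (num_real _)) _.
  rewrite -natrX ler_nat; apply: ltnW; exact: ltn_expl.
case: (ex_minnP ex) => N hN min; exists N; split => //.
case: N hN min => [|N] hN min; first by rewrite mul1r.
by rewrite leNgt; apply/negP => /min; rewrite ltnn.
Qed.

(* Dyadic decomposition of Psi at infinity; the scale 2^n r of the n-th piece stays small, and the
   decay of Psi makes the pieces summable. *)
Lemma weighted_small h x0 (a : nat) chi (beta : R) :
  weakly_small h x0 a -> test_function chi -> beta < -1 ->
  exists k : nat, forall e : R, 0 < e -> exists2 r0 : R, 0 < r0 &
    forall r Psi (B : R), 0 < r < r0 -> smooth Psi -> (forall y, bndAt k B Psi y) ->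
      (forall y j, 1 <= `|y| -> (j <= k)%N -> `|derive1n j Psi y| <= B * `|y| `^ (beta - j%:R)) ->
      `|r ^+ a * (r^-1 * h (fun y => chi y * rescale x0 r Psi y))| <= e * B.
Proof.
move=> hw tc b1.
have b0 : beta < 0 by lra.
have [T hT] := dist_scaleP h x0 a.
have L4 : 0 <= 4 :> R by [].
have [l12 l21 l22 l02] : [/\ 1 <= 2 :> R, 2 * 1 <= 4 :> R, 2 * 2 <= 4 :> R & 0 < 2 :> R] by split; lra.
have [|k0 hk0] := @uniform_small R T 4 L4.
  move=> psi tp e e0; have [r0 r00 hr] := hw psi tp e e0.
  by exists r0 => // r /andP[r1 r2]; rewrite hT//; apply: hr; rewrite r1.
have [K K0 cK] := test_support tc.
have [m [C [C0 hC]]] := dist_boundedP h (ltW K0).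
pose k := maxn k0 m.
have [A1 A10 hA1] := test_bnd k tc.
have t1 : test_function (plateau (1 : R)) by exact: test_plateau.
have t2 : test_function (plateau (2 : R)) by exact: test_plateau.
have s1 := t1.1; have s2 := t2.1.
(* Supported in 1 <= |y| <= 4. Dilated by 2^n, it is the difference of the plateaus of radii 2^(n+1)
   and 2^n, so the pieces telescope. *)
pose theta y : R := plateau 2 y - plateau 1 y.
have st : smooth theta by apply: smoothB.
have tt : test_function theta by apply: testB.
have [A2 A20 hA2] := test_bnd k tt.
have [A3 A30 hA3] := test_bnd k t1.
pose ro y : R := 1 - plateau 1 y.
have so : smooth ro by apply: smoothB; [exact: smooth_cst|exact: s1].
have hro y : bndAt k (1 + A3) ro y.
  apply: bndAtD; [exact: smooth_cst|by apply: smoothN; exact: s1| |].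
    by move=> [|j] _; rewrite ?derive1n_cst ?normr0 //= normr1.
  have := bndAtZ (-1) s1 (hA3 y); rewrite normrN1 mul1r.
  congr (bndAt _ _ _ _); apply/funext => z; exact: mulN1r.
(* Ratio of the geometric series. For N = 2^n the piece at scale N r has size N^beta by the decay,
   and a factor N comes from dividing by r instead of N r; q < 1 because beta < -1. *)
pose q : R := 2 `^ (1 + beta).
have q0 : 0 < q by rewrite powR_gt0.
have q1 : q < 1.
  rewrite /q /powR gt_eqF// expR_lt1 nmulr_rlt0 ?ln_gt0//; lra.
pose c1 : R := 2 ^+ k * (2 ^+ k * A1) * (2 ^+ k * (A2 + A3)).
have c10 : 0 <= c1 by rewrite /c1 !mulr_ge0 ?addr_ge0.
pose S n : R := 1 + (1 - q ^+ n) / (1 - q).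
have q11 : 1 - q != 0 by rewrite gt_eqF//; lra.
have SS n : S n.+1 = S n + q ^+ n by rewrite /S exprS; field.
have Sle n : S n <= 1 + (1 - q)^-1.
  rewrite /S lerD2l ler_pdivrMr ?mulVf//; last by lra.
  by rewrite gerBl exprn_ge0// ltW.
exists k => e e0.
pose D : R := c1 * (1 + (1 - q)^-1) + 1.
have iq : 0 < (1 - q)^-1 by rewrite invr_gt0; lra.
have D0 : 0 < D by rewrite /D ltr_wpDl// mulr_ge0//; lra.
pose e1 : R := e / 2 / D.
have e10 : 0 < e1 by rewrite !divr_gt0.
have e1D : e1 * c1 * (1 + (1 - q)^-1) <= e / 2.
  by rewrite /e1 -mulrA mulrAC ler_pdivrMr// ler_wpM2l ?lerDl//; lra.
have [r1 r10 hr1] := hk0 e1 e10.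
pose d : R := Num.min (r1 / 2) 1.
have d0 : 0 < d by rewrite lt_min divr_gt0//=.
have dr1 : d < r1 by rewrite /d gt_min; apply/orP; left; lra.
have d1 : d <= 1 by rewrite /d ge_min lexx orbT.
have piece rho f (B : R) : 0 < rho -> rho <= d -> 0 <= B -> smooth f ->
    (forall y, 4 < `|y| -> f y = 0) -> (forall y, bndAt k (2 ^+ k * (A2 + A3) * B) f y) ->
    `|rho ^+ a * (rho^-1 * h (fun y => chi y * rescale x0 rho f y))| <= e1 * (c1 * B).
  move=> rho0 rhod B0 sf f4 hf.
  pose F y := chi (rho * y + x0) * f y.
  have sF : smooth F by apply: smoothM; [apply: smooth_aff; exact: tc.1|exact: sf].
  have -> : (fun y => chi y * rescale x0 rho f y) = rescale x0 rho F.
    apply/funext => y; rewrite /rescale /F; congr (chi _ * _).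
    by field; rewrite gt_eqF.
  rewrite -hT//; apply: hr1; rewrite ?rho0 ?(le_lt_trans rhod dr1)//.
    by move=> y y4; rewrite /F f4// mulr0.
  move=> y; apply: (@bndAt_le R k k0 _ _ _ _ (leq_maxl _ _) (lexx _)).
  rewrite /c1 -[X in bndAt _ X]mulrA; apply: bndAtM; [apply: smooth_aff; exact: tc.1|exact: sf| |exact: hf].
  have := bndAt_aff rho x0 tc.1 (hA1 (rho * y + x0)); apply: bndAt_le => //.
  rewrite ler_wpM2r// lerXn2r ?nnegrE ?addr_ge0// (gtr0_norm rho0); lra.
pose Cd : R := C * (2 ^+ m * A1 * (2 ^+ m * ((1 + (d / 2)^-1) ^+ m * (1 + A3)) * ((d / 2) `^ (beta - m%:R)))).
have d20 : 0 < d / 2 by rewrite divr_gt0.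
have Cd0 : 0 <= Cd.
  rewrite /Cd !mulr_ge0 ?powR_ge0 ?addr_ge0 ?exprn_ge0 ?addr_ge0 ?invr_ge0 ?(ltW d20)//.
have gam : 0 < -1 - beta by lra.
have [r2 r20 hr2] := powR_small gam (divr_gt0 (divr_gt0 e0 (@ltr0n R 2)) (ltr_wpDl Cd0 ltr01)).
exists (Num.min d r2); first by rewrite lt_min d0.
move=> r Psi B /andP[r0]; rewrite lt_min => /andP[rd rr2] sP hB hdec.
have B0 : 0 <= B by exact: bndAt_ge0 (hB 0).
have ra1 : r ^+ a <= 1 by rewrite exprn_ile1 ?(ltW r0)// (le_trans (ltW rd) d1).
have ra0 : 0 <= r ^+ a by rewrite exprn_ge0// ltW.
pose P (n : nat) y := plateau (2 ^+ n) y * Psi y.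
have sP' n : smooth (P n) by apply: smoothM; [exact: smooth_plateau|exact: sP].
have tP n : test_function (fun y => chi y * rescale x0 r (P n) y).
  by apply: testM; [exact: tc|apply: smooth_rescale; exact: sP'].
have main n : 2 ^+ n * r <= d ->
    `|r ^+ a * (r^-1 * h (fun y => chi y * rescale x0 r (P n) y))| <= e1 * (c1 * B) * S n.
  elim: n => [|n IHn] hn.
    rewrite /S expr0 subrr mul0r addr0 mulr1.
    apply: (piece r (P 0%N) B r0 (ltW rd) B0 (sP' 0%N)) => y.
      by move=> y4; rewrite /P expr0 (plateau_eq0 ltr01 (le_trans l21 (ltW y4))) mul0r.
    rewrite /P expr0 -mulrA.
    apply: bndAt_le (leqnn k) _ (bndAtM s1 sP (hA3 y) (hB y)).
    by rewrite -mulrA ler_wpM2l// ler_wpM2r// lerDr.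
  pose N : R := 2 ^+ n; have N1 : 1 <= N by rewrite exprn_ege1// ler1n.
  have N0 : 0 < N := lt_le_trans ltr01 N1.
  have Nr0 : 0 < N * r by rewrite mulr_gt0.
  have Nrd : N * r <= d by apply: le_trans hn; rewrite exprS -mulrA ler_peMl ?(ltW Nr0).
  have {}IHn := IHn Nrd.
  pose f y := theta y * Psi (N * y).
  have sPN : smooth (fun y => Psi (N * y)).
    by have := smooth_aff N 0 sP; congr smooth; apply/funext => y; rewrite addr0.
  have sf : smooth f by apply: smoothM.
  have f4 y : 4 < `|y| -> f y = 0.
    move=> /ltW y4; rewrite /f /theta (plateau_eq0 l02 (le_trans l22 y4)).
    by rewrite (plateau_eq0 ltr01 (le_trans l21 y4)) subrr mul0r.
  have BN0 : 0 <= B * N `^ beta by rewrite mulr_ge0// powR_ge0.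
  have hf y : bndAt k (2 ^+ k * (A2 + A3) * (B * N `^ beta)) f y.
    case: (ltP `|y| 1) => y1.
      apply: bndAt_le (leqnn k) _ (bndAt_near _ (bndAt0 k y)).
        by rewrite mulr_ge0// mulr_ge0 ?exprn_ge0 ?addr_ge0.
      have : \forall z \near y, `|z| < 1.
        have hc : (fun z : R => `|z|) z @[z --> y] --> `|y| by exact: norm_continuous.
        by move/cvgr_lt : hc; apply.
      apply: filterS => z /ltW z1; rewrite /f /theta (plateau_eq1 l02 (le_trans z1 l12)).
      by rewrite (plateau_eq1 ltr01 z1) subrr mul0r.
    have hPN : bndAt k (B * N `^ beta) (fun y => Psi (N * y)) y.
      move=> j jk; have -> : (fun y => Psi (N * y)) = fun y => Psi (N * y + 0).
        by apply/funext => z; rewrite addr0.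
      rewrite derive1n_aff// addr0 normrM (ger0_norm (exprn_ge0 j (ltW N0))).
      apply: (@le_trans _ _ (N ^+ j * (B * (N * `|y|) `^ (beta - j%:R)))).
        rewrite ler_wpM2l ?exprn_ge0 ?(ltW N0)//.
        have Ny : `|N * y| = N * `|y| by rewrite normrM gtr0_norm.
        rewrite -Ny; apply: hdec => //; rewrite Ny -[leLHS]mulr1; apply: ler_pM => //.
      by rewrite mulrCA ler_wpM2l//; exact: powR_piece.
    apply: bndAt_le (leqnn k) _ (bndAtM st sPN (hA2 y) hPN).
    by rewrite ler_wpM2r// ler_wpM2l// lerDl.
  have hp := piece _ f _ Nr0 Nrd BN0 sf f4 hf.
  have -> : (fun y => chi y * rescale x0 r (P n.+1) y) =
     fun y => chi y * rescale x0 r (P n) y + chi y * rescale x0 (N * r) f y.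
    apply/funext => y; rewrite -mulrDr; congr (_ * _).
    have e2 : (y - x0) / (N * r) = ((y - x0) / r) / N by rewrite invfM; ring.
    have e3 : N * (((y - x0) / r) / N) = (y - x0) / r by field; rewrite !gt_eqF.
    rewrite /rescale /P /f /theta e2 e3 -!plateau_scale mulr1 exprSr -/N; ring.
  have tf : test_function (fun y => chi y * rescale x0 (N * r) f y).
    by apply: testM; [exact: tc|apply: smooth_rescale; exact: sf].
  rewrite distD; [|exact: tP|exact: tf].
  have -> : e1 * (c1 * B) * S n.+1 = e1 * (c1 * B) * S n + e1 * (c1 * B) * q ^+ n.
    by rewrite SS mulrDr.
  rewrite (mulrDr r^-1) (mulrDr (r ^+ a)).
  apply: le_trans (ler_normD _ _) _; apply: lerD; first exact: IHn.
  set H := h _ in hp *.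
  have -> : r ^+ a * (r^-1 * H) = (N / N ^+ a) * ((N * r) ^+ a * ((N * r)^-1 * H)).
    by rewrite exprMn invfM; field; rewrite !(expf_neq0, gt_eqF).
  have NN : `|N / N ^+ a| <= N.
    rewrite ger0_norm ?divr_ge0 ?exprn_ge0 ?(ltW N0)//.
    by rewrite ler_piMr ?(ltW N0)// invf_le1 ?exprn_gt0// exprn_ege1.
  rewrite normrM; apply: le_trans (ler_pM (normr_ge0 _) (normr_ge0 _) NN hp) _.
  have qn : q ^+ n = N * N `^ beta.
    have -> : N = 2 `^ n%:R by rewrite powR_mulrn.
    rewrite /q -powR_mulrn ?powR_ge0// -!powRrM -powRD; last by apply/implyP.
    by congr (_ `^ _); ring.
  by rewrite qn le_eqVlt; apply/orP; left; apply/eqP; ring.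
(* Dyadic pieces are summed up to the scale 2^N r in ]d / 2, d]. The rest lives at distance at least
   d / 2 from x0, independently of r; there the continuity of [h] on the support of [chi] and the
   decay give O(r^(-1 - beta)). *)
have [N [hN1 hN2]] := dyadic_scale r0 (ltW rd).
pose rho := 2 ^+ N * r.
have rho0 : 0 < rho by rewrite mulr_gt0// exprn_gt0.
have rhod : d / 2 < rho by rewrite ltr_pdivrMr// /rho mulrC mulrA -exprS.
have N0 : 0 < 2 ^+ N :> R by rewrite exprn_gt0.
have N1 : 1 <= 2 ^+ N :> R by rewrite exprn_ege1// ler1n.
pose tail y := chi y * (rescale x0 rho ro y * rescale x0 r Psi y).
have sr1 : smooth (rescale x0 rho ro) by exact: smooth_rescale.
have sr2 : smooth (rescale x0 r Psi) by exact: smooth_rescale.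
have sr12 : smooth (fun y => rescale x0 rho ro y * rescale x0 r Psi y) by exact: smoothM.
have ttail : test_function tail by apply: testM; [exact: tc|exact: sr12].
have split_ : (fun y => chi y * rescale x0 r Psi y) =
    fun y => chi y * rescale x0 r (P N) y + tail y.
  apply/funext => y; rewrite /tail /rescale /P /ro.
  have -> : (y - x0) / rho = ((y - x0) / r) / 2 ^+ N by rewrite /rho invfM; ring.
  by rewrite -(plateau_scale (2 ^+ N) 1) mulr1; ring.
rewrite split_ distD; [|exact: tP|exact: ttail].
rewrite (mulrDr r^-1) (mulrDr (r ^+ a)); apply: le_trans (ler_normD _ _) _.
have -> : e * B = e / 2 * B + e / 2 * B by field.
apply: lerD.
  apply: le_trans (main N hN1) _.
  apply: (@le_trans _ _ (e1 * (c1 * B) * (1 + (1 - q)^-1))).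
    by apply: ler_wpM2l; [nneg|exact: Sle].
  by rewrite mulrA mulrAC ler_wpM2r.
have htail : `|h tail| <= C * (2 ^+ m * A1 * (2 ^+ m * ((1 + (d / 2)^-1) ^+ m * (1 + A3)) *
    (B * (r `^ (- beta) * (d / 2) `^ (beta - m%:R))))).
  apply: hC.
  - exact: ttail.1.
  - by move=> y yK; rewrite /tail cK// mul0r.
  move=> y.
  have dd : 0 <= (d / 2)^-1 by rewrite invr_ge0 ltW.
  case: (ltP `|(y - x0) / rho| 1) => y1.
    apply: bndAt_le (leqnn m) _ (bndAt_near _ (bndAt0 m y)).
      by nneg.
    have : \forall z \near y, `|(z - x0) / rho| < 1.
      have hc : (fun z : R => `|(z - x0) / rho|) z @[z --> y] --> `|(y - x0) / rho|.
        apply: cvg_norm; apply: cvgMl; apply: cvgB; [exact: cvg_id|exact: cvg_cst].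
      by move/cvgr_lt : hc; apply.
    apply: filterS => z /ltW z1; rewrite /tail /rescale /ro plateau_eq1//.
    by rewrite subrr mul0r mulr0.
  apply: bndAtM; [exact: tc.1|exact: sr12|exact: bndAt_le (leq_maxr _ _) (lexx _) (hA1 y)|].
  apply: bndAtM; [exact: sr1|exact: sr2| |].
    have := bndAt_rescale so (bndAt_le (leq_maxr k0 m) (lexx _) (hro ((y - x0) / rho))).
    apply: bndAt_le => //; rewrite ler_wpM2r ?addr_ge0// lerXn2r ?nnegrE ?addr_ge0//.
    rewrite lerD2l ger0_norm ?invr_ge0 ?(ltW rho0)// lef_pV2 ?posrE//; exact: ltW.
  move=> j jm; rewrite derive1n_rescale// normrM ger0_norm ?exprn_ge0 ?invr_ge0 ?(ltW r0)//.
  have ys : rho <= `|y - x0|.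
    by move: y1; rewrite normrM normfV (gtr0_norm rho0) ler_pdivlMr// mul1r.
  have yr : `|(y - x0) / r| = `|y - x0| / r by rewrite normrM normfV (gtr0_norm r0).
  apply: (@le_trans _ _ (r^-1 ^+ j * (B * (`|y - x0| / r) `^ (beta - j%:R)))).
    rewrite ler_wpM2l ?exprn_ge0 ?invr_ge0 ?(ltW r0)// -yr; apply: hdec.
      rewrite yr ler_pdivlMr// mul1r; apply: le_trans ys.
      by rewrite /rho ler_peMl// ltW.
    exact: leq_trans jm (leq_maxr _ _).
  rewrite mulrCA ler_wpM2l//; apply: (powR_tail r0 d20 _ _ jm b0); last by apply: ltW; exact: lt_le_trans ys.
  by rewrite ler_pdivrMr// mul1r (le_trans d1 l12).
apply: (@le_trans _ _ (1 * (r^-1 * (Cd * B * r `^ (- beta))))).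
  rewrite normrM (ger0_norm ra0); apply: ler_pM => //.
  rewrite normrM ger0_norm ?invr_ge0 ?(ltW r0)// ler_wpM2l ?invr_ge0 ?(ltW r0)//.
  apply: le_trans htail _; rewrite /Cd le_eqVlt; apply/orP; left; apply/eqP; ring.
have -> : 1 * (r^-1 * (Cd * B * r `^ (- beta))) = Cd * r `^ (-1 - beta) * B.
  rewrite powRD; last by rewrite (gt_eqF r0) implybT.
  by rewrite (powR_inv1 (ltW r0)); ring.
rewrite ler_wpM2r//; apply: le_trans (ler_wpM2l Cd0 (hr2 r _)) _; first by rewrite r0.
by rewrite mulrCA ler_piMr ?divr_ge0 ?(ltW e0)// ler_pdivrMr ?ltr_wpDl// mul1r lerDl.
Qed.

End weighted.

(** * Point values *)

Section point_value_theory.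
Context {R : realType}.
Implicit Types (f g psi phi chi : R -> R) (x y t r : R) (h : schwartz_distribution R).
Local Notation mu := (@lebesgue_measure R).

Lemma Rintegral_supp f p q : (forall x, ~ (p <= x <= q) -> f x = 0) -> \int[mu]_x f x = itg p q f.
Proof.
move=> hf; rewrite /itg [RHS]Rintegral_mkcond; apply: eq_Rintegral => x _.
rewrite patchE; case: ifPn => // xL; apply: hf => h; move/negP: xL; apply.
by rewrite inE/= in_itv.
Qed.

Lemma test_antiderivative phi : test_function phi ->
  exists Phi : R -> R, forall x, is_derive x 1 Phi (phi x).
Proof.
move=> tp; have [L L0 hL] := test_support tp.
have cp := smooth_continuous tp.1.
have ip : mu.-integrable setT (EFin \o phi).
  have h0 : mu.-integrable `[- L, L] (EFin \o phi) by exact: continuous_itg.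
  have h1 : mu.-integrable setT ((EFin \o phi) \_ `[- L, L]).
    case: (@integrable_mkcond _ _ R mu `[- L, L]%classic (EFin \o phi) (measurable_itv _)) => h1 _.
    exact: h1 h0.
  move: h1; apply: eq_integrable => // x _.
  rewrite patchE; case: ifPn => //= xL; rewrite hL// ltNge; apply/negP => h.
  by move/negP: xL; apply; rewrite inE/= in_itv/= -ler_norml.
exists (fun x => \int[mu]_(t in `]-oo, x]) phi t) => x.
have x1 : x < x + 1 by rewrite ltrDl.
have i1 : mu.-integrable `]-oo, x + 1] (EFin \o phi) by apply: integrableS ip.
have [|d e] := @continuous_FTC1 R phi -oo%O x (x + 1) x1 i1 _ (cp x).
  by rewrite ltNyr.
by apply: DeriveDef; [exact: d|rewrite -derive1E; exact: e].
Qed.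

Lemma itg_antiderivative phi Phi p q : continuous phi ->
  (forall x, is_derive x 1 Phi (phi x)) -> p <= q -> itg p q phi = Phi q - Phi p.
Proof.
move=> cp dP; rewrite le_eqVlt => /orP[/eqP <-|pq]; first by rewrite itg_point subrr.
have cP : continuous Phi.
  by move=> x; apply/differentiable_continuous/derivable1_diffP; exact: is_derive_derivable (dP x).
rewrite /itg /Rintegral (@continuous_FTC2 R phi Phi p q pq)//.
- exact: continuous_subspaceT.
- split.
  + by move=> x _; exact: is_derive_derivable (dP x).
  + by apply: cvg_at_right_filter; exact: cP.
  + by apply: cvg_at_left_filter; exact: cP.
- by move=> x _; exact: is_derive1E.
Qed.

Lemma is_derive_rescale x0 r phi x (d : R) : is_derive ((x - x0) / r) 1 phi d ->
  is_derive x 1 (rescale x0 r phi) (d * r^-1).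
Proof.
move=> hd; rewrite rescaleE.
apply: (@is_derive_compf R phi (fun y => r^-1 * y + - (x0 * r^-1)) x).
  by have -> : r^-1 * x + - (x0 * r^-1) = (x - x0) / r by ring.
exact: is_derive_aff.
Qed.

(** Both signs of r occur, point values being two-sided limits. An antiderivative reduces the change
    of variables to values at end points. *)
Lemma Rintegral_rescale x0 r phi : r != 0 -> test_function phi ->
  `|r|^-1 * \int[mu]_x rescale x0 r phi x = \int[mu]_x phi x.
Proof.
move=> r0 tp; have [L L0 hL] := test_support tp.
have [Phi dP] := test_antiderivative tp.
have cp := smooth_continuous tp.1.
have r1 : 0 < `|r| by rewrite normr_gt0.
have LL : - L <= L by lra.
rewrite (@Rintegral_supp phi (- L) L); last first.
  by move=> x; rewrite -ler_norml => /negP; rewrite -ltNge; exact: hL.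
rewrite (@Rintegral_supp _ (x0 - `|r| * L) (x0 + `|r| * L)); last first.
  move=> x; rewrite -ler_distl => /negP; rewrite -ltNge => xL.
  by apply: hL; rewrite normrM normfV ltr_pdivlMr// mulrC.
have rL : 0 <= `|r| * L by rewrite mulr_ge0// ltW.
rewrite (itg_antiderivative cp dP LL).
have dR x : is_derive x 1 (fun y => r * rescale x0 r Phi y) (rescale x0 r phi x).
  have := @is_deriveZf R r _ x _ (is_derive_rescale (dP ((x - x0) / r))).
  by rewrite mulrCA mulfV// mulr1.
have cR : continuous (rescale x0 r phi).
  by apply: smooth_continuous; apply: smooth_rescale; exact: tp.1.
rewrite (itg_antiderivative cR dR); last by lra.
rewrite /rescale.
have -> : (x0 + `|r| * L - x0) / r = (`|r| / r) * L by ring.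
have -> : (x0 - `|r| * L - x0) / r = - ((`|r| / r) * L) by ring.
have [rp|rn] := ltP 0 r.
  by rewrite (gtr0_norm rp) divff// mul1r -mulrBr mulKf.
have {}rn : r < 0 by rewrite lt_neqAle r0.
rewrite (ltr0_norm rn) mulNr divff// mulN1r opprK; field; exact: r0.
Qed.

Lemma Rintegral_derive1 phi : test_function phi -> \int[mu]_x derive1 phi x = 0.
Proof.
move=> tp; have [L L0 hL] := test_support tp.
have LL : - (L + 1) <= L + 1 by lra.
rewrite (@Rintegral_supp _ (- (L + 1)) (L + 1)); last first.
  move=> x; rewrite -ler_norml => /negP; rewrite -ltNge => xL.
  by apply: (derive1_supp hL); lra.
rewrite (itg_FTC2 tp.1 LL) !hL ?subrr// ?normrN ger0_norm; lra.
Qed.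

Lemma dist_cst (c : R) : exists h, forall phi, h phi = c * \int[mu]_x phi x.
Proof.
have L1 (L : R) phi : 0 <= L -> (forall x, L < `|x| -> phi x = 0) ->
    \int[mu]_x phi x = itg (- L) L phi.
  move=> L0 hL; apply: Rintegral_supp => x; rewrite -ler_norml => /negP; rewrite -ltNge; exact: hL.
have [||h hh] := @dist_of_bounded R (fun phi => c * \int[mu]_x phi x); last by exists h.
- move=> a phi psi tp tq.
  have [L L0 hL] := test_support tp; have [K K0 hK] := test_support tq.
  have M0 : 0 <= L + K by lra.
  rewrite !(L1 (L + K)) //; last 3 first.
  + by move=> x xM; apply: hK; lra.
  + by move=> x xM; apply: hL; lra.
  + by move=> x xM; rewrite hL ?hK ?mulr0 ?addr0//; lra.
  have cp := smooth_continuous tp.1; have cq := smooth_continuous tq.1.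
  have cz : continuous (fun x => a * phi x).
    by apply: smooth_continuous; apply: smoothZ; exact: tp.1.
  by rewrite (itgD _ _ cz cq) (itgZ _ _ a cp); ring.
- move=> L L0; exists 0%N, (`|c| * (L - - L)) => phi B sp pL hB.
  rewrite (L1 L)// normrM -mulrA ler_wpM2l// mulrC.
  apply: itg_bound; [exact: smooth_continuous| lra|].
  by move=> x _; exact: (hB x 0%N).
Qed.

Lemma dist_sub h1 h2 : exists h, forall phi, h phi = h1 phi - h2 phi.
Proof.
have [||h hh] := @dist_of_bounded R (fun phi => h1 phi - h2 phi); last by exists h.
- by move=> a phi psi tp tq; rewrite !dist_linear//; ring.
- move=> L L0; have [m1 [C1 [C10 hC1]]] := dist_bound h1 L0.
  have [m2 [C2 [C20 hC2]]] := dist_bound h2 L0.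
  exists (maxn m1 m2), (C1 + C2) => phi B sp pL hB.
  apply: le_trans (ler_normB _ _) _; rewrite mulrDl; apply: lerD.
    by apply: hC1 => // x _; apply: bndAt_le (hB x); rewrite ?leq_maxl.
  by apply: hC2 => // x _; apply: bndAt_le (hB x); rewrite ?leq_maxr.
Qed.

Lemma point_valueP h x (c : R) : point_value h x c <->
  forall phi, test_function phi -> forall e : R, 0 < e -> exists2 r0 : R, 0 < r0 &
    forall r, 0 < `|r| -> `|r| < r0 ->
      `| `|r|^-1 * h (rescale x r phi) - c * \int[mu]_y phi y| <= e.
Proof.
split=> [hp phi tp e e0|hp phi tp].
  have := (cvgrPdist_le _ _).1 (hp phi tp) e e0.
  move=> [d /= d0 hd]; exists d => // r r0 rd.
  rewrite distrC; apply: hd; last by rewrite -normr_gt0.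
  by rewrite /= sub0r normrN.
apply/cvgrPdist_le => e e0; have [r0 r00 hr] := hp phi tp e e0.
exists r0 => //= r; rewrite /= sub0r normrN => rr rn0.
by rewrite distrC; apply: hr => //; rewrite normr_gt0.
Qed.

Lemma point_value_sub h1 h2 h x (c1 c2 : R) : (forall phi, h phi = h1 phi - h2 phi) ->
  point_value h1 x c1 -> point_value h2 x c2 -> point_value h x (c1 - c2).
Proof.
move=> hE /point_valueP p1 /point_valueP p2; apply/point_valueP => phi tp e e0.
have e2 : 0 < e / 2 by rewrite divr_gt0.
have [r1 r10 h1r] := p1 phi tp _ e2; have [r2 r20 h2r] := p2 phi tp _ e2.
exists (Num.min r1 r2); first by rewrite lt_min r10.
move=> r r0; rewrite lt_min => /andP[rr1 rr2].
have := h1r r r0 rr1; have := h2r r r0 rr2; rewrite hE.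
rewrite mulrBr mulrBl; move: (_ * h1 _) (_ * h2 _) (c1 * _) (c2 * _) => a b u v.
by rewrite !ler_norml; lra.
Qed.

Lemma point_value_cst h x (c : R) : (forall phi, h phi = c * \int[mu]_y phi y) -> point_value h x c.
Proof.
move=> hE; apply/point_valueP => phi tp e e0; exists 1 => // r r0 _.
rewrite hE mulrCA Rintegral_rescale//; last by rewrite -normr_gt0.
by rewrite subrr normr0 ltW.
Qed.

Lemma point_value_local h1 h2 x (c d : R) : 0 < d ->
  (forall phi, test_function phi -> (forall y, d <= `|y - x| -> phi y = 0) -> h1 phi = h2 phi) ->
  point_value h1 x c -> point_value h2 x c.
Proof.
move=> d0 h12 /point_valueP p1; apply/point_valueP => phi tp e e0.
have [r1 r10 h1r] := p1 phi tp e e0.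
have [L L0 hL] := test_support tp.
exists (Num.min r1 (d / (L + 1))); first by rewrite lt_min r10 divr_gt0//; lra.
move=> r r0; rewrite lt_min => /andP[rr1]; rewrite ltr_pdivlMr; last by lra.
move=> rd; rewrite -h12; first exact: h1r.
  by apply: test_rescale => //; rewrite -normr_gt0.
move=> y dy; apply: hL; rewrite normrM normfV ltr_pdivlMr//.
apply: lt_le_trans dy; apply: le_lt_trans rd; rewrite mulrC ler_wpM2l//; lra.
Qed.

Lemma point_value_weakly_small h h' x (c : R) : (forall phi, h' phi = h phi - c * \int[mu]_y phi y) ->
  point_value h x c -> weakly_small h' x 0.
Proof.
move=> hE /point_valueP p1 psi tp e e0; have [r0 r00 hr] := p1 psi tp e e0.
exists r0 => // r /andP[rp rr]; rewrite expr0 mul1r hE.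
have := hr r; rewrite (gtr0_norm rp) => /(_ rp rr).
have := @Rintegral_rescale x r psi; rewrite gt_eqF// (gtr0_norm rp) => <- //.
by rewrite mulrBr; congr (`|_ - _| <= _); ring.
Qed.

Lemma derive1_rescale x0 r phi : smooth phi ->
  derive1 (rescale x0 r phi) = fun y => r^-1 * rescale x0 r (derive1 phi) y.
Proof.
move=> sp; apply: derive1_fun => y; rewrite mulrC; apply: is_derive_rescale.
exact: smooth_is_derive.
Qed.

(** The derivative of a test function has integral 0, so the point value drops out of the limit,
    while the derivation costs one power of r. *)
Lemma derivative_weakly_small (W w : schwartz_distribution R) x (c : R) :
  (forall phi, test_function phi -> w phi = - W (derive1 phi)) ->
  point_value W x c -> weakly_small w x 1.
Proof.
move=> wE /point_valueP p1 psi tp e e0.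
have tp' := test_function_derive1 tp.
have [r0 r00 hr] := p1 _ tp' e e0; exists r0 => // r /andP[rp rr].
have rn0 : r != 0 by rewrite gt_eqF.
have := hr r; rewrite (gtr0_norm rp) => /(_ rp rr).
rewrite (Rintegral_derive1 tp) mulr0 subr0.
rewrite wE; last exact: test_rescale.
rewrite (derive1_rescale _ _ tp.1) distZ; last exact: test_rescale.
by rewrite expr1 mulrN mulrN normrN; congr (`|_| <= _); rewrite mulVKf.
Qed.

End point_value_theory.

(** * Cutting a distribution at a point *)

Section cutoff.
Context {R : realType}.
Implicit Types (f g psi phi chi : R -> R) (x y t r : R) (h H W w : schwartz_distribution R).
Local Notation mu := (@lebesgue_measure R).
Local Notation S := (@smooth_step R).

Let theta u : R := S (2 * u - 1) - S (u - 1).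

Let smooth_theta : smooth theta.
Proof.
apply: smoothB.
  by have := smooth_aff 2 (-1) (@smooth_smooth_step R).
by have := smooth_aff 1 (-1) (@smooth_smooth_step R); congr smooth; apply/funext => u; rewrite mul1r.
Qed.

Let theta0 u : u <= 2^-1 -> theta u = 0.
Proof. by move=> u1; rewrite /theta !step_eq0 ?subrr//; lra. Qed.

Let theta2 u : 2 <= u -> theta u = 0.
Proof. by move=> u1; rewrite /theta !step_eq1 ?subrr//; lra. Qed.

(** This vanishes for y <= c + 2^-n and equals phi for y >= c + 2^(1-n). *)
Let cut c (n : nat) phi y : R := S (2 ^+ n * (y - c) - 1) * phi y.

Let test_cut c n phi : test_function phi -> test_function (cut c n phi).
Proof.
move=> tp; apply: testMr; last exact: tp.
have := smooth_aff (2 ^+ n) (- (2 ^+ n * c) - 1) (@smooth_smooth_step R).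
by congr smooth; apply/funext => y; congr S; ring.
Qed.

Let half_pow (n : nat) : 0 < 2^-1 ^+ n :> R.
Proof. by rewrite exprn_gt0// invr_gt0. Qed.

Let halving (C : R) (n : nat) : C * 2^-1 ^+ n.+1 <= C * 2^-1 ^+ n / 2.
Proof. by rewrite exprSr mulrA. Qed.

Let half_lt (e : R) : 0 < e -> exists N : nat, forall n, (N <= n)%N -> 2^-1 ^+ n < e.
Proof.
move=> e0; exists (Num.truncn e^-1) => n Nn.
rewrite exprVn invf_plt ?posrE ?exprn_gt0//.
apply: lt_le_trans (real_truncnS_gt (num_real _)) _.
by rewrite -natrX ler_nat; apply: leq_ltn_trans Nn _; exact: ltn_expl.
Qed.

Let cut_step c n phi r : r = 2^-1 ^+ n -> forall y,
  cut c n.+1 phi y - cut c n phi y = theta ((y - c) / r) * phi y.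
Proof.
move=> -> y; rewrite /cut /theta exprVn invrK -mulrBl exprS.
by congr ((S _ - S _) * _); ring.
Qed.

(** Passing from one cutoff to the next adds a piece of scale 2^-n, whose pairing is 2^-n times a
    small factor, by weak smallness at c; the pairings with the cutoffs thus converge geometrically.
    For a test function of scale r around c only pieces of scale at most of order r count, and their
    sum is o(r); this is the point value 0 at c. *)
Lemma cutoff_exists H c : weakly_small H c 0 -> exists Hp : schwartz_distribution R,
  [/\ forall phi, test_function phi -> (forall y, c <= y -> phi y = 0) -> Hp phi = 0,
      forall phi d, test_function phi -> 0 < d -> (forall y, y <= c + d -> phi y = 0) -> Hp phi = H phi
    & point_value Hp c 0].
Proof.
move=> hw.
have [T hT] := dist_scaleP H c 0.
have L2 : 0 <= 2 :> R by [].
have [|k hk] := @uniform_small R T 2 L2.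
  move=> psi tp e e0; have [r0 r00 hr] := hw psi tp e e0.
  by exists r0 => // r /andP[r1 r2]; rewrite hT//; apply: hr; rewrite r1.
have tt : test_function theta.
  apply: (@test_of_support _ _ 2); first exact: smooth_theta.
  move=> x; rewrite ltr_normr => /orP[] xx; [apply: theta2|apply: theta0]; lra.
have [A A0 hA] := test_bnd k tt.
(* one dyadic piece of the cutoff, at scale r = 2^-n, paired with phi *)
have piece (e : R) : 0 < e -> exists2 r0 : R, 0 < r0 & forall n phi (B : R),
    2^-1 ^+ n < r0 -> test_function phi ->
    (forall u, 2^-1 <= u -> bndAt k B (fun u => phi (2^-1 ^+ n * u + c)) u) ->
    `|H (cut c n.+1 phi) - H (cut c n phi)| <= 2^-1 ^+ n * (e * (2 ^+ k * A * B)).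
  move=> e0; have [r0 r00 hr] := hk e e0; exists r0 => // n phi B nr tp hB.
  have B0 : 0 <= B by apply: bndAt_ge0 (hB 2^-1 _).
  pose r : R := 2^-1 ^+ n; have rp : 0 < r by exact: half_pow.
  have rn0 : r != 0 by rewrite gt_eqF.
  rewrite -distB; [|exact: test_cut|exact: test_cut].
  pose F u := theta u * phi (r * u + c).
  have sphi : smooth (fun u => phi (r * u + c)) by apply: smooth_aff; exact: tp.1.
  have sF : smooth F by apply: smoothM; [exact: smooth_theta|exact: sphi].
  have -> : (fun y => cut c n.+1 phi y - cut c n phi y) = rescale c r F.
    apply/funext => y; rewrite (@cut_step c n phi r erefl) /rescale /F; congr (_ * phi _).
    by field.
  have -> : H (rescale c r F) = r * T r F by rewrite hT// expr0 mul1r mulVKf.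
  rewrite normrM (gtr0_norm rp) ler_wpM2l ?(ltW rp)//; apply: hr.
  - by rewrite rp.
  - exact: sF.
  - move=> u u2; rewrite /F; suff -> : theta u = 0 by rewrite mul0r.
    by move: u2; rewrite ltr_normr => /orP[] u2; [apply: theta2|apply: theta0]; lra.
  move=> u; case: (ltP u 2^-1) => u1; last first.
    by apply: bndAtM; [exact: smooth_theta|exact: sphi|exact: hA|exact: hB].
  apply: bndAt_le (leqnn k) _ (bndAt_near _ (bndAt0 k u)).
    by rewrite !mulr_ge0// exprn_ge0.
  have : \forall z \near u, z < 2^-1 by exact: lt_nbhsl.
  by apply: filterS => z /ltW z1; rewrite /F theta0// mul0r.
have [r0 r00 hr0] := piece 1 ltr01.
have [N hN] := half_lt r00.
have bphi n phi (B : R) : test_function phi -> (forall x, bndAt k B phi x) ->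
    forall u, bndAt k (2 ^+ k * B) (fun u => phi (2^-1 ^+ n * u + c)) u.
  move=> tp hB u; apply: bndAt_le (leqnn k) _ (bndAt_aff (2^-1 ^+ n) c tp.1 (hB _)).
  have B0 : 0 <= B by exact: bndAt_ge0 (hB 0).
  rewrite ler_wpM2r// lerXn2r ?nnegrE ?addr_ge0// (gtr0_norm (half_pow n)).
  have : 2^-1 ^+ n <= 1 :> R by rewrite exprn_ile1//; lra.
  lra.
pose M : R := 2 ^+ k * A * 2 ^+ k.
have M0 : 0 <= M by rewrite /M !mulr_ge0 ?exprn_ge0.
have stepN phi (B : R) : test_function phi -> (forall x, bndAt k B phi x) ->
    forall n, (N <= n)%N -> `|H (cut c n.+1 phi) - H (cut c n phi)| <= (M * B) * 2^-1 ^+ n.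
  move=> tp hB n Nn.
  apply: le_trans (hr0 n phi _ (hN n Nn) tp (fun u _ => bphi n phi B tp hB u)) _.
  by rewrite /M le_eqVlt; apply/orP; left; apply/eqP; ring.
have limex phi : exists l : R, test_function phi -> forall (B : R), (forall x, bndAt k B phi x) ->
    forall n, (N <= n)%N -> `|l - H (cut c n phi)| <= 2 * ((M * B) * 2^-1 ^+ n).
  case: (pselect (test_function phi)) => [tp|ntp]; last by exists 0.
  have [B B0 hB] := test_bnd k tp.
  have [l hl] := @halving_limit R (fun n => H (cut c n phi)) (fun n => (M * B) * 2^-1 ^+ n) N
     (halving (M * B)) (stepN phi B tp hB).
  exists l => _ B' hB' n Nn.
  have [l' hl'] := @halving_limit R (fun n => H (cut c n phi)) (fun n => (M * B') * 2^-1 ^+ n) N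
     (halving (M * B')) (stepN phi B' tp hB').
  suff -> : l = l' by exact: hl'.
  have B'0 : 0 <= B' by exact: bndAt_ge0 (hB' 0).
  apply/eqP; rewrite -subr_eq0 -normr_le0.
  apply: (@le_halving R _ _ (2 * (M * B) + 2 * (M * B')) (fun n => 1 * 2^-1 ^+ n) N).
  - exact: halving.
  - by rewrite addr_ge0// !mulr_ge0.
  move=> j Nj; rewrite add0r mul1r mulrDl -!(mulrA 2); apply: dist_tri; [exact: hl|exact: hl'].
have [F hF] := choice limex.
(* Any number approached at a geometric rate is the value of [F]; linearity and vanishing to the
   left of c are then read off the approximations. *)
have Funiq phi (l : R) : test_function phi -> (exists C : R, 0 <= C /\ forall n, (N <= n)%N ->
    `|l - H (cut c n phi)| <= C * 2^-1 ^+ n) -> F phi = l.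
  move=> tp [C [C0 hC]]; have [B B0 hB] := test_bnd k tp.
  apply/eqP; rewrite -subr_eq0 -normr_le0.
  apply: (@le_halving R _ _ (2 * (M * B) + C) (fun n => 1 * 2^-1 ^+ n) N).
  - exact: halving.
  - by rewrite addr_ge0// !mulr_ge0.
  move=> j Nj; rewrite add0r mul1r mulrDl -!(mulrA 2).
  by apply: dist_tri; [exact: hF|exact: hC].
have [||Hp hHp] := @dist_of_bounded R F.
- move=> a phi psi tp tq.
  have ta : test_function (fun x => a * phi x + psi x) by apply: testD; [apply: testZ; exact: tp|exact: tq].
  apply: Funiq => //.
  have [B B0 hB] := test_bnd k tp; have [B' B'0 hB'] := test_bnd k tq.
  exists (`|a| * (2 * (M * B)) + 2 * (M * B')); split.
    by rewrite !(addr_ge0, mulr_ge0).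
  move=> n Nn.
  have -> : cut c n (fun x => a * phi x + psi x) = fun x => a * cut c n phi x + cut c n psi x.
    by apply/funext => y; rewrite /cut; ring.
  rewrite dist_linear; [|exact: test_cut|exact: test_cut].
  have -> : a * F phi + F psi - (a * H (cut c n phi) + H (cut c n psi)) =
    a * (F phi - H (cut c n phi)) + (F psi - H (cut c n psi)) by ring.
  have -> : (`|a| * (2 * (M * B)) + 2 * (M * B')) * 2^-1 ^+ n =
     `|a| * (2 * (M * B * 2^-1 ^+ n)) + 2 * (M * B' * 2^-1 ^+ n) by ring.
  apply: le_trans (ler_normD _ _) _; rewrite normrM; apply: lerD.
    by apply: ler_wpM2l; [|exact: hF].
  exact: hF.
- move=> L L0; have [m [C [C0 hC]]] := dist_bound H L0.
  have tp0 : test_function (plateau (L + 1)) by apply: test_plateau; lra.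
  have [D D0 hD] := test_bnd m (test_cut c N tp0).
  exists (maxn m k), (C * (2 ^+ m * D) + 2 * M) => phi B sp pL hB.
  have tp := test_of_support sp pL.
  have B0 : 0 <= B by exact: bndAt_ge0 (hB 0).
  have h1 : `|F phi - H (cut c N phi)| <= 2 * (M * B).
    have := hF phi tp B (fun x => bndAt_le (leq_maxr m k) (lexx B) (hB x)) N (leqnn N).
    move/le_trans; apply; rewrite ler_wpM2l// ler_piMr ?mulr_ge0// exprn_ile1//; lra.
  have h2 : `|H (cut c N phi)| <= C * (2 ^+ m * D * B).
    apply: hC; first exact: (test_cut c N tp).1.
      by move=> x /pL; rewrite /cut => ->; rewrite mulr0.
    move=> x xL; have -> : cut c N phi = fun y => cut c N (plateau (L + 1)) y * phi y.
      apply/funext => y; rewrite /cut; case: (lerP `|y| L) => yL.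
        by rewrite plateau_eq1 ?mulr1//; lra.
      by rewrite pL// !mulr0.
    apply: bndAtM; [exact: (test_cut c N tp0).1|exact: sp|exact: hD|].
    exact: bndAt_le (leq_maxl m k) (lexx B) (hB x).
  have -> : (C * (2 ^+ m * D) + 2 * M) * B = C * (2 ^+ m * D * B) + 2 * (M * B) by ring.
  rewrite -[F phi](subrK (H (cut c N phi))) addrC.
  by apply: le_trans (ler_normD _ _) _; apply: lerD.
exists Hp; split.
- move=> phi tp p0; rewrite hHp; apply: Funiq => //; exists 0; split => // n _.
  have -> : cut c n phi = fun=> 0.
    apply/funext => y; rewrite /cut; case: (lerP c y) => yc; first by rewrite p0// mulr0.
    rewrite step_eq0 ?mul0r// subr_le0; apply: (@le_trans _ _ 0) => //.
    by rewrite pmulr_rle0 ?exprn_gt0// subr_le0 ltW.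
  by rewrite dist0 subrr normr0 mul0r.
- move=> phi d tp d0 p0; rewrite hHp.
  have d2 : 0 < d / 2 by rewrite divr_gt0.
  have [N1 hN1] := half_lt d2.
  have e1 n : (N1 <= n)%N -> cut c n phi = phi.
    move=> /hN1 nd; apply/funext => y; rewrite /cut; case: (lerP y (c + d)) => yd.
      by rewrite p0// mulr0.
    rewrite step_eq1 ?mul1r//.
    have h1 : 2 <= 2 ^+ n * d.
      have := ltW nd; rewrite ler_pdivlMr// exprVn -ler_pdivlMl ?invr_gt0 ?exprn_gt0// invrK.
      by rewrite mulrC.
    have : 2 ^+ n * d <= 2 ^+ n * (y - c) by rewrite ler_wpM2l ?exprn_ge0//; lra.
    lra.
  have [B B0 hB] := test_bnd k tp.
  apply/eqP; rewrite -subr_eq0 -normr_le0.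
  apply: (@le_halving R _ _ (2 * (M * B)) (fun n => 1 * 2^-1 ^+ n) (maxn N N1)).
  + exact: halving.
  + by rewrite !mulr_ge0.
  move=> j; rewrite geq_max => /andP[Nj N1j]; rewrite add0r mul1r.
  have h3 := hF phi tp B hB j Nj; rewrite (e1 j N1j) in h3.
  have -> : 2 * (M * B) * 2^-1 ^+ j = 2 * (M * B * 2^-1 ^+ j) by ring.
  exact: h3.
apply/point_valueP => phi tp e e0.
have [L L0 hL] := test_support tp.
have [B B0 hB] := test_bnd k tp.
(* From the first relevant scale on, 2^-n / |r| < 2 L. This bounds the dilation of phi seen at scale
   2^-n, whence the factor (1 + 2 L)^k. *)
pose Q : R := 2 ^+ k * A * ((1 + 2 * L) ^+ k * B).
have Q0 : 0 <= Q by rewrite /Q !mulr_ge0 ?exprn_ge0 ?addr_ge0 ?mulr_ge0//; lra.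
have e10 : 0 < e / (4 * L * (Q + 1)) by rewrite divr_gt0// !mulr_gt0//; lra.
have [r1 r10 hr1] := piece _ e10.
have lim1 : 0 < Num.min 1 (r1 / (2 * L)) by rewrite lt_min ltr01/= divr_gt0//; lra.
exists (Num.min r1 1 / (2 * L)); first by rewrite divr_gt0 ?lt_min ?r10//; lra.
move=> r rp; rewrite ltr_pdivlMr; last by lra.
rewrite lt_min => /andP[rr1 rr2].
have rn0 : r != 0 by rewrite -normr_gt0.
have tr : test_function (rescale c r phi) by exact: test_rescale.
have Lr0 : 0 < L * `|r| by rewrite mulr_gt0.
(* n0 is the first scale at which the cutoff meets the support of the rescaled test function *)
have [n0 [hn1 hn2]] : exists n0 : nat, L * `|r| <= 2^-1 ^+ n0 /\ 2^-1 ^+ n0 < 2 * (L * `|r|).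
  have Lr1 : L * `|r| <= 1 by lra.
  have [n0 [h1 h2]] := dyadic_scale Lr0 Lr1.
  exists n0; split.
    by rewrite exprVn -[leRHS]mulr1 ler_pdivlMl ?exprn_gt0.
  rewrite exprVn -[ltLHS]mulr1 ltr_pdivrMl ?exprn_gt0//.
  by move: h2; rewrite exprSr -mulrA.
have z0 : H (cut c n0 (rescale c r phi)) = 0.
  rewrite -[RHS](dist0 H); congr (dist_fun H _); apply/funext => y; rewrite /cut.
  case: (lerP (y - c) (2^-1 ^+ n0)) => yc.
    rewrite step_eq0 ?mul0r// subr_le0; move: yc.
    by rewrite exprVn -[leRHS]mulr1 ler_pdivlMl ?exprn_gt0.
  rewrite /rescale hL ?mulr0// normrM normfV ltr_pdivlMr//.
  by apply: le_lt_trans hn1 _; apply: lt_le_trans yc _; exact: ler_norm.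
pose d n : R := (e / (4 * L * (Q + 1)) * Q) * 2^-1 ^+ n.
have st n : (n0 <= n)%N ->
    `|H (cut c n.+1 (rescale c r phi)) - H (cut c n (rescale c r phi))| <= d n.
  move=> n0n.
  have nn0 : 2^-1 ^+ n <= 2^-1 ^+ n0 :> R.
    by rewrite !exprVn lef_pV2 ?posrE ?exprn_gt0// ler_weXn2l// ler1n.
  have s2 : 2^-1 ^+ n < 2 * (L * `|r|) by exact: le_lt_trans hn2.
  have nr : 2^-1 ^+ n < r1 by apply: lt_trans s2 _; lra.
  have hb u : 2^-1 <= u ->
      bndAt k ((1 + 2 * L) ^+ k * B) (fun u => rescale c r phi (2^-1 ^+ n * u + c)) u.
    move=> u1.
    have -> : (fun u => rescale c r phi (2^-1 ^+ n * u + c)) =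
        fun u => phi ((2^-1 ^+ n / r) * u + 0).
      by apply/funext => z; rewrite /rescale; congr phi; field.
    apply: bndAt_le (leqnn k) _ (bndAt_aff (2^-1 ^+ n / r) 0 tp.1 (hB _)).
    rewrite ler_wpM2r// lerXn2r ?nnegrE ?addr_ge0//; first by lra.
    rewrite lerD2l normrM normfV (gtr0_norm (half_pow n)) ler_pdivrMr//.
    by rewrite -mulrA ltW.
  apply: le_trans (hr1 n _ _ nr tr hb) _.
  by rewrite /d /Q le_eqVlt; apply/orP; left; apply/eqP; ring.
have [l hl] := @halving_limit R (fun n => H (cut c n (rescale c r phi))) d n0 (halving _) st.
have dn n : d n = (e / (4 * L * (Q + 1)) * Q) * 2^-1 ^+ n by [].
have C0 : 0 <= e / (4 * L * (Q + 1)) * Q by rewrite mulr_ge0// ltW.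
have -> : Hp (rescale c r phi) = l.
  rewrite hHp; have [B1 B10 hB1] := test_bnd k tr.
  apply/eqP; rewrite -subr_eq0 -normr_le0.
  apply: (@le_halving R _ _ (2 * (M * B1) + 2 * (e / (4 * L * (Q + 1)) * Q)) (fun n => 1 * 2^-1 ^+ n) (maxn N n0)).
  + exact: halving.
  + by apply: addr_ge0; apply: mulr_ge0 => //; apply: mulr_ge0.
  move=> j; rewrite geq_max => /andP[Nj n0j]; rewrite add0r mul1r mulrDl -!(mulrA 2) -dn.
  by apply: dist_tri; [exact: hF|exact: hl].
have := hl n0 (leqnn n0); rewrite z0 subr0 mul0r subr0 normrM normfV normr_id => hl0.
rewrite ler_pdivrMl//; apply: le_trans hl0 _; rewrite dn.
apply: (@le_trans _ _ (2 * (e / (4 * L * (Q + 1)) * Q * (2 * (L * `|r|))))).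
  by rewrite ler_wpM2l// ler_wpM2l// ltW.
have Q1 : 0 < Q + 1 by lra.
rewrite (_ : _ * (_ * _) = `|r| * e * (Q / (Q + 1))); last by field; rewrite !gt_eqF.
by rewrite ler_piMr ?mulr_ge0 ?(ltW e0)// ler_pdivrMr// mul1r lerDl.
Qed.

End cutoff.

(** * Supports and localization *)

Section localization.
Context {R : realType}.
Implicit Types (f g psi phi chi m : R -> R) (x y z t r : R) (h : schwartz_distribution R).

(* Continuous induction on z, the assertion being the claim for all multiples m phi that vanish
   beyond z. *)
Lemma local_to_global h phi (P : R -> Prop) : P 0 -> (forall u v, P u -> P v -> P (u + v)) ->
  test_function phi ->
  (forall x, exists2 d : R, 0 < d & forall m, smooth m -> (forall y, 0 <= m y) ->
     (forall y, d <= `|y - x| -> phi y * m y = 0) -> P (h (fun y => phi y * m y))) ->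
  P (h phi).
Proof.
move=> P0 PD tp loc; have [L L0 hL] := test_support tp.
pose T : set R := [set z | forall m, smooth m -> (forall y, 0 <= m y) ->
  (forall y, z <= y -> phi y * m y = 0) -> P (h (fun y => phi y * m y))].
have Tdone z : L < z -> T z -> P (h phi).
  move=> zL Tz; have := Tz (fun=> 1) (smooth_cst 1) (fun _ => ler01).
  have -> : (fun y => phi y * 1) = phi by apply/funext => y; rewrite mulr1.
  apply=> y zy; rewrite hL ?mul0r//; apply: lt_le_trans (ler_norm _).
  exact: lt_le_trans zy.
have T0 : T (- L - 1).
  move=> m sm m0 hm; have -> : (fun y => phi y * m y) = fun=> 0; last by rewrite dist0.
  apply/funext => y; case: (lerP (- L - 1) y) => yL; first exact: hm.
  by rewrite hL ?mul0r//; rewrite ltr_normr; apply/orP; right; lra.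
case: (pselect (exists2 z, T z & L < z)) => [[z Tz zL]|nT]; first exact: (Tdone z).
have ubT : ubound T L by move=> z Tz; rewrite leNgt; apply/negP => zL; apply: nT; exists z.
have hsT : has_sup T by split; [exists (- L - 1)|exists L].
pose s := sup T; have [d d0 hd] := loc s.
have d2 : 0 < d / 2 by rewrite divr_gt0.
have d4 : 0 < d / 4 by rewrite divr_gt0.
have [z Tz sz] := sup_adherent d2 hsT.
suff : T (s + d / 2) by move=> /(ub_le_sup hsT.2); rewrite -/s; lra.
move=> m sm m0 hm.
(* The part weighted by [sg] vanishes beyond z and is covered by z being in [T]. The other part
   vanishes before z - d / 4 > s - 3 d / 4 and beyond s + d / 2, so it is local at s. *)
pose sg y : R := smooth_step ((z - y) / (d / 4)).
have ssg : smooth sg.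
  have := smooth_aff (- (d / 4)^-1) (z / (d / 4)) (@smooth_smooth_step R).
  by congr smooth; apply/funext => y; rewrite /sg; congr smooth_step; ring.
have sm1 : smooth (fun y => m y * sg y) by exact: smoothM.
have sm2 : smooth (fun y => m y * (1 - sg y)).
  by apply: smoothM; [exact: sm|apply: smoothB; [exact: smooth_cst|exact: ssg]].
have e1 : (fun y => phi y * m y) = fun y => phi y * (m y * sg y) + phi y * (m y * (1 - sg y)).
  by apply/funext => y; ring.
rewrite e1 distD; [|by apply: testM; [exact: tp|exact: sm1]|by apply: testM; [exact: tp|exact: sm2]].
apply: PD.
  apply: Tz; [exact: sm1|by move=> y; rewrite mulr_ge0 ?step_ge0|].
  move=> y zy; rewrite /sg step_eq0 ?mulr0//.
  by rewrite pmulr_lle0 ?invr_gt0// subr_le0.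
apply: hd; [exact: sm2|by move=> y; rewrite mulr_ge0 ?subr_ge0 ?step_le1|].
move=> y; rewrite ler_normr => /orP[] yd.
  by rewrite mulrA hm ?mul0r//; lra.
rewrite /sg step_eq1 ?subrr ?mulr0//.
by rewrite ler_pdivlMr// mul1r; move: sz; rewrite -/s; lra.
Qed.

Lemma not_dist_supp h x : ~ dist_supp h x -> exists2 d : R, 0 < d &
  forall phi, test_function phi -> (forall y, d <= `|y - x| -> phi y = 0) -> h phi = 0.
Proof.
move=> /contrapT[V [oV Vx] hV].
have [d /= d0 hd] : nbhs x V by exact: open_nbhs_nbhs.
exists (d / 2); first by rewrite divr_gt0.
move=> phi tp hp; apply: hV => // y.
have sub : tsupp phi `<=` `[x - d / 2, x + d / 2].
  apply: tsupp_sub; first exact: itv_closed.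
  move=> z /=; rewrite in_itv/= -ler_distl => /negP; rewrite -ltNge => /ltW; exact: hp.
move=> /sub/=; rewrite in_itv/= -ler_distl => yd; apply: hd; rewrite /ball/=.
by rewrite distrC; lra.
Qed.

Lemma vanish_off_supp h phi : test_function phi ->
  (forall x, dist_supp h x -> \forall y \near x, phi y = 0) -> h phi = 0.
Proof.
move=> tp hx; apply: (@local_to_global h phi (fun u => u = 0)) => //.
  by move=> u v -> ->; rewrite addr0.
move=> x; case: (pselect (dist_supp h x)) => [/hx[d /= d0 hd]|/not_dist_supp[d d0 hd]].
  exists d => // m sm m0 hm; rewrite -[RHS](dist0 h); congr (dist_fun h _).
  apply/funext => y; case: (lerP d `|y - x|) => yx; first exact: hm.
  by rewrite hd ?mul0r//= distrC.
exists d; first exact: d0.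
by move=> m sm m0 hm; apply: hd; [exact: testM|exact: hm].
Qed.

(** Two cutoffs equal to 1 near the support of [h] differ by a function vanishing near it, so the
    chosen cutoff may be replaced by an explicit plateau. *)
Lemma compact_pairingE h (a b M : R) psi : supported_in h a b -> 0 < M -> - M < a -> b < M ->
  smooth psi -> compact_pairing h psi = h (fun y => plateau M y * psi y).
Proof.
move=> hs M0 Ma bM sp.
have tM : test_function (plateau M) by exact: test_plateau.
rewrite /compact_pairing; case: xgetP => [_ -> [chi [tc [V [oV hV cV]] ->]]|/(_ (h (fun y => plateau M y * psi y)))[]].
  apply/eqP; rewrite -subr_eq0 -distB; [|by apply: testM; [exact: tc|exact: sp]|by apply: testM; [exact: tM|exact: sp]].
  apply/eqP; apply: vanish_off_supp.
    by apply: testB; [apply: testM; [exact: tc|exact: sp]|apply: testM; [exact: tM|exact: sp]].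
  move=> x hx; have /andP[xa xb] : a <= x <= b by have := hs x hx; rewrite /= in_itv.
  have h1 : \forall y \near x, V y by apply: open_nbhs_nbhs; split => //; exact: hV.
  have h2 : \forall y \near x, - M < y by apply: lt_nbhsr; lra.
  have h3 : \forall y \near x, y < M by apply: lt_nbhsl; lra.
  near=> y; rewrite cV ?plateau_eq1 ?subrr//; last by near: y; exact: h1.
  rewrite ler_norml; apply/andP; split; apply: ltW; near: y; [exact: h2|exact: h3].
exists (plateau M); split => //; exists `]- M, M[%classic; split.
- exact: itv_open.
- move=> x /hs /=; rewrite !in_itv/= => /andP[xa xb]; apply/andP; split; lra.
- by move=> x /=; rewrite in_itv/= => /andP[x1 x2]; apply: plateau_eq1 => //; rewrite ler_norml; lra.
Unshelve. all: by end_near. Qed.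

Lemma at_right0P (V : set R) : (0 : R)^'+ V <-> exists2 r0 : R, 0 < r0 & forall r, 0 < r < r0 -> V r.
Proof.
split=> [[d /= d0 hd]|[d d0 hd]].
  exists d => // r /andP[r0 rd]; apply: hd => //=; by rewrite sub0r normrN gtr0_norm.
by exists d => //= r /=; rewrite sub0r normrN => rd r0; apply: hd; rewrite r0 -(gtr0_norm r0).
Qed.

Lemma limf_einf_gt f (M : R) : (M%:E < limf_einf (fun r => (f r)%:E) 0^'+)%E ->
  exists2 r0 : R, 0 < r0 & forall r, 0 < r < r0 -> M <= f r.
Proof.
rewrite limf_einfE => /ereal_sup_gt[_ [V /at_right0P[r0 r00 hV] <-] hM].
exists r0 => // r hr; rewrite -lee_fin; apply: le_trans (ltW hM) _.
by apply: ereal_inf_lbound; exists r => //; exact: hV.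
Qed.

Lemma limf_einf_ge f (c : R) : (forall e : R, 0 < e -> exists2 r0 : R, 0 < r0 &
    forall r, 0 < r < r0 -> c - e <= f r) -> (c%:E <= limf_einf (fun r => (f r)%:E) 0^'+)%E.
Proof.
move=> hf; apply/lee_subgt0Pr => e e0; have [r0 r00 hr] := hf e e0.
rewrite limf_einfE -EFinB; apply: (@le_trans _ _ (ereal_inf ((fun r => (f r)%:E) @` [set r | 0 < r < r0]))).
  by apply: le_ereal_inf_tmp => _ [r rr <-]; rewrite lee_fin; exact: hr.
by apply: ereal_sup_ubound; exists [set r | 0 < r < r0] => //; apply/at_right0P; exists r0.
Qed.

Lemma limf_esup_lt f (M : R) : (limf_esup (fun r => (f r)%:E) 0^'+ < M%:E)%E ->
  exists2 r0 : R, 0 < r0 & forall r, 0 < r < r0 -> f r <= M.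
Proof.
rewrite limf_esupE => /ereal_inf_lt[_ [V /at_right0P[r0 r00 hV] <-] hM].
exists r0 => // r hr; rewrite -lee_fin; apply: le_trans (ltW hM).
by apply: ereal_sup_ubound; exists r => //; exact: hV.
Qed.

Lemma limf_esup_le f (c : R) : (forall e : R, 0 < e -> exists2 r0 : R, 0 < r0 &
    forall r, 0 < r < r0 -> f r <= c + e) -> (limf_esup (fun r => (f r)%:E) 0^'+ <= c%:E)%E.
Proof.
move=> hf; apply/lee_addgt0Pr => e e0; have [r0 r00 hr] := hf e e0.
rewrite limf_esupE -EFinD; apply: (@le_trans _ _ (ereal_sup ((fun r => (f r)%:E) @` [set r | 0 < r < r0]))).
  by apply: ereal_inf_lbound; exists [set r | 0 < r < r0] => //; apply/at_right0P; exists r0.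
by apply: ge_ereal_sup => _ [r rr <-]; rewrite lee_fin; exact: hr.
Qed.

End localization.

(** * The heat equation *)

Section min_principle.
Context {R : realType}.
Implicit Types (f g : R -> R -> R) (x T e : R).

(* f solves the heat equation f_T = f_xx / 4 + e at (x, T) *)
Definition heat_at f x T e := exists (fx : R -> R) (fxx fT : R),
  [/\ forall z : R, is_derive z 1 (fun z : R => f z T) (fx z), is_derive x 1 fx fxx,
      is_derive T 1 (f x) fT & fT = fxx / 4 + e].

Definition jcont f x T := forall e, 0 < e -> exists2 d : R, 0 < d & forall x' T',
  `|x' - x| <= d -> `|T' - T| <= d -> `|f x' T' - f x T| <= e.

Lemma heat_atD f g x T e e' : heat_at f x T e -> heat_at g x T e' ->
  heat_at (fun x T => f x T + g x T) x T (e + e').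
Proof.
move=> [fx [fxx [fT [h1 h2 h3 h4]]]] [gx [gxx [gT [k1 k2 k3 k4]]]].
exists (fun z => fx z + gx z), (fxx + gxx), (fT + gT); split.
- by move=> z; exact: is_deriveDf (h1 z) (k1 z).
- exact: is_deriveDf h2 k2.
- exact: is_deriveDf h3 k3.
- by rewrite h4 k4; field.
Qed.

Lemma heat_atZ (c : R) f x T e : heat_at f x T e -> heat_at (fun x T => c * f x T) x T (c * e).
Proof.
move=> [fx [fxx [fT [h1 h2 h3 h4]]]].
exists (fun z => c * fx z), (c * fxx), (c * fT); split.
- by move=> z; exact: is_deriveZf (h1 z).
- exact: is_deriveZf h2.
- exact: is_deriveZf h3.
- by rewrite h4; field.
Qed.

Lemma heat_at_affine (n eta : R) x T : heat_at (fun _ T => n + eta * T) x T eta.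
Proof.
exists (fun=> 0), 0, eta; split.
- by move=> z; exact: is_derive_cst.
- exact: is_derive_cst.
- have := is_derive_aff eta n T; congr is_derive; apply/funext => u; exact: addrC.
- by rewrite mul0r add0r.
Qed.

Lemma heat_at_shift (T1 : R) f x T e : heat_at f x (T + T1) e ->
  heat_at (fun x T => f x (T + T1)) x T e.
Proof.
move=> [fx [fxx [fT [h1 h2 h3 h4]]]]; exists fx, fxx, fT; split => //.
have ea : is_derive T 1 (fun T => T + T1) 1.
  by have := is_derive_aff 1 T1 T; congr is_derive; apply/funext => u; rewrite mul1r.
by have := @is_derive_compf R (f x) (fun T => T + T1) T _ _ h3 ea; rewrite mulr1.
Qed.

Lemma jcontD f g x T : jcont f x T -> jcont g x T -> jcont (fun x T => f x T + g x T) x T.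
Proof.
move=> hf hg e e0; have e2 : 0 < e / 2 by rewrite divr_gt0.
have [d d0 hd] := hf _ e2; have [d' d'0 hd'] := hg _ e2.
exists (Num.min d d'); first by rewrite lt_min d0.
move=> x' T'; rewrite !le_min => /andP[h1 h2] /andP[h3 h4].
have := hd _ _ h1 h3; have := hd' _ _ h2 h4.
move: (f x' T') (f x T) (g x' T') (g x T) => a b a' b'; rewrite !ler_norml; lra.
Qed.

Lemma jcontZ (c : R) f x T : jcont f x T -> jcont (fun x T => c * f x T) x T.
Proof.
move=> hf e e0; have [d d0 hd] := hf (e / (`|c| + 1)) (divr_gt0 e0 (ltr_wpDl (normr_ge0 _) ltr01)).
exists d => // x' T' h1 h2; rewrite -mulrBr normrM.
apply: le_trans (ler_wpM2l (normr_ge0 _) (hd _ _ h1 h2)) _.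
by rewrite mulrCA ler_piMr ?(ltW e0)// ler_pdivrMr ?ltr_wpDl// mul1r lerDl.
Qed.

Lemma jcont_affine (n eta : R) x T : jcont (fun _ T => n + eta * T) x T.
Proof.
move=> e e0; exists (e / (`|eta| + 1)); first by rewrite divr_gt0// ltr_wpDl.
move=> x' T' _ h2; have -> : n + eta * T' - (n + eta * T) = eta * (T' - T) by ring.
rewrite normrM; apply: le_trans (ler_wpM2l (normr_ge0 _) h2) _.
by rewrite mulrCA ler_piMr ?(ltW e0)// ler_pdivrMr ?ltr_wpDl// mul1r lerDl.
Qed.

Lemma jcont_shift (T1 : R) f x T : jcont f x (T + T1) -> jcont (fun x T => f x (T + T1)) x T.
Proof.
move=> hf e e0; have [d d0 hd] := hf e e0; exists d => // x' T' h1 h2; apply: hd => //.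
by have -> : T' + T1 - (T + T1) = T' - T by ring.
Qed.

Lemma derive_pos_left (f : R -> R) x (d : R) : is_derive x 1 f d -> 0 < d ->
  exists2 r : R, 0 < r & forall h, 0 < h < r -> f (x - h) < f x /\ f x < f (x + h).
Proof.
move=> df d0; have cv : h^-1 *: ((f \o shift x) (h *: 1) - f x) @[h --> 0^'] --> d.
  by case: df => dv <-; exact: dv.
have [r /= r0 hr] : \forall h \near 0^', 0 < h^-1 *: ((f \o shift x) (h *: 1) - f x).
  by move/cvgr_gt : cv; apply.
exists r => // h /andP[h0 hh]; split.
  have := hr (- h); rewrite /= sub0r opprK (gtr0_norm h0) oppr_eq0 gt_eqF// => /(_ hh isT).
  rewrite /GRing.scale/= mulr1 invrN mulNr oppr_gt0 pmulr_rlt0 ?invr_gt0// subr_lt0.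
  by rewrite addrC.
have := hr h; rewrite /= sub0r normrN (gtr0_norm h0) gt_eqF// => /(_ hh isT).
by rewrite /GRing.scale/= mulr1 pmulr_rgt0 ?invr_gt0// subr_gt0 addrC.
Qed.

Lemma second_derive_min (f fx : R -> R) (a b x fxx : R) : a < x < b ->
  (forall z : R, is_derive z 1 f (fx z)) -> is_derive x 1 fx fxx ->
  (forall z, a <= z <= b -> f x <= f z) -> 0 <= fxx.
Proof.
move=> /andP[ax xb] df dfx fmin; rewrite leNgt; apply/negP => fxx0.
have fx0 : fx x = 0.
  have /(_ _ _ _) h := @derive1_at_min R f a b x (ltW (lt_trans ax xb)).
  have := h (fun z _ => is_derive_derivable (df z)).
  rewrite in_itv/= ax xb => /(_ isT) h2.
  have h3 : is_derive x 1 f 0.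
    by apply: h2 => z; rewrite in_itv/= => /andP[az zb]; apply: fmin; rewrite !ltW.
  by rewrite -(is_derive1E (df x)) (is_derive1E h3).
have dN : is_derive x 1 (fun z => -1 * fx z) (- fxx).
  by have := @is_deriveZf R (-1) fx x _ dfx; rewrite mulN1r.
have [r r0 hr] := derive_pos_left dN (ltac:(by rewrite oppr_gt0)).
pose h := Num.min (r / 2) (b - x).
have h0 : 0 < h by rewrite lt_min divr_gt0//= subr_gt0.
have hr2 : h < r by rewrite gt_min; apply/orP; left; lra.
have hb : h <= b - x by rewrite ge_min lexx orbT.
have [||c] := @MVT R f fx x (x + h).
- by rewrite ltrDl.
- apply: continuous_subspaceT => z.
  by apply/differentiable_continuous/derivable1_diffP; exact: is_derive_derivable (df z).
rewrite in_itv/= => /andP[xc ch] e.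
have fc : fx c < 0.
  have [_] := hr (c - x) (ltac:(by apply/andP; split; lra)).
  by rewrite fx0 mulr0 mulN1r oppr_gt0 addrC subrK.
have := fmin (x + h) (ltac:(by apply/andP; split; lra)).
rewrite -subr_ge0 e addrC addKr; rewrite leNgt => /negP; apply.
by rewrite nmulr_rlt0.
Qed.

(** At a minimum off the bottom and the sides f_xx >= 0, so the strictly positive source forces f_T
    > 0, and slightly earlier values are smaller. Only the past is used, so the top T = T0 is
    included. *)
Lemma heat_min_principle f (al be T1 T0 : R) : al <= be -> T1 <= T0 ->
  (forall x T, al <= x <= be -> T1 <= T <= T0 -> jcont f x T) ->
  (forall x T, al < x < be -> T1 < T <= T0 -> exists2 e : R, 0 < e & heat_at f x T e) ->
  (forall T, T1 <= T <= T0 -> 0 <= f al T /\ 0 <= f be T) ->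
  (forall x, al <= x <= be -> 0 <= f x T1) ->
  forall x T, al <= x <= be -> T1 <= T <= T0 -> 0 <= f x T.
Proof.
move=> ab TT cf hf side bot.
pose A := (`[al, be]%classic `*` `[T1, T0]%classic : set (R * R)).
have A0 : A !=set0 by exists (al, T1); split; rewrite /= in_itv/= lexx.
have cA : compact A by apply: compact_setX; exact: segment_compact.
have cfA : {within A, continuous (fun p : R * R => f p.1 p.2)}.
  apply: continuous_in_subspaceT => -[x T]; rewrite inE => -[/= xA TA].
  move: xA TA; rewrite /= !in_itv/= => xA TA.
  apply/cvgrPdist_le => e e0; have [d d0 hd] := cf x T xA TA e e0.
  exists (ball x d, ball T d); first by split; exact: nbhsx_ballx.
  move=> [x' T'] [/= h1 h2]; rewrite distrC; apply: hd.
    by rewrite distrC; exact: ltW h1.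
  by rewrite distrC; exact: ltW h2.
have [[x0 S0] mA hmin] := compact_EVT_min A0 cA cfA.
have [xA SA] : al <= x0 <= be /\ T1 <= S0 <= T0.
  by move: mA; rewrite inE => -[]/=; rewrite !in_itv.
have {}hmin x T : al <= x <= be -> T1 <= T <= T0 -> f x0 S0 <= f x T.
  by move=> h1 h2; apply: (hmin (x, T)); rewrite inE; split; rewrite /= in_itv.
suff m0 : 0 <= f x0 S0 by move=> x T h1 h2; apply: le_trans m0 (hmin x T h1 h2).
have /andP[ax xb] := xA; have /andP[TS ST] := SA.
have [<-|xna] := eqVneq al x0; first by case: (side S0 SA).
have [e1|xnb] := eqVneq x0 be; first by rewrite e1; case: (side S0 SA).
have [e1|Sn] := eqVneq T1 S0; first by rewrite -e1; exact: bot.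
have xI : al < x0 < be by rewrite !lt_neqAle xna ax xnb xb.
have SI : T1 < S0 <= T0 by rewrite lt_neqAle Sn TS ST.
have [e e0 [fx [fxx [fT [h1 h2 h3 h4]]]]] := hf x0 S0 xI SI.
have fxx0 : 0 <= fxx.
  by apply: (second_derive_min xI h1 h2) => z hz; exact: hmin.
have fT0 : 0 < fT by rewrite h4; lra.
have [r r0 hr] := derive_pos_left h3 fT0.
have /andP[TS' _] := SI.
pose h := Num.min (r / 2) (S0 - T1).
have h0 : 0 < h by rewrite lt_min divr_gt0//= subr_gt0.
have hr2 : h < r by rewrite gt_min; apply/orP; left; lra.
have hb : h <= S0 - T1 by rewrite ge_min lexx orbT.
have [hl _] := hr h (ltac:(by rewrite h0)).
have := hmin x0 (S0 - h) xA (ltac:(by apply/andP; split; lra)).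
by rewrite leNgt hl.
Qed.

End min_principle.

(** * The Gaussian transform as a solution of the heat equation *)

Section heat_kernel.
Context {R : realType}.
Implicit Types (f g chi : R -> R) (x y T s e u : R) (h w : schwartz_distribution R).

(** The kernel is parametrized by the rate s = 1 / T, since a change of s multiplies e^(-s u^2) by a
    factor that is easily expanded. *)
Definition gauss_rate s u : R := expR (- (s * u ^+ 2)).
Local Notation ge := gauss_rate.

Lemma smooth_bounded_gauss_rate s : 0 < s -> smooth_bounded (ge s).
Proof.
move=> s0; have := smooth_bounded_aff 1 (Num.sqrt s) (@smooth_bounded_gauss_fun R).
congr smooth_bounded; apply/funext => u.
by rewrite mul1r /gauss_fun /gauss_rate exprMn sqr_sqrtr// ltW.
Qed.

Lemma is_derive_gauss_rate s u : is_derive u 1 (ge s) (- (2 * s) * (u * ge s u)).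
Proof.
have h1 := @is_deriveMf R id id u 1 1 (is_derive_id _ _) (is_derive_id _ _).
have h2 := @is_deriveZf R (- s) _ u _ h1.
have := @is_derive_compf R expR (fun u => - s * (u * u)) u _ _ (is_derive_expR _) h2.
have -> : (fun y => expR (- s * (y * y))) = ge s.
  by apply/funext => z; rewrite /ge mulNr expr2.
have -> : expR (- s * (u * u)) = ge s u by rewrite /gauss_rate mulNr expr2.
by move/is_derive_eq; apply; rewrite /=; ring.
Qed.

Lemma smooth_gauss_rate s : smooth (ge s).
Proof.
apply: (smooth_comp (f := expR) smooth_expR); have := smoothZ (- s) (@smooth_sqr R).
by congr smooth; apply/funext => u; rewrite mulNr.
Qed.

Arguments smooth_gauss_rate s : clear implicits.

Lemma expR_lip x : `|expR x - 1| <= `|x| * expR `|x|.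
Proof.
have := @derivable_lipschitz R expR 0 x (expR `|x|) (fun z => @derivable_expR R z).
rewrite subr0 expR0 [_ * `|x|]mulrC; apply => z; rewrite subr0 => zx.
rewrite (is_derive1E (is_derive_expR z)) ger0_norm ?expR_ge0// ler_expR.
exact: le_trans (ler_norm _) zx.
Qed.

Lemma expR_taylor x : `|expR x - 1 - x| <= expR `|x| * `|x| ^+ 2.
Proof.
have de : derive1 (@expR R) = expR by apply: derive1_fun => z; exact: is_derive_expR.
have := @smooth_taylor2 R expR 0 x (expR `|x|) smooth_expR.
rewrite subr0 de expR0 mulr1; apply => z; rewrite subr0 => zx.
rewrite derive1nS derive1n1 de de ger0_norm ?expR_ge0// ler_expR.
exact: le_trans (ler_norm _) zx.
Qed.

Lemma bndAt_id (L u : R) k : `|u| <= L -> bndAt k (L + 1) (fun u => u) u.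
Proof.
have d1 : derive1 (fun u : R => u) = fun=> 1 by apply: derive1_fun => z; exact: is_derive_id.
move=> uL [|[|j]] _.
- by apply: le_trans uL _; rewrite lerDl.
- by rewrite derive1n1 d1 normr1 lerDr; exact: le_trans uL.
- rewrite -derive1nSr d1 derive1n_cst normr0; apply: addr_ge0 => //; exact: le_trans uL.
Qed.

Lemma gauss_rate_sq (L e u : R) : `|e| <= 1 -> `|u| <= L -> `|e * u ^+ 2| <= L ^+ 2 * `|e|.
Proof.
move=> e1 uL; rewrite normrM mulrC ler_wpM2r// normrX lerXn2r ?nnegrE//.
exact: le_trans uL.
Qed.

(** This and the two estimates that follow are the expansion of e^(-e u^2) in powers of e, with
    remainders of order 0, 1 and 2 in C^k, for e of either sign. Deriving in u produces a factor e
    times a remainder of one order less, so each estimate feeds the next. *)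
Lemma gauss_rate_bnd0 k (L : R) : exists2 C : R, 0 <= C & forall e u, `|e| <= 1 -> `|u| <= L ->
  bndAt k C (ge e) u.
Proof.
elim: k => [|k [C C0 hC]].
  exists (expR (L ^+ 2)) => [|e u e1 uL [|//] _ /=]; first exact: expR_ge0.
  rewrite ger0_norm ?expR_ge0// ler_expR; apply: le_trans (ler_norm _) _; rewrite normrN.
  by apply: le_trans (gauss_rate_sq e1 uL) _; rewrite ler_piMr// sqr_ge0.
pose D : R := 2 * (2 ^+ k * (`|L| + 1) * C).
have D0 : 0 <= D by rewrite /D !mulr_ge0 ?exprn_ge0 ?addr_ge0.
exists (expR (L ^+ 2) + D); first by rewrite addr_ge0 ?expR_ge0.
move=> e u e1 uL; apply/bndAtS; split.
  rewrite ger0_norm ?expR_ge0//; apply: (@le_trans _ _ (expR (L ^+ 2))); last by rewrite lerDl.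
  rewrite ler_expR; apply: le_trans (ler_norm _) _; rewrite normrN.
  by apply: le_trans (gauss_rate_sq e1 uL) _; rewrite ler_piMr// sqr_ge0.
have -> : derive1 (ge e) = fun u => - (2 * e) * (u * ge e u).
  by apply: derive1_fun => z; exact: is_derive_gauss_rate.
have su : smooth (fun u => u * ge e u) by apply: smoothM; [exact: smooth_id|exact: smooth_gauss_rate].
have uL' : `|u| <= `|L| by apply: le_trans uL _; exact: ler_norm.
have h := bndAtZ (- (2 * e)) su (bndAtM smooth_id (smooth_gauss_rate e) (bndAt_id uL') (hC e u e1 uL)).
apply: bndAt_le (leqnn k) _ h.
apply: (@le_trans _ _ D); last by rewrite lerDr expR_ge0.
rewrite /D normrN normrM ger0_norm// ler_wpM2r ?mulr_ge0 ?exprn_ge0 ?addr_ge0//.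
by rewrite ler_piMr.
Qed.

Lemma gauss_rate_bnd1 k (L : R) : exists2 C : R, 0 <= C & forall e u, `|e| <= 1 -> `|u| <= L ->
  bndAt k (C * `|e|) (fun u => ge e u - 1) u.
Proof.
have val e u : `|e| <= 1 -> `|u| <= L -> `|ge e u - 1| <= L ^+ 2 * expR (L ^+ 2) * `|e|.
  move=> e1 uL; apply: le_trans (expR_lip _) _; rewrite normrN mulrAC.
  have h := gauss_rate_sq e1 uL; apply: ler_pM; rewrite ?expR_ge0//.
  by rewrite ler_expR; apply: le_trans h _; rewrite ler_piMr// sqr_ge0.
have LE : 0 <= L ^+ 2 * expR (L ^+ 2) by rewrite mulr_ge0 ?sqr_ge0 ?expR_ge0.
case: k => [|k].
  by exists (L ^+ 2 * expR (L ^+ 2)) => // e u e1 uL [|//] _; exact: val.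
have [C C0 hC] := gauss_rate_bnd0 k L.
pose D : R := 2 * (2 ^+ k * (`|L| + 1) * C).
have D0 : 0 <= D by rewrite /D !mulr_ge0 ?exprn_ge0 ?addr_ge0.
exists (L ^+ 2 * expR (L ^+ 2) + D); first exact: addr_ge0.
move=> e u e1 uL; rewrite mulrDl; apply/bndAtS; split.
  by apply: le_trans (val e u e1 uL) _; rewrite lerDl mulr_ge0.
have -> : derive1 (fun u => ge e u - 1) = fun u => - (2 * e) * (u * ge e u).
  apply: derive1_fun => z; rewrite -[X in is_derive _ _ _ X]subr0.
  by have := @is_deriveDf R (ge e) (fun=> -1) z _ 0 (is_derive_gauss_rate e z) (is_derive_cst _ _ _); rewrite subr0 addr0.
have su : smooth (fun u => u * ge e u) by apply: smoothM; [exact: smooth_id|exact: smooth_gauss_rate].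
have uL' : `|u| <= `|L| by apply: le_trans uL _; exact: ler_norm.
have h := bndAtZ (- (2 * e)) su (bndAtM smooth_id (smooth_gauss_rate e) (bndAt_id uL') (hC e u e1 uL)).
apply: bndAt_le (leqnn k) _ h.
rewrite normrN normrM ger0_norm// [leLHS](_ : _ = D * `|e|); last by rewrite /D; ring.
by rewrite lerDr mulr_ge0.
Qed.

Lemma gauss_rate_bnd2 k (L : R) : exists2 C : R, 0 <= C & forall e u, `|e| <= 1 -> `|u| <= L ->
  bndAt k (C * `|e| ^+ 2) (fun u => ge e u - 1 + e * u ^+ 2) u.
Proof.
have val e u : `|e| <= 1 -> `|u| <= L -> `|ge e u - 1 + e * u ^+ 2| <= expR (L ^+ 2) * (L ^+ 2) ^+ 2 * `|e| ^+ 2.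
  move=> e1 uL; have := expR_taylor (- (e * u ^+ 2)); rewrite opprK => h1.
  apply: le_trans h1 _; rewrite normrN -mulrA -exprMn.
  have h := gauss_rate_sq e1 uL.
  have Le : 0 <= L ^+ 2 * `|e| by rewrite mulr_ge0// sqr_ge0.
  apply: ler_pM; rewrite ?expR_ge0//.
    by rewrite ler_expR; apply: le_trans h _; rewrite ler_piMr// sqr_ge0.
  by rewrite lerXn2r ?nnegrE.
have LE : 0 <= expR (L ^+ 2) * (L ^+ 2) ^+ 2 by rewrite mulr_ge0 ?sqr_ge0 ?expR_ge0.
case: k => [|k].
  by exists (expR (L ^+ 2) * (L ^+ 2) ^+ 2) => // e u e1 uL [|//] _; exact: val.
have [C C0 hC] := gauss_rate_bnd1 k L.
pose D : R := 2 * (2 ^+ k * (`|L| + 1) * C).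
have D0 : 0 <= D by rewrite /D !mulr_ge0 ?exprn_ge0 ?addr_ge0.
exists (expR (L ^+ 2) * (L ^+ 2) ^+ 2 + D); first exact: addr_ge0.
move=> e u e1 uL; rewrite mulrDl; apply/bndAtS; split.
  by apply: le_trans (val e u e1 uL) _; rewrite lerDl mulr_ge0// exprn_ge0.
have -> : derive1 (fun u => ge e u - 1 + e * u ^+ 2) = fun u => - (2 * e) * (u * (ge e u - 1)).
  apply: derive1_fun => z.
  have h1 := @is_deriveMf R id id z 1 1 (is_derive_id _ _) (is_derive_id _ _).
  have h2 := @is_deriveZf R e _ z _ h1.
  have h3 := @is_deriveDf R (ge e) (fun=> -1) z _ 0 (is_derive_gauss_rate e z) (is_derive_cst _ _ _).
  have h4 := @is_deriveDf R _ _ z _ _ h3 h2.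
  have -> : (fun u => ge e u - 1 + e * u ^+ 2) = fun y => ge e y + -1 + e * (y * y).
    by apply/funext => y; rewrite expr2.
  by move/is_derive_eq : h4; apply; rewrite /=; ring.
have sg : smooth (fun u => ge e u - 1) by apply: smoothB; [exact: smooth_gauss_rate|exact: smooth_cst].
have su : smooth (fun u => u * (ge e u - 1)) by apply: smoothM; [exact: smooth_id|exact: sg].
have uL' : `|u| <= `|L| by apply: le_trans uL _; exact: ler_norm.
have h := bndAtZ (- (2 * e)) su (bndAtM smooth_id sg (bndAt_id uL') (hC e u e1 uL)).
apply: bndAt_le (leqnn k) _ h.
rewrite normrN normrM ger0_norm// [leLHS](_ : _ = D * `|e| ^+ 2); last by rewrite /D; ring.
by rewrite lerDr mulr_ge0// exprn_ge0.
Qed.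

Variables (w : schwartz_distribution R) (chi : R -> R) (K : R).
Hypotheses (sc : smooth chi) (cK : forall x, K < `|x| -> chi x = 0) (K0 : 0 <= K).

Let tc : test_function chi := test_of_support sc cK.

Let pr f x := w (fun y => chi y * f (y - x)).

Lemma is_derive_transl f x : smooth_bounded f -> is_derive x 1 (pr f) (- pr (derive1 f) x).
Proof.
move=> bf; have [m [C [C0 hC]]] := dist_bound w K0.
have [A A0 hA] := test_bnd m tc; have [B B0 hB] := bf.2 m.+2.
have sf := bf.1.
pose M := C * (2 ^+ m * A * B).
have M0 : 0 <= M by rewrite /M !mulr_ge0 ?exprn_ge0.
apply: (is_derive_of_quadratic M0 (@ltr01 R)) => e _.
have bf' := smooth_bounded_derive1 bf.
have t1 z := test_chi_shift sc cK bf z.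
have t2 z := test_chi_shift sc cK bf' z.
have -> : pr f (e + x) - pr f x - e * - pr (derive1 f) x =
   w (fun y => chi y * (f (y - (e + x)) - f (y - x) - - e * derive1 f (y - x))).
  have -> : (fun y => chi y * (f (y - (e + x)) - f (y - x) - - e * derive1 f (y - x))) =
    fun y => (chi y * f (y - (e + x)) - chi y * f (y - x)) - - e * (chi y * derive1 f (y - x)).
    by apply/funext => y; ring.
  have t3 : test_function (fun y => - e * (chi y * derive1 f (y - x))) by apply: testZ; exact: t2.
  rewrite distB; [|by apply: testB; exact: t1|exact: t3].
  rewrite distB; [|exact: t1|exact: t1].
  by rewrite distZ; [rewrite /pr; ring|exact: t2].
have s1 z : smooth (fun y => f (y - z)) by apply: smooth_shift; exact: sf.
have s2 z : smooth (fun y => derive1 f (y - z)) by apply: smooth_shift; exact: bf'.1.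
have s3 : smooth (fun y => f (y - (e + x)) - f (y - x)) by apply: smoothB; exact: s1.
have s4 : smooth (fun y => - e * derive1 f (y - x)) by apply: smoothZ; exact: s2.
have s5 : smooth (fun y => f (y - (e + x)) - f (y - x) - - e * derive1 f (y - x)) by exact: smoothB s3 s4.
rewrite /M -mulrA -(mulrA _ B); apply: hC.
- by apply: smoothM; [exact: sc|exact: s5].
- by move=> y yK; rewrite cK// mul0r.
move=> y _; apply: bndAtM; [exact: sc|exact: s5|exact: hA|].
move=> j jm; rewrite (derive1nB _ s3 s4) (derive1nB _ (s1 _) (s1 _)) (derive1nZ _ _ (s2 x)).
rewrite !(derive1n_shift _ _ sf) (derive1n_shift _ _ bf'.1).
have := @smooth_taylor2 R (derive1n j f) (y - x) (y - (e + x)) B (smooth_derive1n j sf).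
have -> : y - (e + x) - (y - x) = - e by ring.
rewrite normrN -!derive1nS derive1nSr; apply => z _.
by have := hB z j.+2 jm; rewrite -[derive1n j.+2 f]/(derive1n 2 (derive1n j f)).
Qed.

Let q x s := pr (ge s) x.
Let q2 x s := pr (fun u => u ^+ 2 * ge s u) x.

Lemma gauss_rateD s e u : ge (s + e) u = ge s u * ge e u.
Proof. by rewrite /gauss_rate -expRD; congr expR; ring. Qed.

Lemma test_gauss_rate s x : test_function (fun y => chi y * ge s (y - x)).
Proof. by apply: testM; [exact: tc|apply: smooth_shift; exact: smooth_gauss_rate]. Qed.

(** The kernel of rate s + e is that of rate s times e^(-e u^2), expanded on the support of [chi].
    Uniformity in |x| <= X yields joint continuity besides the derivative in s. *)
Lemma rate_increment s (X : R) : 0 < s -> exists2 C : R, 0 <= C & forall x e, `|x| <= X -> `|e| <= 1 ->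
  `|q x (s + e) - q x s| <= C * `|e| /\
  `|q x (s + e) - q x s + e * q2 x s| <= C * `|e| ^+ 2.
Proof.
move=> s0; have [m [C [C0 hC]]] := dist_bound w K0.
have bs := smooth_bounded_gauss_rate s0; have ss := bs.1.
have [A A0 hA] := test_bnd m tc; have [B B0 hB] := bs.2 m.
have [D1 D10 hD1] := gauss_rate_bnd1 m (K + X); have [D2 D20 hD2] := gauss_rate_bnd2 m (K + X).
pose Q : R := C * (2 ^+ m * A * (2 ^+ m * B * (D1 + D2))).
have key g (E : R) x : smooth g -> `|x| <= X ->
   (forall u, `|u| <= K + X -> bndAt m ((D1 + D2) * E) g u) ->
   `|w (fun y => chi y * (ge s (y - x) * g (y - x)))| <= Q * E.
  move=> sg xX hg.
  have -> : Q * E = C * (2 ^+ m * A * (2 ^+ m * B * ((D1 + D2) * E))) by rewrite /Q; ring.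
  have sgg : smooth (fun y => ge s (y - x) * g (y - x)).
    by apply: smoothM; apply: smooth_shift; [exact: ss|exact: sg].
  apply: hC.
  - by apply: smoothM; [exact: sc|exact: sgg].
  - by move=> y yK; rewrite cK// mul0r.
  move=> y yK; apply: bndAtM; [exact: sc|exact: sgg|exact: hA|].
  apply: bndAtM; [by apply: smooth_shift; exact: ss|by apply: smooth_shift; exact: sg| |].
    by move=> j jm; rewrite (derive1n_shift _ _ ss); exact: hB.
  move=> j jm; rewrite (derive1n_shift _ _ sg); apply: hg => //.
  by apply: le_trans (ler_normB _ _) _; exact: lerD.
exists Q; first by rewrite /Q !mulr_ge0 ?exprn_ge0 ?addr_ge0.
move=> x e xX e1; split.
  rewrite /q /pr -distB; [|exact: test_gauss_rate|exact: test_gauss_rate].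
  have -> : (fun y => chi y * ge (s + e) (y - x) - chi y * ge s (y - x)) =
      fun y => chi y * (ge s (y - x) * (fun u => ge e u - 1) (y - x)).
    by apply/funext => y; rewrite gauss_rateD; ring.
  apply: (key (fun u => ge e u - 1) `|e| x _ xX).
    by apply: smoothB; [exact: smooth_gauss_rate|exact: smooth_cst].
  move=> u uK; apply: bndAt_le (leqnn m) _ (hD1 e u e1 uK).
  by rewrite ler_wpM2r// lerDl.
have t2 : test_function (fun y => chi y * ((fun u => u ^+ 2 * ge s u) (y - x))).
  apply: testM; [exact: tc|].
  have := @smooth_shift R x (fun u => u ^+ 2 * ge s u); apply.
  by apply: smoothM; [exact: smooth_sqr|exact: ss].
have t3 : test_function (fun y => e * (chi y * ((fun u => u ^+ 2 * ge s u) (y - x)))) by exact: testZ.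
have t4 : test_function (fun y => chi y * ge (s + e) (y - x) - chi y * ge s (y - x)).
  by apply: testB; exact: test_gauss_rate.
rewrite /q /q2 /pr -distB; [|exact: test_gauss_rate|exact: test_gauss_rate].
rewrite -(distZ w e t2) -(distD w t4 t3).
have -> : (fun y => chi y * ge (s + e) (y - x) - chi y * ge s (y - x) +
       e * (chi y * ((y - x) ^+ 2 * ge s (y - x)))) =
    fun y => chi y * (ge s (y - x) * (fun u => ge e u - 1 + e * u ^+ 2) (y - x)).
  by apply/funext => y; rewrite gauss_rateD; ring.
apply: (key (fun u => ge e u - 1 + e * u ^+ 2) (`|e| ^+ 2) x _ xX).
  apply: smoothD; first by apply: smoothB; [exact: smooth_gauss_rate|exact: smooth_cst].
  by apply: smoothZ; exact: smooth_sqr.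
move=> u uK; apply: bndAt_le (leqnn m) _ (hD2 e u e1 uK).
by rewrite ler_wpM2r ?exprn_ge0// lerDr.
Qed.

Lemma is_derive_rate x s : 0 < s -> is_derive s 1 (q x) (- q2 x s).
Proof.
move=> s0; have [C C0 hC] := @rate_increment s `|x| s0.
apply: (is_derive_of_quadratic C0 (@ltr01 R)) => e e1.
have [_ h] := hC x e (lexx _) e1; rewrite (addrC s) in h.
by rewrite mulrN opprK.
Qed.

Lemma jcont_rate x s : 0 < s -> jcont q x s.
Proof.
move=> s0 e e0; have [C C0 hC] := @rate_increment s (`|x| + 1) s0.
have [m [C1 [C10 hC1]]] := dist_boundedP w K0.
have [c c0 hc] := transl_lipschitz sc cK (smooth_bounded_gauss_rate s0) m.
pose D := C + C1 * c + 1.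
have D0 : 0 < D by rewrite /D ltr_wpDl// addr_ge0// mulr_ge0.
exists (Num.min 1 (e / D)); first by rewrite lt_min ltr01 divr_gt0.
move=> x' s'; rewrite !le_min => /andP[h1 h2] /andP[h3 h4].
have xx : `|x'| <= `|x| + 1.
  by rewrite -[x'](subrK x); apply: le_trans (ler_normD _ _) _; rewrite addrC lerD2l.
have [k1 _] := hC x' (s' - s) xx h3; rewrite (addrC s) subrK in k1.
have k2 : `|q x' s - q x s| <= C1 * c * `|x' - x| by exact: hc.
have -> : q x' s' - q x s = (q x' s' - q x' s) + (q x' s - q x s) by ring.
apply: le_trans (ler_normD _ _) _.
apply: (@le_trans _ _ (C * (e / D) + C1 * c * (e / D))).
  apply: lerD; first by apply: le_trans k1 _; rewrite ler_wpM2l.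
  by apply: le_trans k2 _; rewrite ler_wpM2l// mulr_ge0.
rewrite -mulrDl mulrCA ler_piMr ?(ltW e0)// ler_pdivrMr// mul1r /D; lra.
Qed.

Definition heat_pair x T : R := (Num.sqrt pi)^-1 * ((Num.sqrt T)^-1 * q x T^-1).

Lemma heat_pairE x t : 0 < t -> heat_pair x (t ^+ 2) = w (fun y => chi y * gauss_scaled t (y - x)).
Proof.
move=> t0; rewrite /heat_pair sqrtr_sqr gtr0_norm// mulrA -distZ; last exact: test_gauss_rate.
congr (dist_fun w _); apply/funext => y; rewrite /gauss_scaled /gauss_kernel mulrCA; congr (_ * _).
rewrite mulrA [t^-1 * _]mulrC; congr (_ * _).
rewrite /gauss_rate /gauss_fun; congr expR; congr (- _).
by rewrite exprMn exprVn.
Qed.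

Lemma gauss_rate_second s : 0 < s ->
  derive1 (derive1 (ge s)) = fun u => (2 * s) ^+ 2 * (u ^+ 2 * ge s u) - 2 * s * ge s u.
Proof.
move=> s0; have d1 : derive1 (ge s) = fun u => - (2 * s) * (u * ge s u).
  by apply: derive1_fun => u; exact: is_derive_gauss_rate.
rewrite d1; apply: derive1_fun => u.
have h := @is_deriveZf R (- (2 * s)) _ u _ (@is_deriveMf R id (ge s) u _ _ (is_derive_id _ _) (is_derive_gauss_rate s u)).
by move/is_derive_eq : h; apply; rewrite /=; ring.
Qed.

(** With s = 1 / T, the derivatives in x and in T both reduce to the pairings with e^(-s u^2) and
    u^2 e^(-s u^2). *)
Lemma heat_pair_heat x T : 0 < T -> heat_at heat_pair x T 0.
Proof.
move=> T0; pose s := T^-1; have s0 : 0 < s by rewrite invr_gt0.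
have sT0 : 0 < Num.sqrt T by rewrite sqrtr_gt0.
have bs := smooth_bounded_gauss_rate s0.
have bs1 := smooth_bounded_derive1 bs; have bs2 := smooth_bounded_derive1 bs1.
pose c := (Num.sqrt (@pi R))^-1; pose k := (Num.sqrt T)^-1.
exists (fun z => c * (k * - pr (derive1 (ge s)) z)),
   (c * (k * (-1 * - pr (derive1 (derive1 (ge s))) x))),
   (c * (- (k ^+ 2 * (2 * Num.sqrt T)^-1) * q x s + k * (- q2 x s * (- s ^+ 2)))); split.
- by move=> z; apply: is_deriveZf; apply: is_deriveZf; exact: is_derive_transl.
- apply: is_deriveZf; apply: is_deriveZf.
  have := @is_deriveZf R (-1) _ x _ (is_derive_transl x bs1).
  by congr is_derive; apply/funext => z; rewrite mulN1r.
- apply: is_deriveZf.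
  have hk : is_derive T 1 (fun T => (Num.sqrt T)^-1) (- (k ^+ 2 * (2 * Num.sqrt T)^-1)).
    have := is_deriveV (lt0r_neq0 sT0) (is_derive1_sqrt T0).
    by move/is_derive_eq; apply; rewrite /GRing.scale/= /k exprVn mulNr.
  have hs : is_derive T 1 (fun T : R => T^-1) (- s ^+ 2).
    have := @is_deriveV R id T 1 1 (lt0r_neq0 T0) (is_derive_id _ _).
    by move/is_derive_eq; apply; rewrite /GRing.scale/= /s exprVn mulr1.
  have hq := @is_derive_compf R (q x) (fun T => T^-1) T _ _ (is_derive_rate x s0) hs.
  exact: is_deriveMf hk hq.
rewrite addr0 gauss_rate_second//.
have -> : pr (fun u => (2 * s) ^+ 2 * (u ^+ 2 * ge s u) - 2 * s * ge s u) x =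
    (2 * s) ^+ 2 * q2 x s - 2 * s * q x s.
  have t2 : test_function (fun y => chi y * ((fun u => u ^+ 2 * ge s u) (y - x))).
    apply: testM; [exact: tc|].
    have := @smooth_shift R x (fun u => u ^+ 2 * ge s u); apply.
    by apply: smoothM; [exact: smooth_sqr|exact: bs.1].
  have t1 := test_gauss_rate s x.
  rewrite /q /q2 /pr -(distZ w _ t2) -(distZ w _ t1) -distB; [|exact: testZ|exact: testZ].
  by congr (dist_fun w _); apply/funext => y; ring.
have k2 : k ^+ 2 = s by rewrite /k /s exprVn sqr_sqrtr// ltW.
have kk : (2 * Num.sqrt T)^-1 = k / 2 by rewrite /k invfM mulrC.
by rewrite kk -k2; field.
Qed.

Lemma heat_pair_jcont x T : 0 < T -> jcont heat_pair x T.
Proof.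
move=> T0; apply: jcontZ => e e0.
have s0 : 0 < T^-1 by rewrite invr_gt0.
pose F (p : R) := (Num.sqrt p)^-1.
have cF : {for T, continuous F}.
  apply: continuousV; first by rewrite gt_eqF// sqrtr_gt0.
  exact: sqrt_continuous.
have cI : {for T, continuous (fun p : R => p^-1)}.
  by apply: continuousV; [rewrite gt_eqF|exact: cvg_id].
pose a := F T; pose b := q x T^-1.
pose e1 : R := Num.min 1 (e / (`|a| + `|b| + 1)).
have den : 0 < `|a| + `|b| + 1 by rewrite ltr_wpDl ?addr_ge0.
have e10 : 0 < e1 by rewrite lt_min ltr01 divr_gt0.
have [d1 d10 hd1] := jcont_rate x s0 e10.
have [d2 /= d20 hd2] := (cvgrPdist_le _ _).1 cF e1 e10.
have [d3 /= d30 hd3] := (cvgrPdist_le _ _).1 cI d1 d10.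
exists (Num.min d1 (Num.min d2 d3 / 2)); first by rewrite lt_min d10 divr_gt0// lt_min d20.
move=> x' T'; rewrite !le_min => /andP[h1 _] /andP[_ h2].
have h23 : `|T - T'| < Num.min d2 d3.
  have m0 : 0 < Num.min d2 d3 by rewrite lt_min d20.
  by rewrite distrC; apply: le_lt_trans h2 _; lra.
move: h23; rewrite lt_min => /andP[h22 h33].
have k1 := hd1 x' T'^-1 h1 (ltac:(by rewrite distrC; exact: hd3)).
have k2 : `|F T' - a| <= e1 by rewrite distrC; exact: hd2.
rewrite -/(F T') -/(F T) -/a -/b.
have -> : F T' * q x' T'^-1 - a * b = (F T' - a) * (q x' T'^-1 - b) + (a * (q x' T'^-1 - b) + (F T' - a) * b) by ring.
apply: (@le_trans _ _ (1 * e1 + (`|a| * e1 + e1 * `|b|))).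
  apply: le_trans (ler_normD _ _) _; apply: lerD.
    rewrite normrM; apply: ler_pM => //; apply: le_trans k2 _; by rewrite ge_min lexx.
  apply: le_trans (ler_normD _ _) _; apply: lerD; rewrite normrM; first by rewrite ler_wpM2l.
  by rewrite ler_wpM2r.
have -> : 1 * e1 + (`|a| * e1 + e1 * `|b|) = e1 * (`|a| + `|b| + 1) by ring.
by rewrite -ler_pdivlMr// ge_min lexx orbT.
Qed.

End heat_kernel.

(** * Locally positive distributions and the gap estimate *)

Section gap.
Context {R : realType}.
Implicit Types (f g chi psi : R -> R) (x y t e : R) (w : schwartz_distribution R).

Definition locally_positive w x := exists2 d : R, 0 < d & forall psi, test_function psi ->
  (forall y, 0 <= psi y) -> (forall y, d <= `|y - x| -> psi y = 0) -> 0 <= w psi.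

Lemma positive_of_local w phi : test_function phi -> (forall y, 0 <= phi y) ->
  (forall x, locally_positive w x \/ \forall y \near x, phi y = 0) -> 0 <= w phi.
Proof.
move=> tp p0 loc; apply: (@local_to_global R w phi (fun u => 0 <= u)) => //.
  by move=> u v; exact: addr_ge0.
move=> x; case: (loc x) => [[d d0 hd]|[d /= d0 hd]].
  exists d => // m sm m0 hm; apply: hd; [exact: testM| |exact: hm].
  by move=> y; rewrite mulr_ge0.
exists d => // m sm m0 hm; have -> : (fun y => phi y * m y) = fun=> 0; last by rewrite dist0.
apply/funext => y; case: (lerP d `|y - x|) => yx; first exact: hm.
by rewrite hd ?mul0r//= distrC.
Qed.

Lemma gauss_decay (n : nat) : exists2 C : R, 0 <= C & forall u : R,
  `|u| ^+ n * expR (- (u ^+ 2 / 2)) <= C.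
Proof.
have [C C0 hC] := poly_le_expR ('X^n) (@ltr01 R).
exists (C * expR (2^-1)); first by rewrite mulr_ge0 ?expR_ge0.
move=> u; have := hC u; rewrite hornerXn normrX mul1r => h.
rewrite expRN ler_pdivrMr ?expR_gt0//; apply: le_trans h _.
rewrite -mulrA -expRD ler_wpM2l// ler_expR -(real_normK (num_real u)).
have : 0 <= (`|u| - 1) ^+ 2 by exact: sqr_ge0.
have -> : (`|u| - 1) ^+ 2 = `|u| ^+ 2 - 2 * `|u| + 1 by ring.
lra.
Qed.

(** The variable u and the centre p lie on opposite sides up to the margin 2, so the cross term is
    harmless and half of a Gaussian in each variable survives. The constant is 8 = 2 * 2^2, left
    over when p completes the square with u <= 2. *)
Lemma corner_exponent (u p : R) : u <= 2 -> 0 <= p ->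
  p ^+ 2 / 2 + u ^+ 2 / 2 - 8 <= 3 / 4 * (u - p) ^+ 2.
Proof.
move=> u2 p0.
have -> : 3 / 4 * (u - p) ^+ 2 = 3 / 4 * u ^+ 2 - 3 / 2 * (u * p) + 3 / 4 * p ^+ 2 by field.
have hp := sqr_ge0 p; have hu := sqr_ge0 u.
case: (lerP u 0) => u0.
  by have : 0 <= - (u * p); [rewrite -mulNr mulr_ge0// oppr_ge0|lra].
have h1 : u * p <= 2 * p by rewrite ler_wpM2r.
have : 0 <= (p / 2 - 3) ^+ 2 by exact: sqr_ge0.
have -> : (p / 2 - 3) ^+ 2 = p ^+ 2 / 4 - 3 * p + 9 by field.
have : 0 <= (p / 2 - 3 / 2 * u) ^+ 2 by exact: sqr_ge0.
have -> : (p / 2 - 3 / 2 * u) ^+ 2 = p ^+ 2 / 4 - 3 / 2 * (u * p) + 9 / 4 * u ^+ 2 by field.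
have : u ^+ 2 <= 4.
  have -> : (4 : R) = 2 ^+ 2 by rewrite expr2; lra.
  by rewrite lerXn2r ?nnegrE ?(ltW u0).
lra.
Qed.

Lemma derive1_step_eq0 x : ~ (0 <= x <= 1) -> derive1 (@smooth_step R) x = 0.
Proof.
move=> hx; have [c hc] : exists c : R, \forall z \near x, (fun=> c) z = smooth_step z.
  have [x0|x0] := lerP 0 x.
    exists 1; have : \forall z \near x, 1 < z.
      by apply: lt_nbhsr; rewrite ltNge; apply/negP => x1; apply: hx; rewrite x0.
    by apply: filterS => z /ltW z1; rewrite step_eq1.
  exists 0; have : \forall z \near x, z < 0 by exact: lt_nbhsl.
  by apply: filterS => z /ltW z1; rewrite step_eq0.
have := near_derive1n 1 hc => /nbhs_singleton; rewrite !derive1n1 => <-.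
exact: derive1_cst.
Qed.

Lemma test_derive1_step : test_function (derive1 (@smooth_step R)).
Proof.
have h x : 1 < `|x| -> derive1 (@smooth_step R) x = 0.
  move=> x1; apply: derive1_step_eq0 => /andP[x0 xx]; move: x1; rewrite ger0_norm//; lra.
exact: (@test_of_support R _ 1 (smooth_derive1 (@smooth_smooth_step R)) h).
Qed.

Lemma smooth_bounded_step : smooth_bounded (@smooth_step R).
Proof.
split; first exact: smooth_smooth_step.
case=> [|k].
  exists 1 => // x [|//] _ /=; rewrite ger0_norm ?step_ge0//; exact: step_le1.
have [A A0 hA] := test_bnd k test_derive1_step.
exists (A + 1); first by rewrite addr_ge0.
move=> x; apply/bndAtS; split.
  by rewrite ger0_norm ?step_ge0//; apply: le_trans (step_le1 _) _; rewrite lerDr.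
by apply: bndAt_le (leqnn k) _ (hA x); rewrite lerDl.
Qed.

(* Near an end point e where t <w(e + t .), .> tends weakly to 0, the part of the Gaussian
   transform of w coming from the outer side of e is small in a uniform, Gaussian-weighted sense.
   The sign sg = 1 (resp. -1) is for x to the right (resp. left) of e. *)
Lemma corner_estimate w chi e (sg : R) : sg ^+ 2 = 1 -> weakly_small w e 1 -> test_function chi ->
  forall eps : R, 0 < eps -> exists2 r0 : R, 0 < r0 & forall t x, 0 < t < r0 -> 0 <= sg * (x - e) ->
    `|w (fun y => chi y * (smooth_step (2 - sg * ((y - e) / t)) * gauss_scaled t (y - x)))| <=
      eps * (t^-1 * expR (- ((x - e) ^+ 2 / (2 * t ^+ 2)))).
Proof.
move=> sg2 hw tc.
(* Any exponent below -1 would do, as the kernel decays faster than every power. *)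
have [k hk] := @weighted_small R w e 1 chi (-2) hw tc (ltac:(lra)).
have [C C0 hC] := @gauss_fun_bound R k.
have affE : (fun u : R => smooth_step (- sg * u + 2)) = fun u => smooth_step (2 - sg * u).
  by apply/funext => u; rewrite mulNr addrC.
have sS : smooth (fun u : R => smooth_step (2 - sg * u)).
  by rewrite -affE; exact: (smooth_aff (- sg) 2 (@smooth_smooth_step R)).
have [A A0 hA] : exists2 A : R, 0 <= A & forall u, bndAt k A (fun u : R => smooth_step (2 - sg * u)) u.
  have [A A0 hA] := smooth_bounded_step.2 k.
  exists ((1 + `|- sg|) ^+ k * A); first by rewrite mulr_ge0 ?exprn_ge0 ?addr_ge0.
  by move=> u; rewrite -affE; apply: bndAt_aff; [exact: smooth_smooth_step|exact: hA].
have [C2 C20 hC2] := gauss_decay (2 + k).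
pose c : R := (Num.sqrt pi)^-1.
have c0 : 0 < c by rewrite invr_gt0 sqrt_pi_gt0.
pose D : R := 2 ^+ k * A * (C * expR 8) * (C2 + 1).
have D00 : 0 <= 2 ^+ k * A * (C * expR 8) by rewrite !mulr_ge0 ?exprn_ge0 ?expR_ge0.
have D0 : 0 <= D by rewrite /D mulr_ge0// addr_ge0.
move=> eps eps0; pose eps' := eps / (c * D + 1).
have den : 0 < c * D + 1 by rewrite ltr_wpDl// mulr_ge0// ltW.
have [r0 r00 hr] := hk eps' (divr_gt0 eps0 den).
exists r0 => // t x /andP[t0 tr] xe.
have tn : t != 0 by rewrite gt_eqF.
pose p := (x - e) / t.
have p0 : 0 <= sg * p by rewrite /p mulrA divr_ge0// ltW.
pose Psi (u : R) := smooth_step (2 - sg * u) * gauss_fun (u - p).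
have sg' : smooth (fun u : R => gauss_fun (u - p)).
  by apply: smooth_shift; exact: (@smooth_gauss_fun R).
have sP : smooth Psi by exact: smoothM sS sg'.
(* The factor [E] bounds all derivatives of [Psi] at once, and the estimate for decaying kernels is
   linear in its bound; so the Gaussian weight in x passes to the result. *)
pose E := expR (- (p ^+ 2 / 2)).
have E0 : 0 <= E := expR_ge0 _.
have bnd u : bndAt k (2 ^+ k * A * (C * expR 8) * E * expR (- (u ^+ 2 / 2))) Psi u.
  have [u2|u2] := lerP (sg * u) 2.
    have h1 : bndAt k (C * expR (- (3 / 4 * (u - p) ^+ 2))) (fun u : R => gauss_fun (u - p)) u.
      by move=> j jk; rewrite (derive1n_shift _ _ (@smooth_gauss_fun R)); exact: hC.
    apply: bndAt_le (leqnn k) _ (bndAtM sS sg' (hA u) h1).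
    have -> : 2 ^+ k * A * (C * expR 8) * E * expR (- (u ^+ 2 / 2)) =
        2 ^+ k * A * (C * (expR 8 * E * expR (- (u ^+ 2 / 2)))) by ring.
    rewrite ler_wpM2l ?mulr_ge0 ?exprn_ge0// ler_wpM2l// /E -!expRD ler_expR.
    have := corner_exponent u2 p0; have -> : sg * u - sg * p = sg * (u - p) by ring.
    rewrite !exprMn sg2 !mul1r; lra.
  apply: bndAt_le (leqnn k) _ (bndAt_near _ (bndAt0 k u)).
    by rewrite !mulr_ge0 ?exprn_ge0 ?expR_ge0.
  have cs : {for u, continuous (fun u : R => sg * u)} by exact: mulrl_continuous.
  have /cvgr_gt/(_ _ u2) := cs.
  by apply: filterS => z z2; rewrite /Psi step_eq0 ?mul0r//; lra.
have := hr t Psi (D * E) (ltac:(by rewrite t0)) sP.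
have h1 u : bndAt k (D * E) Psi u.
  apply: bndAt_le (leqnn k) _ (bnd u).
  have -> : D * E = 2 ^+ k * A * (C * expR 8) * E * (C2 + 1) by rewrite /D; ring.
  rewrite ler_wpM2l ?(mulr_ge0 D00 E0)//.
  apply: (@le_trans _ _ 1); last by rewrite lerDr.
  by rewrite -[leRHS]expR0 ler_expR oppr_le0 divr_ge0// sqr_ge0.
have h2 u j : 1 <= `|u| -> (j <= k)%N -> `|derive1n j Psi u| <= D * E * `|u| `^ (-2 - j%:R).
  move=> u1 jk; apply: le_trans (bnd u j jk) _.
  have -> : D * E * `|u| `^ (-2 - j%:R) = 2 ^+ k * A * (C * expR 8) * E * ((C2 + 1) * `|u| `^ (-2 - j%:R)).
    by rewrite /D; ring.
  rewrite ler_wpM2l ?(mulr_ge0 D00 E0)//.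
  have -> : -2 - j%:R = - (2 + j)%:R :> R by rewrite natrD; ring.
  have u0 : 0 < `|u| by apply: lt_le_trans u1.
  rewrite powR_invn ?(ltW u0)// ler_pdivlMr ?exprn_gt0// mulrC.
  apply: (@le_trans _ _ (`|u| ^+ (2 + k) * expR (- (u ^+ 2 / 2)))).
    by rewrite ler_wpM2r ?expR_ge0// ler_weXn2l// leq_add2l.
  by apply: le_trans (hC2 u) _; rewrite lerDl.
move=> /(_ h1 h2); rewrite expr1 mulVKf// => h3.
have tP : test_function (fun y => chi y * rescale e t Psi y).
  by apply: testM; [exact: tc|apply: smooth_rescale; exact: sP].
have -> : (fun y => chi y * (smooth_step (2 - sg * ((y - e) / t)) * gauss_scaled t (y - x))) =
   fun y => c * t^-1 * (chi y * rescale e t Psi y).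
  apply/funext => y; rewrite /rescale /Psi /gauss_scaled /gauss_kernel -/c.
  have -> : t^-1 * (y - x) = (y - e) / t - p by rewrite /p; field.
  ring.
rewrite distZ// normrM (ger0_norm (ltW (mulr_gt0 c0 _))) ?invr_gt0//.
have -> : expR (- ((x - e) ^+ 2 / (2 * t ^+ 2))) = E.
  by rewrite /E /p; congr (expR (- _)); field.
apply: (@le_trans _ _ (c * t^-1 * (eps' * (D * E)))).
  by rewrite ler_wpM2l// mulr_ge0 ?invr_ge0// ltW.
have -> : c * t^-1 * (eps' * (D * E)) = (c * D * eps') * (t^-1 * E) by ring.
rewrite ler_wpM2r ?mulr_ge0 ?invr_ge0 ?(ltW t0)// /eps' mulrCA ler_piMr ?(ltW eps0)//.
by rewrite ler_pdivrMr// mul1r lerDl.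
Qed.

(** The weight 1 is split into a step at each end point and a middle part. The middle part vanishes
    within t of the ends and beyond them, so it only meets points where [w] is locally positive; the
    steps are handled by [corner_estimate]. *)
Lemma gap_bottom w chi (al be : R) : test_function chi -> (forall y, 0 <= chi y) -> al < be ->
  (forall y, al < y < be -> locally_positive w y) ->
  weakly_small w al 1 -> weakly_small w be 1 -> forall eps : R, 0 < eps ->
  exists2 r0 : R, 0 < r0 & forall t x, 0 < t < r0 -> al <= x <= be ->
    - (eps * (t^-1 * (expR (- ((x - al) ^+ 2 / (2 * t ^+ 2))) + expR (- ((x - be) ^+ 2 / (2 * t ^+ 2)))))) <=
      w (fun y => chi y * gauss_scaled t (y - x)).
Proof.
move=> tc c0 ab loc wa wb eps eps0.
have [r1 r10 h1] := @corner_estimate w chi al 1 (expr1n _ _) wa tc eps eps0.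
have [r2 r20 h2] := @corner_estimate w chi be (-1) (ltac:(by rewrite sqrrN expr1n)) wb tc eps eps0.
(* For t < (be - al) / 4 the two steps have disjoint supports, so the middle weight is
   nonnegative. *)
exists (Num.min (Num.min r1 r2) ((be - al) / 4)).
  by rewrite !lt_min r10 r20 divr_gt0// subr_gt0.
move=> t x /andP[t0]; rewrite !lt_min => /andP[/andP[tr1 tr2] tb] /andP[ax xb].
have := h1 t x (ltac:(by rewrite t0)) (ltac:(by rewrite mul1r subr_ge0)).
have := h2 t x (ltac:(by rewrite t0)) (ltac:(by rewrite mulN1r oppr_ge0 subr_le0)).
pose SL := fun y : R => smooth_step (2 - 1 * ((y - al) / t)).
pose SR := fun y : R => smooth_step (2 - -1 * ((y - be) / t)).
pose g := fun y => gauss_scaled t (y - x).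
have sS (sg e : R) : smooth (fun y : R => smooth_step (2 - sg * ((y - e) / t))).
  have := smooth_aff (- (sg / t)) (2 + sg * e / t) (@smooth_smooth_step R).
  congr smooth; apply/funext => y; congr smooth_step; field.
  by rewrite gt_eqF.
have sL : smooth SL by exact: sS.
have sR : smooth SR by exact: sS.
have sg : smooth g by apply: smooth_shift; exact: (smooth_bounded_gauss_scaled t).1.
have sLg : smooth (fun y => SL y * g y) by exact: smoothM.
have sRg : smooth (fun y => SR y * g y) by exact: smoothM.
have sm : smooth (fun y => 1 - SL y - SR y).
  by apply: smoothB; [apply: smoothB; [exact: smooth_cst|exact: sL]|exact: sR].
have smg : smooth (fun y => (1 - SL y - SR y) * g y) by exact: smoothM.
have tL : test_function (fun y => chi y * (SL y * g y)) by apply: testM; [exact: tc|exact: sLg].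
have tR : test_function (fun y => chi y * (SR y * g y)) by apply: testM; [exact: tc|exact: sRg].
have tm : test_function (fun y => chi y * ((1 - SL y - SR y) * g y)) by apply: testM; [exact: tc|exact: smg].
have mid0 : 0 <= w (fun y => chi y * ((1 - SL y - SR y) * g y)).
  apply: positive_of_local; first exact: tm.
    move=> y; apply: mulr_ge0 => //; apply: mulr_ge0; last first.
      by rewrite /g /gauss_scaled mulr_ge0 ?invr_ge0 ?(ltW t0)// gauss_kernel_ge0.
    have [yc|yc] := lerP ((y - al) / t) 2.
      have -> : SR y = 0.
        apply: step_eq0; rewrite mulN1r opprK -lerBrDl sub0r ler_pdivrMr//.
        by rewrite ler_pdivrMr// in yc; lra.
      by rewrite subr0 subr_ge0 step_le1.
    have -> : SL y = 0 by apply: step_eq0; lra.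
    by rewrite subr0 subr_ge0 step_le1.
  move=> y; case: (boolP (al < y < be)) => [yI|]; first by left; exact: loc.
  rewrite negb_and -!leNgt => /orP[ya|yb]; right.
    have h : \forall z \near y, z < al + t by apply: lt_nbhsl; lra.
    apply: filterS h => z za.
    have -> : SL z = 1.
      apply: step_eq1; rewrite mul1r; suff : (z - al) / t < 1 by lra.
      by rewrite ltr_pdivrMr//; lra.
    have -> : SR z = 0; last by rewrite subrr subr0 mul0r mulr0.
    apply: step_eq0; rewrite mulN1r opprK -lerBrDl sub0r ler_pdivrMr//; lra.
  have h : \forall z \near y, be - t < z by apply: lt_nbhsr; lra.
  apply: filterS h => z za.
  have -> : SR z = 1.
    apply: step_eq1; rewrite mulN1r opprK; suff : -1 < (z - be) / t by lra.
    by rewrite ltr_pdivlMr//; lra.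
  have -> : SL z = 0; last by rewrite subr0 subrr mul0r mulr0.
  apply: step_eq0; rewrite mul1r; suff : 2 <= (z - al) / t by lra.
  by rewrite ler_pdivlMr//; lra.
have -> : (fun y => chi y * gauss_scaled t (y - x)) =
    fun y => (chi y * (SL y * g y) + chi y * (SR y * g y)) + chi y * ((1 - SL y - SR y) * g y).
  by apply/funext => y; rewrite /g; ring.
rewrite distD; [|by apply: testD; [exact: tL|exact: tR]|exact: tm].
rewrite distD; [|exact: tL|exact: tR].
move: mid0; rewrite -/(SL _) -/(SR _) -/(g _).
move: (w (fun y => chi y * (SL y * g y))) => A.
move: (w (fun y => chi y * (SR y * g y))) => B.
move: (w (fun y => chi y * ((1 - SL y - SR y) * g y))) => D D0.
rewrite !ler_norml => /andP[h3 _] /andP[h4 _].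
rewrite mulrDr mulrDr opprD; move: h3 h4 D0; lra.
Qed.

(* Minimum principle for the Gaussian transform plus N, plus eta T (which makes the inequality
   strict), plus ka times the heat kernels issued at time - T1 from the two end points, which
   absorb the negative part allowed by gap_bottom at the initial time T1 = t1 ^ 2. *)
Lemma gap_bound w chi (K al be N t0 : R) : smooth chi -> (forall x, K < `|x| -> chi x = 0) -> 0 <= K ->
  (forall y, 0 <= chi y) -> al < be ->
  (forall y, al < y < be -> locally_positive w y) ->
  weakly_small w al 1 -> weakly_small w be 1 -> 0 <= N ->
  (forall t, 0 < t <= t0 -> - N <= w (fun y => chi y * gauss_scaled t (y - al)) /\
                            - N <= w (fun y => chi y * gauss_scaled t (y - be))) ->
  forall x t, al <= x <= be -> 0 < t <= t0 -> - N <= w (fun y => chi y * gauss_scaled t (y - x)).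
Proof.
move=> sc cK K0 c0 ab loc wa wb N0 side x t xI /andP[tp tt].
have t00 : 0 < t0 by exact: lt_le_trans tt.
have tc := test_of_support sc cK.
(* The sum of the Dirac masses at the end points: its Gaussian transform is the sum of the two heat
   kernels, to which the results on [heat_pair] apply. *)
have [w2 hw2] : exists w2 : schwartz_distribution R, forall phi, w2 phi = phi al + phi be.
  apply: dist_of_bounded => [c phi psi _ _|L _]; first by ring.
  exists 0%N, 2 => phi B _ _ hB; apply: le_trans (ler_normD _ _) _.
  by have := hB al 0%N isT; have := hB be 0%N isT; rewrite /=; lra.
pose L := `|al| + `|be| + 1.
have L0 : 0 < L by rewrite /L ltr_wpDl ?addr_ge0.
pose h2 := heat_pair w2 (plateau L).
pose sp : R := Num.sqrt pi.
have sp0 : 0 < sp by exact: sqrt_pi_gt0.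
have h2E z T : 0 < T -> h2 z T = sp^-1 * ((Num.sqrt T)^-1 * (gauss_rate T^-1 (z - al) + gauss_rate T^-1 (z - be))).
  move=> T0; rewrite /h2 /heat_pair hw2 !plateau_eq1 ?mul1r//.
  - by rewrite /gauss_rate -(sqrrN (z - al)) -(sqrrN (z - be)) !opprB.
  - by rewrite /L; have := normr_ge0 al; lra.
  - by rewrite /L; have := normr_ge0 be; lra.
have h2_ge0 z T : 0 < T -> 0 <= h2 z T.
  move=> T0; rewrite h2E// mulr_ge0 ?invr_ge0 ?(ltW sp0)// mulr_ge0 ?invr_ge0 ?sqrtr_ge0//.
  by rewrite addr_ge0 ?expR_ge0.
have h2_le z T : 0 < T -> t ^+ 2 <= T -> h2 z T <= sp^-1 * (t^-1 * 2).
  move=> T0 tT; rewrite h2E// ler_pM2l ?invr_gt0//; apply: ler_pM.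
  - by rewrite invr_ge0 sqrtr_ge0.
  - by rewrite addr_ge0 ?expR_ge0.
  - rewrite lef_pV2 ?posrE ?sqrtr_gt0//.
    by rewrite -(ger0_norm (ltW tp)) -sqrtr_sqr ler_wsqrtr.
  - have ge1 u : gauss_rate T^-1 u <= 1.
      by rewrite -[leRHS]expR0 ler_expR oppr_le0 mulr_ge0 ?sqr_ge0// invr_ge0 ltW.
    by have := ge1 (z - al); have := ge1 (z - be); lra.
suff H : forall de : R, 0 < de -> 0 <= w (fun y => chi y * gauss_scaled t (y - x)) + N + de.
  rewrite -subr_ge0 opprK; apply/ler_addgt0Pr => de de0; rewrite -[leLHS]/0; exact: H.
move=> de de0.
pose q2 : R := Num.sqrt 2.
have q20 : 0 < q2 by rewrite sqrtr_gt0.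
pose Q := sp^-1 * (t^-1 * 2).
have Q0 : 0 < Q by rewrite /Q !mulr_gt0 ?invr_gt0.
(* [Q] bounds the two heat kernels from time t^2 on, so they cost at most de / 2 there; likewise eta
   t^2 = de / 2. The factor relating [eps] to [ka] normalizes a heat kernel at time 2 T1, the time
   elapsed since -T1. *)
pose ka := de / 2 / Q.
have ka0 : 0 < ka by rewrite !divr_gt0.
pose eps := ka / (sp * q2).
have eps0 : 0 < eps by rewrite divr_gt0// mulr_gt0.
pose eta := de / 2 / t ^+ 2.
have eta0 : 0 < eta by rewrite !divr_gt0// exprn_gt0.
have [r0 r00 hb] := gap_bottom tc c0 ab loc wa wb eps0.
pose t1 := Num.min (r0 / 2) t.
have t10 : 0 < t1 by rewrite lt_min tp divr_gt0.
have t1r : t1 < r0 by rewrite /t1 gt_min; apply/orP; left; lra.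
have t1t : t1 <= t by rewrite ge_min lexx orbT.
pose T1 := t1 ^+ 2.
have T10 : 0 < T1 by rewrite exprn_gt0.
pose f := fun z T => heat_pair w chi z T + (N + eta * T) + ka * h2 z (T + T1).
have sqT (T : R) : 0 < T -> T = Num.sqrt T ^+ 2 by move=> T0; rewrite sqr_sqrtr// ltW.
have sq0 (T : R) : 0 < T -> 0 < Num.sqrt T by rewrite sqrtr_gt0.
have TT : T1 <= t0 ^+ 2 by rewrite lerXn2r ?nnegrE ?(ltW t10) ?(ltW t00)//; exact: le_trans tt.
have pK z : 2 * L < `|z| -> plateau L z = 0.
  by move=> zL; apply: plateau_eq0 => //; exact: ltW.
have LL : 0 <= 2 * L by rewrite mulr_ge0// ltW.
have sP : smooth (plateau L) := (test_plateau L0).1.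
have f0 : 0 <= f x (t ^+ 2).
  apply: (@heat_min_principle R f al be T1 (t0 ^+ 2) (ltW ab) TT) => //.
  - move=> z T _ /andP[TT1 _]; have T0 : 0 < T by exact: lt_le_trans TT1.
    have TT0 : 0 < T + T1 by exact: addr_gt0.
    apply: jcontD; last by apply: jcontZ; apply: jcont_shift; exact: (heat_pair_jcont w2 sP pK LL z TT0).
    by apply: jcontD; [exact: (heat_pair_jcont w sc cK K0 z T0)|exact: jcont_affine].
  - move=> z T _ /andP[TT1 _]; have T0 : 0 < T by exact: lt_trans TT1.
    have TT0 : 0 < T + T1 by exact: addr_gt0.
    exists eta => //; have -> : eta = 0 + eta + ka * 0 by ring.
    apply: heat_atD; last by apply: heat_atZ; apply: heat_at_shift; exact: (heat_pair_heat w2 sP pK LL z TT0).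
    apply: heat_atD; last exact: heat_at_affine.
    exact: (heat_pair_heat w sc cK K0 z T0).
  - move=> T /andP[TT1 TT0]; have T0 : 0 < T by exact: lt_le_trans TT1.
    have sT : 0 < Num.sqrt T <= t0.
      rewrite sqrtr_gt0 T0/=; rewrite -(ger0_norm (ltW t00)) -sqrtr_sqr.
      by rewrite ler_wsqrtr.
    have [s1 s2] := side _ sT.
    have e1 : 0 <= eta * T by rewrite mulr_ge0// ltW.
    have e2 z : 0 <= ka * h2 z (T + T1) by rewrite mulr_ge0 ?(ltW ka0)// h2_ge0// addr_gt0.
    have V z : heat_pair w chi z T = w (fun y => chi y * gauss_scaled (Num.sqrt T) (y - z)).
      by rewrite {1}(sqT T T0) (heat_pairE w sc cK)// sq0.
    by rewrite /f !V; split; rewrite addr_ge0 ?e2// addrA addr_ge0// -lerBlDr sub0r.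
  - move=> z zI; have := hb t1 z (ltac:(by rewrite t10)) zI.
    rewrite -(heat_pairE w sc cK z t10) -/T1 => hbz.
    have -> : f z T1 = heat_pair w chi z T1 + eps * (t1^-1 * (expR (- ((z - al) ^+ 2 / (2 * t1 ^+ 2))) +
         expR (- ((z - be) ^+ 2 / (2 * t1 ^+ 2))))) + (N + eta * T1).
      rewrite /f h2E ?addr_gt0//; have -> : T1 + T1 = 2 * t1 ^+ 2 by rewrite /T1; ring.
      rewrite sqrtrM// sqrtr_sqr gtr0_norm// -/q2 /gauss_rate ![(2 * t1 ^+ 2)^-1 * _]mulrC.
      rewrite /eps; field.
      by rewrite !gt_eqF.
    have e1 : 0 <= eta * T1 by rewrite mulr_ge0// ltW.
    by move: hbz e1 N0; lra.
  - by rewrite lerXn2r ?nnegrE ?(ltW t10) ?(ltW tp)//= lerXn2r ?nnegrE ?(ltW t00) ?(ltW tp).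
move: f0; rewrite /f (heat_pairE w sc cK x tp).
have -> : eta * t ^+ 2 = de / 2 by rewrite /eta divfK// gt_eqF// exprn_gt0.
have : ka * h2 x (t ^+ 2 + T1) <= de / 2.
  apply: (@le_trans _ _ (ka * Q)); last by rewrite /ka divfK// gt_eqF.
  by rewrite ler_pM2l// h2_le ?addr_gt0 ?exprn_gt0// lerDl ltW.
lra.
Qed.

End gap.

(** * Fatou, Baire and positivity everywhere *)

Section positivity.
Context {R : realType}.
Implicit Types (f g chi psi : R -> R) (x y t e : R) (w : schwartz_distribution R).
Local Notation mu := lebesgue_measure.

(** Fatou's lemma for functions bounded below, by dominated convergence of the parts min (f n,
    0). *)
Lemma itg_liminf (L N : R) (Z : set R) (f : nat -> R -> R) : 0 <= L -> 0 <= N ->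
  (forall n, continuous (f n)) -> mu.-negligible Z ->
  (forall n x, - L <= x <= L -> - N <= f n x) ->
  (forall x, - L <= x <= L -> ~ Z x -> forall e : R, 0 < e -> exists n0, forall n, (n0 <= n)%N -> - e <= f n x) ->
  forall e : R, 0 < e -> exists n0, forall n, (n0 <= n)%N -> - e <= itg (- L) L (f n).
Proof.
move=> L0 N0 cf nZ fN fZ e e0.
pose g n x := 2^-1 * (f n x - `|f n x|).
have cg n : continuous (g n).
  move=> x; apply: cvgM; first exact: cvg_cst.
  by apply: cvgB; [exact: cf|exact: (continuous_norm (cf n))].
have gf n x : g n x <= f n x by rewrite /g; have := ler_normr (f n x) (- f n x); have := lerNnormlW (lexx `|f n x|); lra.
have g0 n x : g n x <= 0 by rewrite /g; have := ler_norm (f n x); lra.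
have gle n x (a : R) : 0 <= a -> - a <= f n x -> `|g n x| <= a.
  move=> a0 fa; rewrite ler0_norm// /g.
  by case: (lerP 0 (f n x)) => f0; [rewrite ger0_norm|rewrite ltr0_norm]; lra.
pose D := `[- L, L]%classic : set R.
have [||||||_ _ h] := @dominated_convergence _ _ R mu D _ (fun n x => (g n x)%:E) (fun=> 0%E) (fun=> N%:E).
- exact: measurable_itv.
- move=> n; apply/measurable_EFinP; apply: measurable_funTS; exact: continuous_measurable_fun.
- exact: measurable_cst.
- apply: (negligibleS _ nZ) => x /= hx; apply: contrapT => nZx; apply: hx; rewrite /D /= in_itv/= => xL.
  apply/fine_cvgP; split; first by apply: nearW.
  apply/cvgrPdist_le => a a0; have [n0 hn] := fZ x xL nZx a a0.
  exists n0 => // n /= nn; rewrite sub0r normrN; apply: gle; [exact: ltW|exact: hn].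
- have cN : continuous (fun _ : R => N) by move=> x; exact: cvg_cst.
  have h := continuous_itg (- L) L cN. exact: h.
- apply: aeW => x n /=; rewrite /D /= in_itv/= => xL; rewrite lee_fin; apply: gle => //; exact: fN.
rewrite integral0 in h.
have [n0 _ hn] := (cvgrPdist_lt _ _).1 (fine_cvg h) e e0.
exists n0 => n nn; have := hn n nn; rewrite /= sub0r normrN => hl.
have h1 : itg (- L) L (g n) <= itg (- L) L (f n) by apply: itg_le; [exact: cg|exact: cf|by move=> x _].
apply: le_trans h1; have := ltW hl; rewrite ler_norml => /andP[]; by rewrite /itg /Rintegral.
Qed.

(** Off a neighborhood of x of radius r the test function only meets points of local positivity.
    What is cut away is the test function times a plateau of scale r, and its pairing is arbitrarily
    small for small r, by weak smallness with a = 1. *)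
Lemma locally_positive_not_isolated w x (d : R) : weakly_small w x 1 -> 0 < d ->
  (forall y, 0 < `|y - x| < d -> locally_positive w y) -> locally_positive w x.
Proof.
move=> ws d0 loc; exists (d / 2) => [|psi tpsi p0 hp]; first by rewrite divr_gt0.
have tP := test_plateau (@ltr01 R); have sP := tP.1.
have [k hk] := @weighted_small R w x 1 psi (-2) ws tpsi (ltac:(lra)).
have [A A0 hA] := test_bnd k tP.
apply/ler_addgt0Pr => e e0; rewrite -[leLHS]/0.
(* The plateau of radius 1 vanishes beyond 2, where |y|^(-2 - j) is still at least 2^-(2 + k). *)
pose B := A * 2 ^+ (2 + k).
have B0 : 0 <= B by rewrite /B mulr_ge0// exprn_ge0.
have B1 : 0 < B + 1 by rewrite ltr_wpDl.
have [r0 r00 hr] := hk (e / (B + 1)) (divr_gt0 e0 B1).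
pose r := r0 / 2.
have rp : 0 < r by rewrite divr_gt0.
have rr : 0 < r < r0 by rewrite rp /r; lra.
have h := hr r (plateau 1) B rr sP.
have {h}h : `|w (fun y => psi y * rescale x r (plateau 1) y)| <= e.
  have := h _ _; rewrite expr1 mulVKf ?gt_eqF// => h1.
  apply: le_trans (h1 _ _) _.
  - move=> y; apply: bndAt_le (leqnn k) _ (hA y); rewrite /B ler_peMr// exprn_ege1//; lra.
  - move=> y j y1 jk; have y0 : 0 < `|y| by apply: lt_le_trans y1.
    have [y2|y2] := ltP 2 `|y|.
      have -> : derive1n j (plateau 1) y = 0; last by rewrite normr0 mulr_ge0// powR_ge0.
      apply: (@derive1n_supp R _ 2 j) y2 => z z2; apply: plateau_eq0 => //; rewrite mulr1; exact: ltW.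
    have -> : -2 - j%:R = - (2 + j)%:R :> R by rewrite natrD; ring.
    rewrite powR_invn ?(ltW y0)// ler_pdivlMr ?exprn_gt0//; apply: ler_pM => //.
      exact: hA.
    apply: (@le_trans _ _ (2 ^+ (2 + j))); first by rewrite lerXn2r ?nnegrE.
    by rewrite ler_weXn2l ?leq_add2l//; lra.
  - by rewrite mulrAC ler_pdivrMr// ler_wpM2l ?(ltW e0)// lerDl.
have sr : smooth (rescale x r (plateau 1)) by apply: smooth_rescale; exact: sP.
have s1 : smooth (fun y => 1 - rescale x r (plateau 1) y).
  by apply: smoothB; [exact: smooth_cst|exact: sr].
have t1 : test_function (fun y => psi y * rescale x r (plateau 1) y) by apply: testM; [exact: tpsi|exact: sr].
have t2 : test_function (fun y => psi y * (1 - rescale x r (plateau 1) y)) by apply: testM; [exact: tpsi|exact: s1].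
have : 0 <= w (fun y => psi y * (1 - rescale x r (plateau 1) y)).
  apply: positive_of_local; first exact: t2.
    by move=> y; rewrite mulr_ge0// subr_ge0 plateau_le1.
  move=> y; have [->|yx] := eqVneq y x.
    right; have h1 : \forall z \near x, `|z - x| < r.
      by exists r => // z /=; rewrite distrC.
    apply: filterS h1 => z zr; rewrite /rescale plateau_eq1 ?subrr ?mulr0//.
    by rewrite normrM normfV (gtr0_norm rp) ler_pdivrMr// mul1r ltW.
  have [yd|yd] := ltP `|y - x| d; first by left; apply: loc; rewrite normr_gt0 subr_eq0 yx.
  right; have cn : (fun z : R => `|z - x|) z @[z --> y] --> `|y - x|.
    by apply: cvg_norm; apply: cvgB; [exact: cvg_id|exact: cvg_cst].
  have yd2 : d / 2 < `|y - x| by apply: lt_le_trans yd; lra.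
  have /cvgr_gt/(_ _ yd2) := cn.
  by apply: filterS => z /ltW zd; rewrite hp ?mul0r.
move=> h0; have -> : psi = fun y => psi y * rescale x r (plateau 1) y + psi y * (1 - rescale x r (plateau 1) y).
  by apply/funext => y; ring.
rewrite distD; [|exact: t1|exact: t2].
move: h0 h; rewrite ler_norml => h0 /andP[h _]; lra.
Qed.

(* Baire's theorem on a closed set P without isolated points, the points en n being discarded. *)
Lemma baire_real (P : set R) (C : nat -> set R) (en : nat -> R) (p0 : R) : P p0 ->
  (forall z, ~ P z -> exists2 d : R, 0 < d & forall y, `|y - z| < d -> ~ P y) ->
  (forall n z, ~ C n z -> exists2 d : R, 0 < d & forall y, `|y - z| < d -> ~ C n y) ->
  (forall x (d : R), P x -> 0 < d -> exists y, P y /\ 0 < `|y - x| < d) ->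
  (forall x, P x -> (exists n, C n x) \/ exists n, x = en n) ->
  exists n x, exists2 d : R, P x /\ 0 < d & forall y, P y -> `|y - x| < d -> C n y.
Proof.
move=> Pp0 cP cC iso cov; apply: contrapT => H.
(* Pairs are a centre in P and a radius. Radii at least halve, so the limit of the centres lies
   within twice each radius; hence the factor 2 in the condition of avoidance. *)
pose good n (p q : R * R) := [/\ P q.1, 0 < q.2, q.2 <= p.2 / 2, `|q.1 - p.1| <= p.2 &
  forall z, `|z - q.1| <= 2 * q.2 -> ~ C n z /\ z <> en n].
have step n (p : R * R) : P p.1 -> 0 < p.2 -> exists q, good n p q.
  case: p => x r /= Px r0.
  have [y [Py yx nC]] : exists y, [/\ P y, `|y - x| < r & ~ C n y].
    apply: contrapT => nE; apply: H; exists n, x, r => // y Py yr.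
    by apply: contrapT => nCy; apply: nE; exists y.
  have [d1 d10 hd1] := cC n y nC.
  (* If y happens to be the discarded point, another point of P arbitrarily near y replaces it. *)
  have [y' [Py' yx' nC' ny']] : exists y, [/\ P y, `|y - x| < r, ~ C n y & y != en n].
    have [ye|yne] := eqVneq y (en n); last by exists y.
    have [|y' [Py' /andP[h1 h2]]] := iso y (Num.min d1 (r - `|y - x|)) Py.
      by rewrite lt_min d10 subr_gt0.
    move: h2; rewrite lt_min => /andP[h2 h3]; exists y'; split => //.
    - rewrite -(subrK y y') -addrA; apply: le_lt_trans (ler_normD _ _) _; lra.
    - exact: hd1.
    - by rewrite -ye -subr_eq0 -normr_gt0.
  have [d2 d20 hd2] := cC n y' nC'.
  have n0 : 0 < `|y' - en n| by rewrite normr_gt0 subr_eq0.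
  exists (y', Num.min (r / 2) (Num.min (d2 / 4) (`|y' - en n| / 4))); split => //=.
  - by rewrite !lt_min !divr_gt0.
  - by rewrite ge_min lexx.
  - exact: ltW.
  move=> z zy.
  have zm : `|z - y'| <= d2 / 2 /\ `|z - y'| <= `|y' - en n| / 2.
    have h1 : Num.min (r / 2) (Num.min (d2 / 4) (`|y' - en n| / 4)) <= d2 / 4.
      by rewrite !ge_min lexx orbT.
    have h2 : Num.min (r / 2) (Num.min (d2 / 4) (`|y' - en n| / 4)) <= `|y' - en n| / 4.
      by rewrite !ge_min lexx !orbT.
    split; lra.
  split; first by apply: hd2; lra.
  by move=> ze; case: zm => _; rewrite ze distrC; lra.
pose s n := iteri n (fun n p => xget p [set q | good n p q]) (p0, 1 : R).
have sS n : s n.+1 = xget (s n) [set q | good n (s n) q] by [].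
have inv n : P (s n).1 /\ 0 < (s n).2.
  elim: n => [|n [IH1 IH2]]; first by split.
  have [q hq] := step n (s n) IH1 IH2.
  by have := @xgetPex _ (s n) [set q | good n (s n) q] (ex_intro _ q hq); rewrite -sS => -[].
have sG n : good n (s n) (s n.+1).
  have [q hq] := step n (s n) (inv n).1 (inv n).2.
  by rewrite sS; exact: (@xgetPex _ (s n) [set q | good n (s n) q] (ex_intro _ q hq)).
have [||l hl] := @halving_limit R (fun n => (s n).1) (fun n => (s n).2) 0.
- by move=> n; case: (sG n).
- by move=> n _; case: (sG n).
have small (e : R) : 0 < e -> exists n, (s n).2 < e.
  move=> e0; have hs n : (s n).2 <= 2^-1 ^+ n.
    elim: n => [|n IH]; first by rewrite expr0.
    by case: (sG n) => _ _ h _ _; rewrite exprSr; lra.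
  have h2 : `|2^-1 : R| < 1 by rewrite ger0_norm//; lra.
  have [n _ hn] := (cvgrPdist_lt _ _).1 (cvg_expr h2) e e0.
  exists n; apply: le_lt_trans (hs n) _; have := hn n (leqnn n).
  by rewrite sub0r normrN ger0_norm// exprn_ge0.
have Pl : P l.
  apply: contrapT => /cP[d d0 hd]; have [n hn] := small (d / 2) (ltac:(by rewrite divr_gt0)).
  apply: (hd (s n).1 _ (inv n).1); rewrite distrC; apply: le_lt_trans (hl n isT) _; lra.
have out n : ~ C n l /\ l <> en n by case: (sG n) => _ _ _ _; apply; exact: hl.
by case: (cov l Pl) => -[n hn]; case: (out n).
Qed.

Lemma expr_half_small (e : R) : 0 < e -> exists n0, forall n, (n0 <= n)%N -> 2^-1 ^+ n < e :> R.
Proof.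
move=> e0; have h2 : `|2^-1 : R| < 1 by rewrite ger0_norm//; lra.
have [n0 _ hn] := (cvgrPdist_lt _ _).1 (cvg_expr h2) e e0.
by exists n0 => n nn; have := hn n nn; rewrite sub0r normrN ger0_norm// exprn_ge0.
Qed.

Lemma locally_positive_open w z : locally_positive w z ->
  exists2 d : R, 0 < d & forall y, `|y - z| < d -> locally_positive w y.
Proof.
move=> [d d0 hd]; exists (d / 2); first by rewrite divr_gt0.
move=> y yz; exists (d / 2); first by rewrite divr_gt0.
move=> psi tp p0 hp; apply: hd => // u ud; apply: hp.
have : `|u - z| <= `|u - y| + `|y - z|.
  by apply: le_trans (ler_normD _ _); rewrite addrA subrK.
lra.
Qed.

(** A point where [w] is locally positive lies between the nearest points p and q on either side
    where it is not. These exist because local positivity is an open condition, they lie in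
    [al, be], and the assumed bound holds at both; so [gap_bound] applies to ]p, q[. *)
Lemma gap_extend w chi (K al be N t0 : R) : smooth chi -> (forall x, K < `|x| -> chi x = 0) -> 0 <= K ->
  (forall y, 0 <= chi y) -> (forall y, weakly_small w y 1) -> 0 <= N ->
  ~ locally_positive w al -> ~ locally_positive w be ->
  (forall y t, al <= y <= be -> ~ locally_positive w y -> 0 < t <= t0 ->
     - N <= w (fun u => chi u * gauss_scaled t (u - y))) ->
  forall x t, al <= x <= be -> 0 < t <= t0 -> - N <= w (fun y => chi y * gauss_scaled t (y - x)).
Proof.
move=> sc cK K0 c0 ws N0 Pa Pb hP x t xI tI.
have [Lx|] := pselect (locally_positive w x); last by move=> nx; exact: hP.
have /andP[ax xb] := xI.
pose A : set R := [set y | ~ locally_positive w y /\ al <= y <= x].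
pose B : set R := [set y | ~ locally_positive w y /\ x <= y <= be].
have hA : has_sup A by split; [exists al; split => //; rewrite lexx|exists x => y [_ /andP[]]].
have hB : has_inf B by split; [exists be; split => //; rewrite lexx andbT|exists x => y [_ /andP[]]].
pose p := sup A; pose q := inf B.
have alp : al <= p by apply: ub_le_sup hA.2 _ _; split => //; rewrite lexx.
have qbe : q <= be by apply: ge_inf hB.2 _ _; split => //; rewrite lexx andbT.
have px : p <= x by apply: sup_le_ub => [|y [_ /andP[]]//]; exact: hA.1.
have xq : x <= q by apply: lb_le_inf => [|y [_ /andP[]]//]; exact: hB.1.
have Pp : ~ locally_positive w p.
  move=> /locally_positive_open[d d0 hd]; have [y [Py yI] py] := sup_adherent d0 hA.
  apply: (Py); apply: hd; rewrite ler0_norm ?opprB; last by rewrite subr_le0; exact: (ub_le_sup hA.2 (conj Py yI)).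
  by move: py; rewrite -/p; lra.
have Pq : ~ locally_positive w q.
  move=> /locally_positive_open[d d0 hd]; have [y [Py yI] qy] := inf_adherent d0 hB.
  apply: (Py); apply: hd; rewrite ger0_norm; last by rewrite subr_ge0; exact: (ge_inf hB.2 (conj Py yI)).
  by move: qy; rewrite -/q; lra.
have px' : p < x by rewrite lt_neqAle px andbT; apply/eqP => e; apply: Pp; rewrite e.
have xq' : x < q by rewrite lt_neqAle xq andbT; apply/eqP => e; apply: Pq; rewrite -e.
apply: (@gap_bound R w chi K p q N t0) => //.
- exact: lt_trans xq'.
- move=> y /andP[py yq]; apply: contrapT => Py.
  have [yx|xy] := lerP y x.
    have yI : al <= y <= x by rewrite yx andbT; lra.
    by have := ub_le_sup hA.2 (conj Py yI); rewrite -/p leNgt py.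
  have yI : x <= y <= be by apply/andP; split; lra.
  by have := ge_inf hB.2 (conj Py yI); rewrite -/q leNgt yq.
- by move=> t' tI'; split; apply: hP => //; apply/andP; split; lra.
- by rewrite px xq.
Qed.

Section positivity_theorem.
Variables (w : schwartz_distribution R) (M a b : R) (en : nat -> R) (Z : set R).
Hypotheses (M0 : 0 < M) (Ma : - M < a) (bM : b < M) (nZ : mu.-negligible Z).
Hypotheses (ws : forall x, weakly_small w x 1)
  (out : forall x, ~ (a <= x <= b) -> locally_positive w x).
Let v x t := w (fun y => plateau M y * gauss_scaled t (y - x)).
Hypotheses (lb : forall x, a <= x <= b -> (exists n, x = en n) \/
    exists (L r0 : R), 0 < r0 /\ forall t, 0 < t < r0 -> - L <= v x t)
  (lz : forall x, a <= x <= b -> ~ Z x -> forall e : R, 0 < e ->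
    exists2 r0 : R, 0 < r0 & forall t, 0 < t < r0 -> - e <= v x t).

Let M2 : 0 <= 2 * M. Proof. by rewrite mulr_ge0// ltW. Qed.
Let sP : smooth (plateau M) := (test_plateau M0).1.
Let pK x : 2 * M < `|x| -> plateau M x = 0.
Proof. by move=> xM; apply: plateau_eq0 => //; exact: ltW. Qed.

Lemma transform_continuous t : continuous (fun x => v x t).
Proof. exact: (@continuous_transl R _ _ _ sP pK (smooth_bounded_gauss_scaled t) w). Qed.

(* Fatou's lemma, applied to the approximation of w by its Gaussian transforms *)
Lemma positive_between (al be N t0 : R) : - M <= al -> be <= M -> 0 < t0 -> 0 <= N -> a <= al -> be <= b ->
  (forall x t, al <= x <= be -> 0 < t <= t0 -> - N <= v x t) ->
  forall psi, test_function psi -> (forall y, 0 <= psi y) ->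
    (forall y, ~ (al <= y <= be) -> psi y = 0) -> 0 <= w psi.
Proof.
move=> Mal beM t00 N0 aal beb hv psi tpsi p0 ps.
have [m [C0 [C00 hC0]]] := dist_boundedP w M2.
have [c c0 hc] := @mollified_pairing R (plateau M) M (2 * M) m (ltW M0) sP pK (fun x => plateau_eq1 M0).
have [B B0 hB] := test_bnd m.+1 tpsi.
have psB y : psi y <= B by have := hB y 0%N isT; rewrite /= ger0_norm.
have psM y : M < `|y| -> psi y = 0.
  move=> yM; apply: ps => /andP[y1 y2]; move: yM; rewrite ltNge => /negP; apply.
  by rewrite ler_norml; apply/andP; split; lra.
pose f n x := v x (t0 * 2^-1 ^+ n) * psi x.
have tn (n : nat) : 0 < t0 * 2^-1 ^+ n <= t0.
  by rewrite mulr_gt0 ?exprn_gt0//= ler_piMr ?(ltW t00)// exprn_ile1//; lra.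
apply/ler_addgt0Pr => e e0; have e2 : 0 < e / 2 by rewrite divr_gt0.
have [n1 h1] : exists n1, forall n, (n1 <= n)%N -> - (e / 2) <= itg (- M) M (f n).
  apply: (@itg_liminf M (N * B) Z) => //; first exact: ltW.
  - exact: mulr_ge0.
  - move=> n x; apply: cvgM; first exact: transform_continuous.
    exact: (smooth_continuous tpsi.1).
  - move=> n x _; rewrite /f; have [xI|/ps ->] := pselect (al <= x <= be); last first.
      by rewrite mulr0 oppr_le0 mulr_ge0.
    apply: (@le_trans _ _ (- N * psi x)); last by rewrite ler_wpM2r// hv.
    by rewrite mulNr lerN2 ler_wpM2l.
  - move=> x _ nZx e' e'0; have [xI|/ps nx] := pselect (al <= x <= be); last first.
      by exists 0%N => n _; rewrite /f nx mulr0 oppr_le0 ltW.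
    have B1 : 0 < B + 1 by rewrite ltr_wpDl.
    have [|r0 r00 hr] := @lz x _ nZx (e' / (B + 1)) (divr_gt0 e'0 B1).
      by have /andP[x1 x2] := xI; apply/andP; split; lra.
    have [n0 hn0] := expr_half_small (divr_gt0 r00 t00).
    exists n0 => n nn; rewrite /f.
    apply: (@le_trans _ _ (- (e' / (B + 1)) * psi x)).
      rewrite mulNr lerN2 mulrAC ler_pdivrMr// ler_wpM2l ?(ltW e'0)//.
      by apply: le_trans (psB x) _; rewrite lerDl.
    rewrite ler_wpM2r// hr// mulr_gt0 ?exprn_gt0//=.
    by have := hn0 n nn; rewrite ltr_pdivlMr// mulrC.
pose Q := C0 * (c * t0 * B) + 1.
have Q0 : 0 < Q by rewrite /Q ltr_wpDl// !mulr_ge0// ltW.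
have [n2 h2] := expr_half_small (divr_gt0 e2 Q0).
pose n := maxn n1 n2.
have := hc w C0 hC0 (t0 * 2^-1 ^+ n) psi B (ltac:(by case/andP : (tn n))) tpsi.1 psM hB.
rewrite -/(f n) => h3.
have h4 := h1 n (leq_maxl _ _).
have h5 : C0 * (c * (t0 * 2^-1 ^+ n) * B) <= e / 2.
  have -> : C0 * (c * (t0 * 2^-1 ^+ n) * B) = C0 * (c * t0 * B) * 2^-1 ^+ n by ring.
  apply: (@le_trans _ _ (Q * 2^-1 ^+ n)).
    by rewrite ler_wpM2r ?exprn_ge0// /Q lerDl.
  by have := h2 n (leq_maxr _ _); rewrite ltr_pdivlMr// mulrC => /ltW.
move: h3; rewrite ler_norml => /andP[h3 _].
move: h3 h4 h5; rewrite /f /v; lra.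
Qed.

(* The closed set P where w is not locally positive has no isolated points. If it is not empty, the
   Gaussian transform is bounded below on P near some point of P (Baire), hence also on the gaps
   (gap_extend), and then positive_between makes w positive around points of P. *)
Theorem locally_positive_everywhere x : locally_positive w x.
Proof.
apply: contrapT => Px.
pose P : set R := [set y | ~ locally_positive w y].
have Pab y : P y -> a <= y <= b by move=> Py; apply: contrapT => /out.
have iso y (d : R) : P y -> 0 < d -> exists z, P z /\ 0 < `|z - y| < d.
  move=> Py d0; apply: contrapT => nz; apply: Py; apply: (locally_positive_not_isolated (ws y) d0).
  by move=> z zy; apply: contrapT => Pz; apply: nz; exists z.
(* One integer controls both the lower bound and the range of t. These sets are closed because the
   transform is continuous in its first argument. *)
pose C n : set R := [set y | forall t, 0 < t <= n.+1%:R^-1 -> - n.+1%:R <= v y t].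
have [|||n [p [d [Pp d0] hd]]] := @baire_real P C en x Px _ _ iso.
- by move=> z /contrapT/locally_positive_open[d d0 hd]; exists d => // y /hd yp; apply.
- move=> n z /existsNP[t /not_implyP[tn /negP]]; rewrite -ltNge => vz.
  have /cvgr_lt/(_ _ vz)[d /= d0 hd] := @transform_continuous t z.
  exists d => // y yz Cy; have := Cy t tn; rewrite leNgt hd//=.
  by rewrite distrC.
- move=> y /Pab /lb[[n ->]|[L [r0 [r00 hr]]]]; first by right; exists n.
  left; pose K := Num.max `|L| r0^-1.
  have [n hn] : exists n : nat, K < n.+1%:R.
    exists (Num.truncn K); rewrite truncnS_gt//.
  exists n => t /andP[t0 tn]; have [hL hr0] : `|L| < n.+1%:R /\ r0^-1 < n.+1%:R.
    by move: hn; rewrite gt_max => /andP.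
  apply: (@le_trans _ _ (- L)); first by rewrite lerN2; apply: ltW; apply: le_lt_trans hL; exact: ler_norm.
  apply: hr; rewrite t0/=; apply: le_lt_trans tn _.
  by rewrite -(invrK r0) ltf_pV2 ?posrE ?invr_gt0.
(* Of three points of P in the portion, the middle one would be a point of local positivity. Three
   such points exist since p is not isolated in P. *)
have key al be q : P al -> P be -> P q -> al < q -> q < be -> `|al - p| < d -> `|be - p| < d -> False.
  move=> Pal Pbe Pq alq qbe ald bed; apply: Pq.
  have nn : 0 < n.+1%:R^-1 :> R by rewrite invr_gt0.
  have /andP[a1 b1] := Pab al Pal; have /andP[a2 b2] := Pab be Pbe.
  exists (Num.min (q - al) (be - q)); first by rewrite lt_min !subr_gt0 alq.
  have Mal : - M <= al := le_trans (ltW Ma) a1.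
  have beM : be <= M := le_trans b2 (ltW bM).
  move=> psi tpsi p0 hp; apply: (@positive_between al be n.+1%:R n.+1%:R^-1) => //.
    apply: (@gap_extend w (plateau M) (2 * M) al be n.+1%:R n.+1%:R^-1) => //; try exact: sP.
      by move=> y; exact: plateau_ge0.
    move=> y t /andP[y1 y2] Py; apply: hd => //.
    move: ald bed; rewrite !ltr_norml => /andP[? ?] /andP[? ?]; apply/andP; split; lra.
  move=> y ny; apply: hp; rewrite leNgt lt_min; apply/negP => /andP[].
  rewrite !ltr_norml => /andP[? ?] /andP[? ?]; apply: ny; apply/andP; split; lra.
have [q [Pq /andP[qp qd]]] := iso p d Pp d0.
have [r [Pr /andP[rp rq]]] := iso p `|q - p| Pp qp.
have rd : `|r - p| < d by exact: lt_trans qd.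
have pd : `|p - p| < d by rewrite subrr normr0.
have qp' : q != p by rewrite -subr_eq0 -normr_gt0.
have rp' : r != p by rewrite -subr_eq0 -normr_gt0.
have rq' : r != q by apply/eqP => e; move: rq; rewrite e ltxx.
case: (ltgtP q p) qp' => // h1 _; case: (ltgtP r p) rp' => // h2 _; case: (ltgtP r q) rq' => // h3 _.
- exact: (key r p q).
- exact: (key q p r).
- exact: (key q r p).
- exact: (key q r p).
- exact: (key r q p).
- exact: (key r q p).
- exact: (key p q r).
- exact: (key p r q).
Qed.

End positivity_theorem.

End positivity.

(** * Test classes and the integral *)

Section point_value_consequences.
Context {R : realType}.
Implicit Types (f g chi psi phi : R -> R) (x y t e r : R) (h w W : schwartz_distribution R).
Local Notation mu := (@lebesgue_measure R).

Lemma flat1_nondecreasing x y : x <= y -> flat 1 x <= flat 1 y.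
Proof.
move=> xy; rewrite {1}/flat; case: ifPn => [x0|_]; last exact: flat1_ge0.
have y0 : 0 < y by exact: lt_le_trans xy.
rewrite /flat y0 !hornerE ler_expR lerN2.
by rewrite lef_pV2.
Qed.

Lemma step_nondecreasing x y : x <= y -> smooth_step x <= smooth_step y :> R.
Proof.
move=> xy; rewrite /smooth_step ler_pdivrMr ?flat1_sum_gt0// mulrAC ler_pdivlMr ?flat1_sum_gt0//.
have h1 := flat1_nondecreasing xy.
have h2 : flat 1 (1 - y) <= flat 1 (1 - x) by apply: flat1_nondecreasing; lra.
rewrite !mulrDr mulrC lerD2l; apply: ler_pM => //; exact: flat1_ge0.
Qed.

Lemma Rintegral_derive1_step : \int[mu]_x derive1 (@smooth_step R) x = 1.
Proof.
rewrite (@Rintegral_supp R _ 0 1); last by move=> x; exact: derive1_step_eq0.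
by rewrite itg_FTC2//; [rewrite step_eq1 ?step_eq0 ?subr0|exact: smooth_smooth_step].
Qed.

Lemma point_value_uniq h x (c1 c2 : R) : point_value h x c1 -> point_value h x c2 -> c1 = c2.
Proof.
move=> /point_valueP p1 /point_valueP p2.
apply/eqP; rewrite -subr_eq0 -normr_le0; apply/ler_addgt0Pr => e e0; rewrite add0r.
have e2 : 0 < e / 2 by rewrite divr_gt0.
have [r1 r10 h1] := p1 _ test_derive1_step _ e2.
have [r2 r20 h2] := p2 _ test_derive1_step _ e2.
pose r := Num.min r1 r2 / 2.
have m0 : 0 < Num.min r1 r2 by rewrite lt_min r10.
have r0 : 0 < r by rewrite divr_gt0.
have rm : r < Num.min r1 r2 by rewrite /r; lra.
move: rm; rewrite lt_min => /andP[rr1 rr2].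
have := h1 r; rewrite gtr0_norm// => /(_ r0 rr1).
have := h2 r; rewrite gtr0_norm// => /(_ r0 rr2).
rewrite Rintegral_derive1_step !mulr1; move: (r^-1 * _) => A.
rewrite !ler_norml => /andP[? ?] /andP[? ?]; apply/andP; split; lra.
Qed.

Lemma le_of_approx (A B gc gd e : R) : 0 <= A - B -> `|A - gd| <= e / 2 -> `|B - gc| <= e / 2 ->
  gc <= gd + e.
Proof. rewrite !ler_norml => AB /andP[? ?] /andP[? ?]; lra. Qed.

(** Test [w] on the difference of two smooth steps of width r at c and d, nonnegative because steps
    are nondecreasing. Its derivative is a difference of approximate Dirac masses, so the pairing
    tends to the difference of the point values. *)
Lemma nonneg_derivative_le W w (c d gc gd : R) :
  (forall phi, test_function phi -> w phi = - W (derive1 phi)) ->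
  (forall x, locally_positive w x) -> c <= d -> point_value W c gc -> point_value W d gd -> gc <= gd.
Proof.
move=> wE pos cd pc; move: (cd); rewrite le_eqVlt => /orP[/eqP <- pd|cd' pd].
  by rewrite (point_value_uniq pc pd).
apply/ler_addgt0Pr => e e0; have e2 : 0 < e / 2 by rewrite divr_gt0.
have sS := @smooth_smooth_step R; have tS := test_derive1_step (R := R).
have [r1 r10 h1] := (point_valueP _ _ _).1 pc _ tS _ e2.
have [r2 r20 h2] := (point_valueP _ _ _).1 pd _ tS _ e2.
pose r := Num.min r1 r2 / 2.
have m0 : 0 < Num.min r1 r2 by rewrite lt_min r10.
have r0 : 0 < r by rewrite divr_gt0.
have rm : r < Num.min r1 r2 by rewrite /r; lra.
move: rm; rewrite lt_min => /andP[rr1 rr2].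
pose p y := rescale c r smooth_step y - rescale d r smooth_step y.
have src : smooth (rescale c r smooth_step) by exact: smooth_rescale.
have srd : smooth (rescale d r smooth_step) by exact: smooth_rescale.
have sp : smooth p by exact: smoothB.
have tp : test_function p.
  have hp y : `|c| + `|d| + r < `|y| -> p y = 0.
    move=> yb; have hc := ler_norm c; have hd := ler_norm d.
    have hc' := ler_norm (- c); have hd' := ler_norm (- d); rewrite normrN in hc'; rewrite normrN in hd'.
    rewrite /p /rescale; have [y0|y0] := lerP 0 y.
      move: yb; rewrite (ger0_norm y0) => yb.
      rewrite !step_eq1 ?subrr// ler_pdivlMr// mul1r; have := normr_ge0 c; have := normr_ge0 d; lra.
    move: yb; rewrite (ltr0_norm y0) => yb.
    rewrite !step_eq0 ?subrr// ler_pdivrMr// mul0r; have := normr_ge0 c; have := normr_ge0 d; lra.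
  exact: test_of_support sp hp.
have wp : 0 <= w p.
  apply: positive_of_local => //; last by move=> x; left.
  by move=> y; rewrite subr_ge0; apply: step_nondecreasing; rewrite ler_pM2r ?invr_gt0//; lra.
have tr x : test_function (rescale x r (derive1 smooth_step)) by apply: test_rescale; [rewrite gt_eqF|exact: tS].
have : w p = r^-1 * W (rescale d r (derive1 smooth_step)) - r^-1 * W (rescale c r (derive1 smooth_step)).
  rewrite wE//.
  have -> : derive1 p = fun y => r^-1 * (rescale c r (derive1 smooth_step) y - rescale d r (derive1 smooth_step) y).
    have := derive1nB 1 src srd; rewrite !derive1n1 /p => ->.
    by apply/funext => y; rewrite (derive1_rescale c r sS) (derive1_rescale d r sS) mulrBr.
  rewrite distZ; last by apply: testB; exact: tr.
  by rewrite distB; [rewrite -mulrBr -mulrN opprB|exact: tr|exact: tr].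
move: wp => /[swap] -> wp.
have := h1 r; rewrite gtr0_norm// => /(_ r0 rr1).
have := h2 r; rewrite gtr0_norm// => /(_ r0 rr2).
rewrite Rintegral_derive1_step !mulr1; exact: le_of_approx wp.
Qed.

Lemma powR_nonincreasing (s x y : R) : s <= 0 -> 1 <= x -> x <= y -> y `^ s <= x `^ s.
Proof.
move=> s0 x1 xy; have x0 : 0 < x by exact: lt_le_trans x1.
have y0 : 0 < y by exact: lt_le_trans xy.
rewrite -(opprK s) powRN (powRN x) lef_pV2 ?posrE ?powR_gt0//.
by apply: ge0_ler_powR; rewrite ?oppr_ge0 ?nnegrE ?(ltW x0) ?(ltW y0).
Qed.

Lemma powR_le1 (s x : R) : s <= 0 -> 1 <= x -> x `^ s <= 1.
Proof. by move=> s0 x1; have := powR_nonincreasing s0 (lexx 1) x1; rewrite powR1. Qed.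

(** The decay estimates hold beyond thresholds depending on the order. Between 1 and the threshold
    the derivative is bounded and the power of |y| is bounded away from 0, so one constant serves
    all orders up to k from |y| = 1 on. *)
Lemma T0_bounds phi : T0 phi -> exists2 alpha : R, alpha < -1 & forall k, exists2 B : R, 0 <= B &
  (forall y, bndAt k B phi y) /\
  (forall y j, 1 <= `|y| -> (j <= k)%N -> `|derive1n j phi y| <= B * `|y| `^ (alpha - j%:R)).
Proof.
move=> [sphi _ _ [al al1 hal]]; exists al => //.
have one (j : nat) : exists2 B : R, 0 <= B & (forall y, `|derive1n j phi y| <= B) /\
    forall y, 1 <= `|y| -> `|derive1n j phi y| <= B * `|y| `^ (al - j%:R).
  have [C [M hM]] := hal j; pose N := Num.max 1 M.
  have N1 : 1 <= N by rewrite le_max lexx.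
  have MN : M <= N by rewrite le_max lexx orbT.
  have N0 : 0 < N by exact: lt_le_trans N1.
  have aj : al - j%:R <= 0 by have := ler0n R j; lra.
  have cf : {within `[- N, N], continuous (derive1n j phi)}.
    by apply: continuous_subspaceT; apply: smooth_continuous; exact: smooth_derive1n.
  have [A A0 hA] : exists2 A : R, 0 <= A & forall y, `|y| <= N -> `|derive1n j phi y| <= A.
    have /compact_bounded[A [_ hA]] := continuous_compact cf (@segment_compact R (- N) N).
    exists (`|A| + 1); first by rewrite addr_ge0.
    move=> y yN; apply: (hA (`|A| + 1)); first by rewrite ltr_pwDr// ler_norm.
    by exists y => //=; rewrite in_itv/= -ler_norml.
  pose p := N `^ (al - j%:R); have p0 : 0 < p by exact: powR_gt0.
  have p1 : p <= 1 by exact: powR_le1.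
  exists (A / p + `|C|); first by rewrite addr_ge0// divr_ge0// ltW.
  have mono y : `|y| <= N -> 1 <= `|y| -> p <= `|y| `^ (al - j%:R) by move=> y1 y2; exact: powR_nonincreasing.
  split=> [y|y y1].
    have [yN|/ltW yN] := lerP `|y| N.
      apply: le_trans (hA y yN) _; apply: (@le_trans _ _ (A / p)); last by rewrite lerDl.
      by rewrite ler_pdivlMr// ler_piMr.
    apply: le_trans (hM y (le_trans MN yN)) _; apply: (@le_trans _ _ (`|C|)); last by rewrite lerDr divr_ge0// ltW.
    apply: le_trans (ler_norm _) _; rewrite normrM ler_piMr// ger0_norm ?powR_ge0//.
    by apply: powR_le1 => //; exact: le_trans yN.
  have [yN|/ltW yN] := lerP `|y| N.
    apply: le_trans (hA y yN) _; apply: (@le_trans _ _ (A / p * p)); first by rewrite divfK// gt_eqF.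
    apply: ler_pM => //; [by rewrite divr_ge0// ltW|exact: ltW|by rewrite lerDl|exact: mono].
  apply: le_trans (hM y (le_trans MN yN)) _; rewrite ler_wpM2r ?powR_ge0//.
  by apply: le_trans (ler_norm _) _; rewrite lerDr divr_ge0// ltW.
elim=> [|k [B B0 [h1 h2]]].
  have [B B0 [h1 h2]] := one 0%N; exists B => //; split.
    by move=> y [|//] _; exact: h1.
  by move=> y [|//] y1 _; exact: h2.
have [B' B'0 [h1' h2']] := one k.+1; exists (B + B'); first exact: addr_ge0.
split=> [y j|y j y1]; rewrite leq_eqVlt ltnS => /orP[/eqP ->|jk].
- by apply: le_trans (h1' y) _; rewrite lerDr.
- by apply: le_trans (h1 y j jk) _; rewrite lerDl.
- by apply: le_trans (h2' y y1) _; rewrite ler_wpM2r ?powR_ge0// lerDr.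
- by apply: le_trans (h2 y j y1 jk) _; rewrite ler_wpM2r ?powR_ge0// lerDl.
Qed.

Lemma T0_mass phi : T0 phi -> (forall N, 0 <= N -> itg (- N) N phi <= 1) /\
  forall e, 0 < e -> exists2 N : R, 0 <= N & 1 - e <= itg (- N) N phi.
Proof.
move=> [sphi p0 I1 _]; have cphi := smooth_continuous sphi.
have mphi (D : set R) : measurable_fun D (fun x => (phi x)%:E).
  by apply/measurable_EFinP; apply: measurable_funTS; exact: continuous_measurable_fun.
have itgE N : (itg (- N) N phi)%:E = (\int[mu]_(x in `[(- N)%R, N]) (phi x)%:E)%E.
  rewrite /itg /Rintegral fineK//; apply: integrable_fin_num => //.
  exact: continuous_itg.
split=> [N N0|e e0].
  rewrite -lee_fin itgE -I1; apply: ge0_subset_integral => //.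
  - exact: mphi.
  - by move=> x _; rewrite lee_fin.
pose F (n : nat) := `[(- n%:R), (n%:R : R)]%classic : set R.
have UF : \bigcup_n F n = setT.
  rewrite -subTset => x _; exists (Num.truncn `|x|).+1 => //=.
  by rewrite /F/= in_itv/= -ler_norml ltW// truncnS_gt.
have h := @ge0_nondecreasing_set_cvg_integral _ (measurableTypeR R) R F (fun x => (phi x)%:E) mu.
have : (\int[mu]_(x in F i) (phi x)%:E)%E @[i --> \oo] --> (1 : R)%:E.
  rewrite -I1 -UF; apply: h => //.
  - move=> m n mn; rewrite subsetEset => x; rewrite /F /= !in_itv/= -!ler_norml => xm.
    by apply: le_trans xm _; rewrite ler_nat.
  - by move=> i; exact: measurable_itv.
  - by move=> i; exact: mphi.
  - by move=> i x _; rewrite lee_fin.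
move=> /fine_cvg hc; have [n0 _ hn] := (cvgrPdist_lt _ _).1 hc e e0.
exists n0%:R => //; have := hn n0 (leqnn _); rewrite /= ltr_norml => /andP[_].
rewrite /itg /Rintegral /F; lra.
Qed.

Lemma itg_ge0 p q f : p <= q -> continuous f -> (forall x, 0 <= f x) -> 0 <= itg p q f.
Proof.
move=> pq cf f0; rewrite -(mul0r (q - p)) -(@itg_cst R p q 0 pq).
by apply: itg_le => // x; exact: cvg_cst.
Qed.

(** The normalization of [phi] must survive the cutoff with which it is paired. As |x| < M, the
    plateau is 1 near x, hence on almost all of the mass of [phi] once r is small. *)
Lemma T0_cutoff_mass phi x (M : R) : T0 phi -> `|x| < M -> forall e, 0 < e ->
  exists2 r0 : R, 0 < r0 & forall r, 0 < r < r0 ->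
    `|r^-1 * \int[mu]_y (plateau M y * rescale x r phi y) - 1| <= e.
Proof.
move=> Tphi xM e e0; have M0 : 0 < M by exact: le_lt_trans xM.
have [m1 m2] := T0_mass Tphi; have [N N0 hN] := m2 e e0.
have [sphi p0 _ _] := Tphi; have cphi := smooth_continuous sphi.
have N1 : 0 < N + 1 by rewrite ltr_wpDl.
exists ((M - `|x|) / (N + 1)); first by rewrite divr_gt0// subr_gt0.
move=> r /andP[r0 rM]; have rn : r != 0 by rewrite gt_eqF.
pose Psi y := plateau M (r * y + x) * phi y.
have tP : test_function Psi.
  by apply: testM; [exact: (test_aff x rn (test_plateau M0))|exact: sphi].
have -> : (fun y => plateau M y * rescale x r phi y) = rescale x r Psi.
  apply/funext => y; rewrite /rescale /Psi.
  by have -> : r * ((y - x) / r) + x = y by field.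
have := @Rintegral_rescale R x r Psi rn tP; rewrite (gtr0_norm r0) => ->.
have [L L0 hL] := test_support tP.
pose L' := Num.max L N.
have LL : L <= L' by rewrite le_max lexx.
have NL : N <= L' by rewrite le_max lexx orbT.
have L'0 : 0 <= L' by exact: le_trans NL.
rewrite (@Rintegral_supp R _ (- L') L'); last first.
  move=> y; rewrite -ler_norml => /negP; rewrite -ltNge => yL; apply: hL; exact: le_lt_trans yL.
have cP := smooth_continuous tP.1.
have P0 y : 0 <= Psi y by rewrite mulr_ge0// plateau_ge0.
have up : itg (- L') L' Psi <= 1.
  apply: le_trans (m1 L' L'0); apply: itg_le => // y _.
  by rewrite /Psi ler_piMl// plateau_le1.
have lo : 1 - e <= itg (- L') L' Psi.
  apply: le_trans hN _; rewrite (@itg_split R (- L') L' (- N) _ cP); last by apply/andP; split; lra.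
  rewrite (@itg_split R (- N) L' N _ cP); last by apply/andP; split; lra.
  have -> : itg (- N) N Psi = itg (- N) N phi.
    apply: itg_ext => y; rewrite -ler_norml => yN; rewrite /Psi plateau_eq1 ?mul1r//.
    apply: le_trans (ler_normD _ _) _; rewrite normrM (gtr0_norm r0).
    have : r * `|y| <= r * (N + 1) by rewrite ler_pM2l//; lra.
    by move: rM; rewrite ltr_pdivlMr//; lra.
  have i1 : 0 <= itg (- L') (- N) Psi by apply: itg_ge0 => //; lra.
  have i2 : 0 <= itg N L' Psi by apply: itg_ge0.
  by move: i1 i2; move: (itg _ _ _) (itg _ _ _) (itg _ _ _) => A B D; lra.
rewrite ler_norml; apply/andP; split; lra.
Qed.

(** The passage from test functions to T_0 kernels: after the constant c is subtracted, the
    distribution is weakly small and [weighted_small] applies; the constant is restored through the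
    mass of the kernel. *)
Lemma point_value_T0 h phi x (M c : R) : point_value h x c -> T0 phi -> `|x| < M ->
  forall e, 0 < e -> exists2 r0 : R, 0 < r0 & forall r, 0 < r < r0 ->
    `|r^-1 * h (fun y => plateau M y * rescale x r phi y) - c| <= e.
Proof.
move=> pv Tphi xM e e0; have M0 : 0 < M by exact: le_lt_trans xM.
have [h1 hh1] := dist_cst c; have [h2 hh2] := dist_sub h h1.
have h2E f : h2 f = h f - c * \int[mu]_y f y by rewrite hh2 hh1.
have ws := point_value_weakly_small h2E pv.
have [al al1 hal] := T0_bounds Tphi.
have [k hk] := weighted_small ws (test_plateau M0) al1.
have [B B0 [b1 b2]] := hal k.
have B1 : 0 < B + 1 by rewrite ltr_wpDl.
have e2 : 0 < e / 2 by rewrite divr_gt0.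
have [r1 r10 hr1] := hk (e / 2 / (B + 1)) (divr_gt0 e2 B1).
have c1 : 0 < `|c| + 1 by rewrite ltr_wpDl.
have [r2 r20 hr2] := T0_cutoff_mass Tphi xM (divr_gt0 e2 c1).
have [sphi _ _ _] := Tphi.
exists (Num.min r1 r2); first by rewrite lt_min r10.
move=> r /andP[r0]; rewrite lt_min => /andP[rr1 rr2].
have := hr1 r phi B (ltac:(by rewrite r0)) sphi b1 b2; rewrite expr0 mul1r h2E.
have := hr2 r (ltac:(by rewrite r0)).
move: (\int[mu]_y _) (h _) => I H hI hH.
have -> : r^-1 * H - c = r^-1 * (H - c * I) + c * (r^-1 * I - 1) by ring.
apply: le_trans (ler_normD _ _) _; rewrite (splitr e); apply: lerD.
  by apply: le_trans hH _; rewrite mulrAC ler_pdivrMr// ler_wpM2l ?(ltW e2)// lerDl.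
rewrite normrM; apply: le_trans (ler_wpM2l (normr_ge0 c) hI) _.
by rewrite mulrCA ler_piMr ?(ltW e2)// ler_pdivrMr// mul1r lerDl.
Qed.

(** This single kernel is admissible in both conditions on a pair, so no other kernel is needed in
    the comparison. *)
Lemma T1_gauss : T1 (@gauss_kernel R).
Proof.
have sg := @smooth_gauss_fun R.
have c0 : 0 < (Num.sqrt (@pi R))^-1 by rewrite invr_gt0 sqrt_pi_gt0.
have sk : smooth (@gauss_kernel R) := (smooth_bounded_gauss_kernel).1.
have derK m y : derive1n m (@gauss_kernel R) y = (Num.sqrt pi)^-1 * derive1n m gauss_fun y.
  by have := derive1nZ (Num.sqrt pi)^-1 m sg; rewrite /gauss_kernel => ->.
split; last first.
  move=> x; have d : derive1 (@gauss_kernel R) x = (Num.sqrt pi)^-1 * (- (2 * 1) * (x * gauss_fun x)).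
    rewrite -derive1n1 derK derive1n1; congr (_ * _).
    have -> : @gauss_fun R = gauss_rate 1 by apply/funext => y; rewrite /gauss_fun /gauss_rate mul1r.
    exact: is_derive1E (is_derive_gauss_rate 1 x).
  rewrite d; have -> : x * ((Num.sqrt pi)^-1 * (- (2 * 1) * (x * gauss_fun x))) =
     - ((Num.sqrt pi)^-1 * (2 * (x ^+ 2 * gauss_fun x))) by ring.
  by rewrite oppr_le0 mulr_ge0 ?(ltW c0)// mulr_ge0// mulr_ge0 ?sqr_ge0// expR_ge0.
split; first exact: sk.
- by move=> x; exact: gauss_kernel_ge0.
- rewrite -(@integral_normal_pdf R 0 (1 / Num.sqrt 2)); apply: eq_integral => x _; congr EFin.
  rewrite -(@gauss_scaledE R 1 0 x ltr01) /gauss_scaled invr1 !mul1r sub0r.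
  by rewrite /gauss_kernel /gauss_fun sqrrN.
exists (-2) => [|m]; first by lra.
have [C C0 hC] := @gauss_fun_bound R m; have [C' C'0 hC'] := @gauss_decay R (2 + m).
exists ((Num.sqrt pi)^-1 * (C * C')), 1 => x x1; rewrite derK normrM (gtr0_norm c0) -mulrA ler_pM2l//.
apply: le_trans (hC x m (leqnn m)) _; rewrite -[X in _ <= X]mulrA ler_wpM2l//.
have -> : -2 - m%:R = - (2 + m)%:R :> R by rewrite natrD; ring.
rewrite powR_invn// ler_pdivlMr ?exprn_gt0//; last exact: lt_le_trans x1.
rewrite mulrC; apply: le_trans (hC' x); rewrite ler_wpM2l ?exprn_ge0// ler_expR.
by have := sqr_ge0 x; lra.
Qed.

End point_value_consequences.

(** * The primitive as a pair, and the value of the integral *)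

Section fundamental_theorem.
Context {R : realType}.
Implicit Types (f psi phi : R -> R) (x y z t e r c d : R) (h u v U V w W : schwartz_distribution R).
Implicit Types (G : R -> R) (g : R -> \bar R) (E Z : set R).
Local Notation mu := (@lebesgue_measure R).

Lemma derive1_near0 f y : (\forall z \near y, f z = 0) -> derive1 f y = 0.
Proof.
move=> h; have h0 : \forall z \near y, (fun=> 0) z = f z by apply: filterS h => z ->.
have := near_derive1n 1 h0 => /nbhs_singleton; rewrite !derive1n1 => <-.
exact: derive1_cst.
Qed.

(* H is the restriction of GG - G c to the right of c. *)
Lemma cut_at G GG c : (forall x, point_value GG x (G x)) -> exists H : schwartz_distribution R,
  [/\ forall phi, test_function phi -> (forall y, c <= y -> phi y = 0) -> H phi = 0,
      forall phi e, test_function phi -> 0 < e -> (forall y, y <= c + e -> phi y = 0) ->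
        H phi = GG phi - G c * \int[mu]_y phi y,
      forall x, x <= c -> point_value H x 0
    & forall x, c <= x -> point_value H x (G x - G c)].
Proof.
move=> pG; have [K hK] := dist_cst (G c); have [D hD] := dist_sub GG K.
have DE phi : D phi = GG phi - G c * \int[mu]_y phi y by rewrite hD hK.
have [H [H1 H2 H3]] := cutoff_exists (point_value_weakly_small DE (pG c)).
exists H; split => //.
- by move=> phi e tp e0 hp; rewrite (H2 phi e tp e0 hp) DE.
- move=> x; rewrite le_eqVlt => /orP[/eqP ->|xc]; first exact: H3.
  have [N hN] := dist_cst (0 : R).
  apply: (@point_value_local R N H x 0 (c - x)); [by rewrite subr_gt0| |exact: point_value_cst hN].
  move=> phi tp hp; rewrite hN mul0r; apply/esym/H1 => // y cy; apply: hp.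
  by apply: le_trans (ler_norm _); lra.
- move=> x; rewrite le_eqVlt => /orP[/eqP <-|cx]; first by rewrite subrr.
  have pD : point_value D x (G x - G c).
    exact: point_value_sub hD (pG x) (point_value_cst x hK).
  have d0 : 0 < (x - c) / 2 by rewrite divr_gt0// subr_gt0.
  apply: (point_value_local d0 _ pD) => phi tp hp.
  apply/esym/(H2 _ _ tp d0) => y yc; apply: hp; rewrite distrC.
  by apply: le_trans (ler_norm _); lra.
Qed.

(** The difference of the cuts at c and at d: beyond d the two differ by the constant G d - G c,
    which the derivative does not see. *)
Lemma cut_pair G GG c d : (forall x, point_value GG x (G x)) -> c <= d ->
  exists U : schwartz_distribution R,
  [/\ lojasiewicz_distribution U, point_value U c 0, point_value U d (G d - G c),
      supported_in (dist_derive U) c d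
    & forall x gam, c < x < d -> point_value (dist_derive GG) x gam -> point_value (dist_derive U) x gam].
Proof.
move=> pG cd; have [A [A1 A2 A3 A4]] := cut_at c pG; have [B [B1 B2 B3 B4]] := cut_at d pG.
have [U hU] := dist_sub A B; exists U.
have dU phi : dist_derive U phi = - (A (derive1 phi) - B (derive1 phi)) by rewrite /dist_derive /= hU.
split.
- move=> x; have [xc|cx] := lerP x c.
    by exists (0 - 0); apply: point_value_sub hU _ _; [exact: A3|apply: B3; exact: le_trans cd].
  have [xd|dx] := lerP x d.
    by exists (G x - G c - 0); apply: point_value_sub hU _ _; [apply: A4; exact: ltW|exact: B3].
  exists (G x - G c - (G x - G d)).
  by apply: point_value_sub hU _ _; [apply: A4; exact: ltW|apply: B4; exact: ltW].
- by rewrite -(subr0 0); apply: point_value_sub hU _ _; [exact: A3|exact: B3].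
- by rewrite -(subr0 (_ - _)); apply: point_value_sub hU _ _; [exact: A4|exact: B3].
- move=> x sx; apply: contrapT => xcd; apply: sx.
  have off phi y (V : set R) : tsupp phi `<=` V -> ~ V y -> derive1 phi y = 0.
    by move=> sV nV; apply: tsupp0 => /tsupp_derive1/sV.
  have [xc|cx] := ltP x c.
    exists `]-oo, c[%classic; first by split; [exact: lray_open|rewrite /= in_itv].
    move=> phi tphi sphi; have tp' := test_function_derive1 tphi.
    rewrite dU A1//; last by move=> y cy; apply: (off _ _ _ sphi); rewrite /= in_itv/= => yc; lra.
    rewrite B1 ?subrr ?oppr0// => y dy; apply: (off _ _ _ sphi); rewrite /= in_itv/= => yc; lra.
  have dx : d < x by rewrite ltNge; apply/negP => xd; apply: xcd; rewrite /= in_itv/= cx.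
  have e0 : 0 < (x - d) / 2 by rewrite divr_gt0// subr_gt0.
  exists `](d + x) / 2, +oo[%classic; first by split; [exact: rray_open|rewrite /= in_itv/= andbT; lra].
  move=> phi tphi sphi; have tp' := test_function_derive1 tphi.
  rewrite dU (A2 _ _ tp' e0); last first.
    by move=> y yd; apply: (off _ _ _ sphi); rewrite /= in_itv/= andbT => dy; lra.
  rewrite (B2 _ _ tp' e0); last first.
    by move=> y yd; apply: (off _ _ _ sphi); rewrite /= in_itv/= andbT => dy; lra.
  by rewrite Rintegral_derive1// !mulr0 subrr oppr0.
- move=> x gam /andP[cx xd]; pose m := Num.min (x - c) (d - x).
  have m0 : 0 < m by rewrite lt_min !subr_gt0 cx.
  have [mc md] : m <= x - c /\ m <= d - x by split; rewrite ge_min lexx ?orbT.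
  have m2 : 0 < m / 2 by rewrite divr_gt0.
  have m4 : 0 < m / 4 by rewrite divr_gt0.
  apply: (point_value_local m4) => phi tphi hphi; have tp' := test_function_derive1 tphi.
  have off y : m / 2 <= `|y - x| -> derive1 phi y = 0.
    move=> yx; apply: derive1_near0.
    have cn : (fun z : R => `|z - x|) z @[z --> y] --> `|y - x|.
      by apply: cvg_norm; apply: cvgB; [exact: cvg_id|exact: cvg_cst].
    have yx4 : m / 4 < `|y - x| by lra.
    have /cvgr_gt/(_ _ yx4) := cn.
    by apply: filterS => z /ltW; exact: hphi.
  rewrite dU (A2 _ _ tp' m2); last first.
    by move=> y yc; apply: off; rewrite distrC; apply: le_trans (ler_norm _); lra.
  rewrite B1//; last by move=> y dy; apply: off; apply: le_trans (ler_norm _); lra.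
  by rewrite Rintegral_derive1// mulr0 !subr0.
Qed.

Definition gauss_value u x t : R := affine_pairing (compact_pairing u) x t gauss_kernel.

Lemma affine_compact_pairing u c d (M : R) phi x t : supported_in u c d -> 0 < M -> - M < c -> d < M ->
  smooth phi -> 0 < t ->
  affine_pairing (compact_pairing u) x t phi = t^-1 * u (fun y => plateau M y * rescale x t phi y).
Proof.
move=> su M0 Mc dM sphi t0; rewrite /affine_pairing gtr0_norm//; congr (_ * _).
have sr : smooth (rescale x t phi) by exact: smooth_rescale.
exact: (@compact_pairingE R u c d M _ su M0 Mc dM sr).
Qed.

(** Stated for the difference of transforms. In its uses one of the pairs comes from [cut_pair],
    whose transform converges to a finite value off a countable set; only a limit and a one-sided
    limit are subtracted, and no infinite values compete. *)
Lemma comparison c d u1 U1 u2 U2 (r1 r2 : R) E Z : c <= d -> countable E -> mu.-negligible Z ->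
  supported_in u1 c d -> lojasiewicz_distribution U1 -> dist_eq (dist_derive U1) u1 -> point_value U1 c 0 ->
  supported_in u2 c d -> lojasiewicz_distribution U2 -> dist_eq (dist_derive U2) u2 -> point_value U2 c 0 ->
  point_value U1 d r1 -> point_value U2 d r2 ->
  (forall x, c <= x <= d -> ~ E x -> exists (L r0 : R), 0 < r0 /\
     forall t, 0 < t < r0 -> - L <= gauss_value u1 x t - gauss_value u2 x t) ->
  (forall x, c <= x <= d -> ~ Z x -> forall e, 0 < e -> exists2 r0 : R, 0 < r0 &
     forall t, 0 < t < r0 -> - e <= gauss_value u1 x t - gauss_value u2 x t) ->
  r2 <= r1.
Proof.
move=> cd cE nZ s1 L1 d1 p1 s2 L2 d2 p2 q1 q2 hE hZ.
have [W hW] := dist_sub U1 U2; have [w hw] := dist_sub u1 u2.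
have wW phi : test_function phi -> w phi = - W (derive1 phi).
  by move=> tp; rewrite hw -d1// -d2// hW /dist_derive/=; ring.
pose M := `|c| + `|d| + 1.
have M0 : 0 < M by rewrite /M ltr_wpDl ?addr_ge0.
have Mc : - M < c by rewrite /M; have := lerNnormlW (lexx `|c|); have := normr_ge0 d; lra.
have dM : d < M by rewrite /M; have := ler_norm d; have := normr_ge0 c; lra.
have gE x t : 0 < t -> gauss_value u1 x t - gauss_value u2 x t =
    w (fun y => plateau M y * gauss_scaled t (y - x)).
  move=> t0; have sk : smooth (@gauss_kernel R) := (smooth_bounded_gauss_kernel).1.
  rewrite /gauss_value (affine_compact_pairing x s1 M0 Mc dM sk t0) (affine_compact_pairing x s2 M0 Mc dM sk t0).
  rewrite -mulrBr -hw -distZ; last first.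
    by apply: testM; [exact: test_plateau|apply: smooth_rescale; exact: sk].
  congr (dist_fun w _); apply/funext => y; rewrite /gauss_scaled /rescale (mulrC _ t^-1) mulrCA.
  by rewrite mulrC [(y - x) / t]mulrC; ring.
have pW : point_value W c (0 - 0) by exact: point_value_sub hW p1 p2.
have qW : point_value W d (r1 - r2) by exact: point_value_sub hW q1 q2.
suff pos x : locally_positive w x.
  by have := nonneg_derivative_le wW pos cd pW qW; rewrite subrr subr_ge0.
have [en hen] : exists en : nat -> R, forall y, E y -> exists n, y = en n.
  have /countable_injP[f finj] := cE.
  (* Indices not attained on [E] are sent to 0, which merely allows one more exceptional point. *)
  exists (fun n => xget 0 [set y | E y /\ f y = n]) => y Ey; exists (f y).
  have [Ez fz] := @xgetPex _ 0 [set z | E z /\ f z = f y] (ex_intro _ y (conj Ey erefl)).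
  by apply: finj; rewrite ?inE.
apply: (@locally_positive_everywhere R w M c d en Z) => //.
- move=> y; have [l1 pl1] := L1 y; have [l2 pl2] := L2 y.
  exact: (derivative_weakly_small wW (point_value_sub hW pl1 pl2)).
- move=> y ny; have ns h : supported_in h c d -> ~ dist_supp h y.
    by move=> sh /sh; rewrite /= in_itv.
  have [e1 e10 h1] := not_dist_supp (ns _ s1); have [e2 e20 h2] := not_dist_supp (ns _ s2).
  exists (Num.min e1 e2) => [|phi tp _ hp]; first by rewrite lt_min e10.
  by rewrite hw h1 ?h2 ?subrr// => z hz; apply: hp; rewrite ge_min hz ?orbT.
- move=> y yI; have [Ey|nEy] := pselect (E y); first by left; exact: hen.
  right; have [L [r0 [r00 hr]]] := hE y yI nEy; exists L, r0; split => // t tI.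
  by rewrite -gE; [exact: hr|case/andP: tI].
- move=> y yI nZy e e0; have [r0 r00 hr] := hZ y yI nZy e e0; exists r0 => // t tI.
  by rewrite -gE; [exact: hr|case/andP: tI].
Qed.

Lemma T0_limit u c d x (gam : R) phi : supported_in u c d -> point_value u x gam -> T0 phi ->
  forall e, 0 < e -> exists2 r0 : R, 0 < r0 & forall t, 0 < t < r0 ->
    `|affine_pairing (compact_pairing u) x t phi - gam| <= e.
Proof.
move=> su pu Tphi e e0; pose M := `|c| + `|d| + `|x| + 1.
have M0 : 0 < M by rewrite /M ltr_wpDl ?addr_ge0.
have nc := normr_ge0 c; have nd := normr_ge0 d; have nx := normr_ge0 x.
have Mc : - M < c by rewrite /M; have := lerNnormlW (lexx `|c|); lra.
have dM : d < M by rewrite /M; have := ler_norm d; lra.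
have xM : `|x| < M by rewrite /M; lra.
have [r0 r00 hr] := point_value_T0 pu Tphi xM e0.
exists r0 => // t tI; have /andP[t0 _] := tI; have [sphi _ _ _] := Tphi.
by rewrite (affine_compact_pairing x su M0 Mc dM sphi t0); exact: hr.
Qed.

Lemma countableU (A B : set R) : countable A -> countable B -> countable (A `|` B).
Proof.
move=> cA cB; rewrite -bigcup2E; apply: bigcup_countable => [|[|[|n]] _] //=.
Qed.

Lemma lojasiewicz_integral G GG c d g E : (forall x, point_value GG x (G x)) -> c <= d -> countable E ->
  (forall x, (`[c, d] `\` E) x -> exists2 gam, point_value (dist_derive GG) x gam & g x = gam%:E) ->
  dist_integrable c d g /\ dist_integral c d g = (G d - G c)%:E.
Proof.
move=> pG cd cE hg; have [U [LU Uc Ud sU Ug]] := cut_pair pG cd.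
(* The end points are added because the derivative of [U] may have no point value there. The set is
   countable, hence null, and serves as both exceptional sets of the pairs. *)
pose F := E `|` [set c; d].
have cF : countable F by apply: (countableU cE); exact/finite_set_countable/finite_set2.
have nF : mu.-negligible F.
  apply/negligibleP; [exact: countable_measurable|exact: countable_lebesgue_measure0].
have hF x : c <= x <= d -> ~ F x -> exists2 gam, g x = gam%:E & forall phi, T0 phi -> forall e, 0 < e ->
    exists2 r0 : R, 0 < r0 & forall t, 0 < t < r0 ->
      `|affine_pairing (compact_pairing (dist_derive U)) x t phi - gam| <= e.
  move=> /andP[cx xd] nFx.
  have [|gam pg ->] := hg x.
    by split; [rewrite /= in_itv/= cx|move=> Ex; apply: nFx; left].
  exists gam => // phi Tphi; apply: (T0_limit sU) => //; apply: Ug => //.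
  rewrite !lt_neqAle cx xd !andbT; apply/andP; split; apply/eqP => e; apply: nFx; right; [left|right] => //.
have inF x A : (`[c, d] `\` A) x -> c <= x <= d /\ ~ A x by case; rewrite /= in_itv.
have lowerU x phi : (`[c, d] `\` F) x -> T0 phi -> (g x <= lower_value (dist_derive U) phi x)%E.
  move=> /inF[xI nFx] Tphi; have [gam -> hx] := hF x xI nFx.
  apply: limf_einf_ge => e e0; have [r0 r00 hr] := hx phi Tphi e e0; exists r0 => // t /hr.
  by rewrite ler_norml => /andP[? _]; lra.
have upperU x phi : (`[c, d] `\` F) x -> T0 phi -> (upper_value (dist_derive U) phi x <= g x)%E.
  move=> /inF[xI nFx] Tphi; have [gam -> hx] := hF x xI nFx.
  apply: limf_esup_le => e e0; have [r0 r00 hr] := hx phi Tphi e e0; exists r0 => // t /hr.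
  by rewrite ler_norml => /andP[_ ?]; lra.
have fin x : (`[c, d] `\` F) x -> exists gam, g x = gam%:E.
  by move=> /inF[xI nFx]; have [gam -> _] := hF x xI nFx; exists gam.
have major : major_pair c d g (dist_derive U) U.
  split => //; exists F, F; split => // x phi Fx [Tphi _].
  have [gam gE] := fin x Fx; apply: lt_le_trans (lowerU x phi Fx Tphi); by rewrite gE ltNyr.
have minor : minor_pair c d g (dist_derive U) U.
  split => //; exists F, F; split => // x phi Fx [Tphi _].
  have [gam gE] := fin x Fx; apply: le_lt_trans (upperU x phi Fx Tphi) _; by rewrite gE ltry.
have nU A : mu.-negligible A -> mu.-negligible (A `|` F) by move=> nA; exact: negligibleU.
have T0g := (@T1_gauss R).1.
have majorV r : (exists u V, major_pair c d g u V /\ point_value V d r) -> G d - G c <= r.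
  move=> [u [V [[su LV dV Vc [A [Z [cA nZ hZ hA]]]] Vd]]].
  apply: (@comparison c d u V (dist_derive U) U r (G d - G c) (A `|` F) (Z `|` F)) => //.
  - exact: countableU cA cF.
  - exact: nU.
  - move=> x xI nx; have nA : ~ A x by move=> Ax; apply: nx; left.
    have nFx : ~ F x by move=> Ax; apply: nx; right.
    have [gam _ hx] := hF x xI nFx; have [r1 r10 h1] := hx _ T0g 1 ltr01.
    have : (-oo < lower_value u gauss_kernel x)%E.
      by apply: hA; [split; rewrite //= in_itv|exact: T1_gauss].
    (* A real number strictly below the lower limit, which may be +oo; in the case -oo the
       implication is vacuous. *)
    have [L] : exists L : R, (-oo < lower_value u gauss_kernel x)%E -> (L%:E < lower_value u gauss_kernel x)%E.
      case: (lower_value _ _ _) => [s| |]; last by exists 0.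
        by exists (s - 1) => _; rewrite lte_fin; lra.
      by exists 0 => _; rewrite ltry.
    move=> /[apply]/limf_einf_gt[r2 r20 h2].
    exists (- (L - gam - 1)), (Num.min r1 r2); split; first by rewrite lt_min r10.
    move=> t /andP[t0]; rewrite lt_min => /andP[t1 t2].
    have := h1 t (ltac:(by rewrite t0)); have := h2 t (ltac:(by rewrite t0)).
    rewrite /gauss_value opprK ler_norml => ? /andP[_ ?]; lra.
  - move=> x xI nx e e0; have nZx : ~ Z x by move=> Ax; apply: nx; left.
    have nFx : ~ F x by move=> Ax; apply: nx; right.
    have e2 : 0 < e / 2 by rewrite divr_gt0.
    have [gam gE hx] := hF x xI nFx; have [r1 r10 h1] := hx _ T0g _ e2.
    have : ((gam - e / 2)%:E < lower_value u gauss_kernel x)%E.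
      apply: (@lt_le_trans _ _ gam%:E); first by rewrite lte_fin; lra.
      by rewrite -gE; apply: hZ => //; split; rewrite //= in_itv.
    move=> /limf_einf_gt[r2 r20 h2].
    exists (Num.min r1 r2); first by rewrite lt_min r10.
    move=> t /andP[t0]; rewrite lt_min => /andP[t1 t2].
    have := h1 t (ltac:(by rewrite t0)); have := h2 t (ltac:(by rewrite t0)).
    rewrite /gauss_value ler_norml => ? /andP[_ ?]; lra.
have minorV r : (exists u V, minor_pair c d g u V /\ point_value V d r) -> r <= G d - G c.
  move=> [u [V [[su LV dV Vc [A [Z [cA nZ hZ hA]]]] Vd]]].
  apply: (@comparison c d (dist_derive U) U u V (G d - G c) r (A `|` F) (Z `|` F)) => //.
  - exact: countableU cA cF.
  - exact: nU.
  - move=> x xI nx; have nA : ~ A x by move=> Ax; apply: nx; left.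
    have nFx : ~ F x by move=> Ax; apply: nx; right.
    have [gam _ hx] := hF x xI nFx; have [r1 r10 h1] := hx _ T0g 1 ltr01.
    have : (upper_value u gauss_kernel x < +oo)%E.
      by apply: hA; [split; rewrite //= in_itv|exact: T1_gauss].
    have [L] : exists L : R, (upper_value u gauss_kernel x < +oo)%E -> (upper_value u gauss_kernel x < L%:E)%E.
      case: (upper_value _ _ _) => [s| |]; last by exists 0 => _; rewrite ltNyr.
        by exists (s + 1) => _; rewrite lte_fin; lra.
      by exists 0.
    move=> /[apply]/limf_esup_lt[r2 r20 h2].
    exists (- (gam - 1 - L)), (Num.min r1 r2); split; first by rewrite lt_min r10.
    move=> t /andP[t0]; rewrite lt_min => /andP[t1 t2].
    have := h1 t (ltac:(by rewrite t0)); have := h2 t (ltac:(by rewrite t0)).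
    rewrite /gauss_value opprK ler_norml => ? /andP[? _]; lra.
  - move=> x xI nx e e0; have nZx : ~ Z x by move=> Ax; apply: nx; left.
    have nFx : ~ F x by move=> Ax; apply: nx; right.
    have e2 : 0 < e / 2 by rewrite divr_gt0.
    have [gam gE hx] := hF x xI nFx; have [r1 r10 h1] := hx _ T0g _ e2.
    have : (upper_value u gauss_kernel x < (gam + e / 2)%:E)%E.
      apply: (@le_lt_trans _ _ gam%:E); last by rewrite lte_fin; lra.
      by rewrite -gE; apply: hZ => //; split; rewrite //= in_itv.
    move=> /limf_esup_lt[r2 r20 h2].
    exists (Num.min r1 r2); first by rewrite lt_min r10.
    move=> t /andP[t0]; rewrite lt_min => /andP[t1 t2].
    have := h1 t (ltac:(by rewrite t0)); have := h2 t (ltac:(by rewrite t0)).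
    rewrite /gauss_value ler_norml => ? /andP[? _]; lra.
have supE : ereal_sup (minor_values c d g) = (G d - G c)%:E.
  apply/eqP; rewrite eq_le; apply/andP; split.
    by apply: ge_ereal_sup => _ [r hr <-]; rewrite lee_fin; exact: minorV.
  by apply: ereal_sup_ubound; exists (G d - G c) => //; exists (dist_derive U), U.
have infE : ereal_inf (major_values c d g) = (G d - G c)%:E.
  apply/eqP; rewrite eq_le; apply/andP; split.
    by apply: ereal_inf_lbound; exists (G d - G c) => //; exists (dist_derive U), U.
  by apply: le_ereal_inf_tmp => _ [r hr <-]; rewrite lee_fin; exact: majorV.
split; last exact: supE.
by split; [exists (dist_derive U), U|exists (dist_derive U), U|rewrite supE infE].
Qed.

End fundamental_theorem.

Theorem theorem6p5 (R : realType) (G : R -> R) (GG : schwartz_distribution R)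
    (hG : associated_distribution G GG)
    (a b : R) (hab : a <= b) (E : set R) (hE : countable E)
    (g : R -> \bar R)
    (hg : forall x : R, (`[a, b] `\` E) x ->
       exists2 gamma : R, point_value (dist_derive GG) x gamma & g x = gamma%:E) :
  dist_integrable a b g /\
  (forall c d : R, a <= c -> c <= d -> d <= b ->
     dist_integrable c d g /\ dist_integral c d g = (G d - G c)%:E).
Proof.
have key c d : a <= c -> c <= d -> d <= b ->
    dist_integrable c d g /\ dist_integral c d g = (G d - G c)%:E.
  move=> ac cd db; apply: (lojasiewicz_integral hG.2 cd hE) => x [xI nEx]; apply: hg; split => //.
  move: xI; rewrite /= !in_itv/= => /andP[cx xd].
  by rewrite (le_trans ac cx) (le_trans xd db).
by split; [exact: (key a b (lexx _) hab (lexx _)).1|exact: key].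
Qed.
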